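(* Suppose $\theta>0$ and $\alpha>-1$, and let $N\in\mathbb{N}$. Then, for any partition $\lambda$ with $l(\lambda)\le N$ and any $\mathbf{x}_N\in W_{\ge}^N$, $$[\Lambda_{\theta,\alpha,N}^{N}P_\lambda^\theta](\mathbf{x}_N)=c(\lambda,N,\theta;\alpha)\,P_\lambda^\theta(\mathbf{x}_N),$$ where $$c(\lambda,N,\theta;\alpha)=\prod_{i=1}^{N}\frac{((N+\alpha+1-i)\theta)_{\lambda_i}}{((N+\alpha+2-i)\theta)_{\lambda_i}}.$$
   Context: $W_{\ge}^N=\{(x_1,\dots,x_N)\in[0,\infty)^N: x_1\le\cdots\le x_N\}$; $(x)_r=\Gamma(x+r)/\Gamma(x)$; for a partition $\lambda=(\lambda_1\ge\lambda_2\ge\cdots)$, $l(\lambda)$ is its length and $|\lambda|=\sum_i\lambda_i$. For a kernel $K$ and function $f$, $[Kf](\mathbf{x})=\int f(\mathbf{y})K(\mathbf{x},d\mathbf{y})$. Kernel $\Lambda_{\theta,\alpha,N}^{N}$ (from $W_{\ge}^N$ to $W_{\ge}^N$): for $\mathbf{x}=(x_1,\dots,x_N)\in W_{\ge}^N$, put $x_0=0$; $\Lambda_{\theta,\alpha,N}^{N}(\mathbf{x},\cdot)$ is the distribution on $W_{\ge}^N$ of the (ordered) roots of the random polynomial $y\mapsto\sum_{i=0}^{N}w_i\prod_{0\le j\le N,\,j\ne i}(y-x_j)$, where $(w_0,\dots,w_N)$ has the Dirichlet distribution with parameters $(s_0,\dots,s_N)$, $s_0=(\alpha+1)\theta$,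 $s_1=\cdots=s_N=\theta$. Jack polynomial $P_\lambda^\theta(\mathbf{x}_N)$, $l(\lambda)\le N$: the symmetric polynomial in $N$ variables of the form $x_1^{\lambda_1}\cdots x_N^{\lambda_N}+\cdots$ (monomial symmetric function $m_\lambda$ with coefficient $1$ plus a combination of $m_\mu$, $|\mu|=|\lambda|$, $\mu$ strictly below $\lambda$ in dominance order) that is an eigenfunction of $D_2^N=\sum_{i=1}^N x_i^2\frac{\partial^2}{\partial x_i^2}+2\theta\sum_{i=1}^N\sum_{j\ne i}\frac{x_i^2}{x_i-x_j}\frac{\partial}{\partial x_i}$, with eigenvalue $2B(\lambda')-2\theta B(\lambda)+2\theta(N-1)|\lambda|$, where $B(\lambda)=\sum_i(i-1)\lambda_i$ and $\lambda'$ is the conjugate partition. *)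

(* Defs.v *)
From HB Require Import structures.
From mathcomp Require Import all_boot all_order all_algebra.
From mathcomp Require Import all_classical all_reals all_analysis.
(* The notations of mpoly clash with those of the analysis library. *)
From mathcomp.multinomials Require Import (canonicals, coercions) mpoly.

Set Implicit Arguments.
Unset Strict Implicit.
Unset Printing Implicit Defensive.
Import Order.TTheory GRing.Theory Num.Theory.
Import numFieldNormedType.Exports.

Local Open Scope classical_set_scope.
Local Open Scope ring_scope.

Section lebesgue_tuple.
Context (R : realType) (n : nat).

Definition cons_pair (p : measurableTypeR R * n.-tuple R) : n.+1.-tuple R :=
  [tuple of p.1 :: p.2].

Definition uncons_tuple (v : n.+1.-tuple R) : measurableTypeR R * n.-tuple R :=
  (thead v, [tuple of behead v]).

Lemma cons_pairK : cancel cons_pair uncons_tuple.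
Proof. by case=> t v; congr (_, _); apply: val_inj. Qed.

Lemma measurable_cons_pair :
  measurable_fun [set: measurableTypeR R * n.-tuple R] cons_pair.
Proof. exact: measurable_cons. Qed.

Lemma measurable_uncons_tuple :
  measurable_fun [set: n.+1.-tuple R] uncons_tuple.
Proof.
apply/measurable_fun_pairP; split; last exact: measurable_behead.
exact: measurable_tnth.
Qed.

Variable mu : {sigma_finite_measure set (n.-tuple R) -> \bar R}.

Definition lebesgue_cons : set (n.+1.-tuple R) -> \bar R :=
  pushforward (@lebesgue_measure R \x mu)%E cons_pair.

Let lebesgue_cons0 : lebesgue_cons set0 = 0.
Proof. by rewrite /lebesgue_cons /pushforward preimage_set0 measure0. Qed.

Let lebesgue_cons_ge0 A : (0 <= lebesgue_cons A)%E.
Proof. by rewrite /lebesgue_cons /pushforward; exact: measure_ge0. Qed.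

Let lebesgue_cons_sigma_additive : semi_sigma_additive lebesgue_cons.
Proof.
move=> F mF tF mUF; rewrite /lebesgue_cons /pushforward preimage_bigcup.
apply: measure_semi_sigma_additive.
- by move=> k; rewrite -[X in measurable X]setTI; exact: measurable_cons_pair.
- apply/trivIsetP => /= i j _ _ ij; rewrite -preimage_setI.
  by move/trivIsetP : tF => /(_ _ _ _ _ ij) ->//; rewrite preimage_set0.
- rewrite -preimage_bigcup -[X in measurable X]setTI.
  exact: measurable_cons_pair.
Qed.

HB.instance Definition _ := isMeasure.Build _ _ _ lebesgue_cons
  lebesgue_cons0 lebesgue_cons_ge0 lebesgue_cons_sigma_additive.

Let lebesgue_cons_sigma_finite : sigma_finite [set: n.+1.-tuple R] lebesgue_cons.
Proof.
have /sigma_finiteP[F [FT ndF mF]] := sigma_finiteT (@lebesgue_measure R).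
have /sigma_finiteP[G [GT ndG mG]] := sigma_finiteT mu.
exists (fun k => uncons_tuple @^-1` (F k `*` G k)).
  apply/esym; rewrite -preimage_bigcup -subTset => v _ /=.
  have [i _ Fi] : (\bigcup_k F k) (uncons_tuple v).1 by rewrite -FT.
  have [j _ Gj] : (\bigcup_k G k) (uncons_tuple v).2 by rewrite -GT.
  exists (maxn i j) => //; split.
    by move: Fi; exact/subsetPset/ndF/leq_maxl.
  by move: Gj; exact/subsetPset/ndG/leq_maxr.
move=> k; have [mFk Fk] := mF k; have [mGk Gk] := mG k; split.
  rewrite -[X in measurable X]setTI; apply: measurable_uncons_tuple => //.
  exact: measurableX.
rewrite /lebesgue_cons /pushforward -comp_preimage.
rewrite (_ : _ \o _ = id); last by apply/funext => p; rewrite /= cons_pairK.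
by rewrite preimage_id product_measure1E// lte_mul_pinfty// ge0_fin_numE.
Qed.

HB.instance Definition _ := Measure_isSigmaFinite.Build _ _ _ lebesgue_cons
  lebesgue_cons_sigma_finite.

End lebesgue_tuple.

(* Lebesgue measure on R^n, with its product sigma-algebra; the library only
   has binary products. *)
Fixpoint lebesgue_tuple (R : realType) (n : nat) :
    {sigma_finite_measure set (n.-tuple R) -> \bar R} :=
  match n with
  | 0%N => dirac [tuple]
  | n'.+1 => lebesgue_cons (lebesgue_tuple R n')
  end.

Section special_functions.
Context {R : realType}.

Definition Gamma (x : R) : R :=
  \int[lebesgue_measure]_(t in `]0, +oo[) (t `^ (x - 1) * expR (- t)).

Definition pochhammer (x r : R) : R := Gamma (x + r) / Gamma x.

End special_functions.

Section kernel.
Context {R : realType}.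

Definition weyl_chamber N : set (N.-tuple R) :=
  [set x | (forall i, 0 <= tnth x i) /\
           (forall i j : 'I_N, (i <= j)%N -> tnth x i <= tnth x j)].

(* The point of the hyperplane w_0 + ... + w_N = 1 with (w_1, ..., w_N) = v. *)
Definition barycentric N (v : N.-tuple R) : N.+1.-tuple R :=
  [tuple of 1 - \sum_(i < N) tnth v i :: v].

Definition open_simplex N : set (N.+1.-tuple R) :=
  [set w | (forall i, 0 < tnth w i) /\ \sum_(i < N.+1) tnth w i = 1].

Definition dirichlet_density N (s : 'I_N.+1 -> R) (w : N.+1.-tuple R) : R :=
  Gamma (\sum_i s i) / \prod_i Gamma (s i) * \prod_i tnth w i `^ (s i - 1).

(* The Dirichlet distribution of (w_0, ..., w_N) has its density with respect
   to dw_1 ... dw_N on the simplex. *)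
Definition dirichlet N (s : 'I_N.+1 -> R) : set (N.+1.-tuple R) -> \bar R :=
  fun A => (\int[lebesgue_tuple R N]_(v in
    @barycentric N @^-1` (@open_simplex N `&` A))
    (dirichlet_density s (barycentric v))%:E)%E.

Definition random_poly N (x : N.-tuple R) (w : N.+1.-tuple R) : {poly R} :=
  \sum_(i < N.+1) tnth w i *:
    \prod_(j < N.+1 | j != i) ('X - (tnth [tuple of 0 :: x] j)%:P).

(* The roots, with multiplicity, of a monic polynomial of degree N that splits
   over R; an arbitrary value otherwise. *)
Definition ordered_roots N (p : {poly R}) : N.-tuple R :=
  xget [tuple of nseq N 0]
    [set y : N.-tuple R | sorted <=%R y /\ p = \prod_(a <- y) ('X - a%:P)].

Definition Lambda_weights (theta alpha : R) N (i : 'I_N.+1) : R :=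
  if i == ord0 then (alpha + 1) * theta else theta.

Definition Lambda (theta alpha : R) N (x : N.-tuple R) :
    set (N.-tuple R) -> \bar R :=
  pushforward (dirichlet (@Lambda_weights theta alpha N))
    (fun w => ordered_roots N (random_poly x w)).

Definition kernel_action N (K : N.-tuple R -> set (N.-tuple R) -> \bar R)
    (f : N.-tuple R -> R) (x : N.-tuple R) : \bar R :=
  (\int[K x]_(y in @weyl_chamber N) (f y)%:E)%E.

End kernel.

(* A partition is the sequence of its positive parts: lambda_i is
   nth 0 la i.-1, and l(lambda) is size la. *)
Definition is_partition (la : seq nat) : bool := sorted geq la && (0%N \notin la).

Definition conj_partition (la : seq nat) : seq nat :=
  [seq count (fun p => j < p)%N la | j <- iota 0 (head 0%N la)].

Definition partition_B (la : seq nat) : nat :=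
  (\sum_(i < size la) i * nth 0 la i)%N.

Definition dominance_lt (mu la : seq nat) : Prop :=
  [/\ mu <> la, sumn mu = sumn la &
      forall k, (sumn (take k mu) <= sumn (take k la))%N].

Section jack.
Context {R : realType} (N : nat).
Local Notation mpolyRN := (mpoly.mpoly N R).

Definition peval (P : mpolyRN) (x : N.-tuple R) : R := mpoly.meval (tnth x) P.

(* The monomial symmetric polynomial m_mu in N variables, which is 0 when
   l(mu) > N. *)
Definition monomial_sym (mu : seq nat) : mpolyRN :=
  \sum_(m : mpoly.bmultinom N (sumn mu).+1 |
        perm_eq (mpoly.multinom_val m) (mu ++ nseq (N - size mu) 0%N))
    mpoly.mpolyX R m.

(* The value at x of D_2^N P, for x with pairwise distinct coordinates. *)
Definition D2 (theta : R) (P : mpolyRN) (x : N.-tuple R) : R :=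
  \sum_(i < N) tnth x i ^+ 2 * peval (mpoly.mderiv i (mpoly.mderiv i P)) x +
  2 * theta * \sum_(i < N) \sum_(j < N | j != i)
    tnth x i ^+ 2 / (tnth x i - tnth x j) * peval (mpoly.mderiv i P) x.

Definition D2_eigenvalue (theta : R) (la : seq nat) : R :=
  2 * (partition_B (conj_partition la))%:R - 2 * theta * (partition_B la)%:R
  + 2 * theta * (N%:R - 1) * (sumn la)%:R.

Definition is_jack (theta : R) (la : seq nat) (P : mpolyRN) : Prop :=
  [/\ P \is @mpoly.symmetric N R,
      exists (mus : seq (seq nat)) (u : seq nat -> R),
        (forall mu, mu \in mus -> is_partition mu /\ dominance_lt mu la) /\
        P = monomial_sym la + \sum_(mu <- mus) u mu *: monomial_sym mu &
      forall x : N.-tuple R, injective (tnth x) ->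
        D2 theta P x = D2_eigenvalue theta la * peval P x].

Definition jack_coef (la : seq nat) (theta alpha : R) : R :=
  \prod_(1 <= i < N.+1)
    (pochhammer ((N%:R + alpha + 1 - i%:R) * theta) (nth 0%N la i.-1)%:R /
     pochhammer ((N%:R + alpha + 2 - i%:R) * theta) (nth 0%N la i.-1)%:R).

End jack.

(* Main.v *)
(** A symmetric polynomial is [P = g(e_1, ..., e_N)].  If [w] is a point of the simplex and
    [y_1, ..., y_N] are the roots of [sum_a w_a prod_(j != a) (t - x_j)], with [x_0 = 0],
    then comparing coefficients shows that [e_k(y)] is a polynomial in [x] whose
    coefficients are linear in [w]; so [P(y) = F(x, w)] for a polynomial [F], and averaging
    over the Dirichlet weights only involves Dirichlet moments: it maps [P] to a polynomial
    [G] in [x].  The integral operator intertwines [D_2^N] with itself: [D_2^N] acting on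
    [F] in the variable [x], minus a second order operator in [w] whose Dirichlet mean
    vanishes by parts, equals [D_2^N] acting on [P] at the point [y].  Since both sides are
    second order differential operators in [P], it suffices to check this on the [e_k] and
    on the products [e_k e_l], that is, on their generating polynomials, where it is a
    rational identity.  So [G] is an eigenfunction of [D_2^N] with the eigenvalue of the
    Jack polynomial, and all its monomials are dominated by [lambda].  The eigenvalues of
    strictly dominated exponents are smaller, hence [G = c P].  The constant [c] is the
    coefficient of [x^lambda] in [G], the Dirichlet mean of
    [prod_k (w_0 + w_(k+1) + ... + w_N)^(lambda_k - lambda_(k+1))].

    On the analytic side, Euler's beta integral gives the Dirichlet moments, and the roots
    [y] are measurable in [w] because they interlace with the [x_j]: [y_k >= c] is decided
    by the sign of the random polynomial at [c]. *)

From HB Require Import structures.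
Require Import Defs.
From mathcomp Require Import all_boot all_order all_algebra.
From mathcomp Require Import all_classical all_reals all_analysis.
From mathcomp.multinomials Require Import -(notations) mpoly.
From mathcomp Require Import measurable_realfun.
From mathcomp Require Import ring lra zify.

Set Implicit Arguments.
Unset Strict Implicit.
Unset Printing Implicit Defensive.
Import Order.TTheory GRing.Theory Num.Theory.
Import numFieldNormedType.Exports.

Local Open Scope ring_scope.

(** * Second order operators *)

(** Why an operator in w is needed: the summand of w_a misses the node x_a, while D_2^N in x still
    has its poles there. The edge operators of the simplex, with coefficients - x_a x_b / (x_a -
    x_b)^2, remove this excess. These coefficients vanish at the node x_0 = 0, so only the
    parameters s_1 = ... = s_N = theta enter the intertwining, and alpha is felt only through the
    Dirichlet mean.

    The poles also shape the proof: the eigenvalue equation of a Jack polynomial is available only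
    at distinct coordinates. The differential identities are therefore proved at 0 < x_1 < ... <
    x_N, where interlacing is strict and the roots y are distinct, and they lead to an identity of
    polynomials, which holds on the whole chamber.

    Two orders on exponents are used. Dominance controls supports; the monomial order of [mlead]
    gives any nonzero polynomial, symmetric or not, a leading exponent from which its eigenvalue is
    read off. The eigenvalue of P is identified in this way too, so [D2_eigenvalue] is never
    expanded. *)

(** Vanishing of the triple commutator of [D] with multiplications, taken at 1: for a ring morphism
    [phi], a differential operator of order at most two along [phi] without zeroth order term. The
    condition is linear in [D], so that two operators over the same [phi] can be subtracted. *)
Definition second_order (C R : comNzRingType) (phi D : C -> R) := forall f g h,
  D (f * g * h) = phi f * D (g * h) + phi g * D (f * h) + phi h * D (f * g)
    - phi f * phi g * D h - phi f * phi h * D g - phi g * phi h * D f.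

Lemma second_orderB (C R : comNzRingType) (phi D D' : C -> R) :
  second_order phi D -> second_order phi D' ->
  second_order phi (fun f => D f - D' f).
Proof. by move=> hD hD' f g h; rewrite hD hD'; ring. Qed.

Lemma second_order_comp (B C R : comNzRingType) (psi : B -> C) (phi D : C -> R) :
  {morph psi : f g / f * g} ->
  second_order phi D -> second_order (phi \o psi) (D \o psi).
Proof. by move=> psiM hD f g h; rewrite /= !psiM hD. Qed.

Section diffusion.
Variables (C R : comNzRingType) (phi : C -> R) (I : finType).
Variables (d : I -> C -> C) (a b : I -> R).
Hypothesis phiD : {morph phi : f g / f + g}.
Hypothesis phiM : {morph phi : f g / f * g}.
Hypothesis dD : forall k, {morph d k : f g / f + g}.
Hypothesis dM : forall k f g, d k (f * g) = d k f * g + f * d k g.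

(** The coefficients are scalars because the operator is only considered after the evaluation [phi];
    poles such as 1 / (x_i - x_j) then need no rational functions. *)
Definition diffusion f := \sum_k (a k * phi (d k (d k f)) + b k * phi (d k f)).

Definition carre_du_champ f g := \sum_k a k * (phi (d k f) * phi (d k g)).

Lemma diffusionD f g : diffusion (f + g) = diffusion f + diffusion g.
Proof.
rewrite /diffusion -big_split; apply: eq_bigr => k _ /=.
by rewrite !(dD, phiD); ring.
Qed.

Lemma diffusionM f g : diffusion (f * g) =
  phi f * diffusion g + phi g * diffusion f + 2 * carre_du_champ f g.
Proof.
rewrite /diffusion /carre_du_champ !mulr_sumr -!big_split.
by apply: eq_bigr => k _ /=; rewrite !(dM, dD, phiD, phiM); ring.
Qed.

Lemma diffusion_scale c f :
  (forall k, d k c = 0) -> diffusion (c * f) = phi c * diffusion f.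
Proof.
move=> dc; rewrite /diffusion mulr_sumr; apply: eq_bigr => k _.
have dcf g : d k (c * g) = c * d k g by rewrite dM dc mul0r add0r.
by rewrite !dcf !phiM; ring.
Qed.

Lemma carre_du_champM f g h :
  carre_du_champ (f * g) h = phi f * carre_du_champ g h + phi g * carre_du_champ f h.
Proof.
rewrite /carre_du_champ !mulr_sumr -!big_split.
by apply: eq_bigr => k _ /=; rewrite dM phiD !phiM; ring.
Qed.

Lemma second_order_diffusion : second_order phi diffusion.
Proof. by move=> f g h; rewrite !diffusionM carre_du_champM phiM; ring. Qed.

End diffusion.

(* A second order operator over an evaluation is determined by its values on the
   variables and on the products of two variables. *)
Lemma second_order_eq0 n (R : comNzRingType) (phi D : mpoly n R -> R) :
  second_order phi D -> (forall c f g, D (c *: f + g) = c * D f + D g) ->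
  D 1 = 0 -> (forall i, D (mpolyX R (mnm1 i)) = 0) ->
  (forall i j, D (mpolyX R (mnm1 i) * mpolyX R (mnm1 j)) = 0) ->
  forall f, D f = 0.
Proof.
move=> hD linD D1 DX DXX.
have D0 : D 0 = 0.
  by have := linD (-1) 0 0; rewrite scaler0 addr0 mulN1r addNr.
suff Dm k m : (mdeg m < k)%N -> D (mpolyX R m) = 0.
  move=> f; rewrite (mpolyE f); elim: (msupp f) => [|m s IH].
    by rewrite big_nil.
  by rewrite big_cons linD IH (Dm (mdeg m).+1) // mulr0 addr0.
elim: k m => // k IH m mk.
have split_mnm (m' : multinom n) : mdeg m' != 0%N ->
    exists i m'', m' = mnm_add (mnm1 i) m'' /\ mdeg m' = (mdeg m'').+1.
  move=> hm'; have [i hi] : exists i, m' i != 0%N.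
    apply/existsP; apply: contraR hm'; rewrite negb_exists => /forallP h.
    by rewrite mdegE big1 // => i _; apply/eqP/negPn/h.
  exists i, (mnm_sub m' (mnm1 i)).
  have e : m' = mnm_add (mnm1 i) (mnm_sub m' (mnm1 i)).
    by rewrite addmC submK // lep1mP.
  by split=> //; rewrite {1}e mdegD mdeg1.
have [/eqP|/split_mnm[i [m1 [em e1]]]] := eqVneq (mdeg m) 0%N.
  by rewrite mdeg_eq0 => /eqP ->; rewrite mpolyX0.
have [/eqP|/split_mnm[j [m2 [e e2]]]] := eqVneq (mdeg m1) 0%N.
  by rewrite mdeg_eq0 em => /eqP ->; rewrite addm0.
(* With two variables split off, [second_order] expresses [D] at this monomial through [D] at
   monomials of smaller degree. *)
rewrite em e !mpolyXD mulrA hD DXX DX DX -!mpolyXD !IH ?mdegD ?mdeg1; first (by ring);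
  move: mk e1 e2; rewrite ?e ?mdegD ?mdeg1; lia.
Qed.

Lemma derivation_prod (C : comNzRingType) (d : C -> C) (I : finType)
    (A : pred I) (F : I -> C) :
  d 1 = 0 -> (forall f g, d (f * g) = d f * g + f * d g) ->
  d (\prod_(i | A i) F i) =
  \sum_(i | A i) d (F i) * \prod_(j | A j && (j != i)) F j.
Proof.
move=> d1 dM; elim: (index_enum I) (index_enum_uniq I) => [|i r IH] /=.
  by rewrite !big_nil d1.
case/andP=> ir ur; rewrite !big_cons.
have drop_i k : k \in r -> (i != k) by apply: contraTneq => <-.
case: ifP => Ai; last first.
  by rewrite IH //; apply: eq_bigr => k _; rewrite big_cons Ai.
rewrite dM IH // eqxx /=; congr (_ + _).
  congr (_ * _); rewrite big_seq_cond [RHS]big_seq_cond; apply: eq_bigl => j.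
  by case: (boolP (j \in r)) => // /drop_i; rewrite eq_sym => -> ; rewrite andbT.
rewrite mulr_sumr big_seq_cond [RHS]big_seq_cond.
apply: eq_bigr => k /andP[/drop_i ik _].
by rewrite big_cons Ai ik mulrCA.
Qed.

Lemma sum_neq_sym (V : nmodType) (I : finType) (A : pred I) (u : I -> I -> V) :
  \sum_(i | A i) \sum_(j | A j && (j != i)) u i j =
  \sum_(i | A i) \sum_(j | A j && (j != i)) u j i.
Proof.
rewrite (exchange_big_dep A) /= => [|i j _ /andP[]//].
apply: eq_bigr => i Ai; apply: eq_bigl => j.
by rewrite Ai eq_sym.
Qed.

(** * The rational identities behind the intertwining *)

Section rational_identities.
Variables (R : realFieldType).

(** Adding the terms (i, j) and (j, i) cancels the pole: (c_i^2 (t - c_j) - c_j^2 (t - c_i)) / (c_i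
    - c_j) = t^2 - (t - c_i) (t - c_j). Applied to the nodes and to the roots, it puts both sides of
    the intertwining in the same form without denominators. *)
Lemma pair_sum_identity (I : finType) (A : pred I) (c : I -> R) (t : R) :
  {in A &, injective c} ->
  2 * \sum_(i | A i) \sum_(j | A j && (j != i))
     c i ^+ 2 / (c i - c j) * \prod_(l | A l && (l != i)) (t - c l) =
  \sum_(i | A i) \sum_(j | A j && (j != i))
    (t ^+ 2 * \prod_(l | [&& A l, l != i & l != j]) (t - c l)
     - \prod_(l | A l) (t - c l)).
Proof.
move=> cI; rewrite mulr_natl mulr2n {2}sum_neq_sym -big_split /=.
apply: eq_bigr => i Ai; rewrite -big_split /=; apply: eq_bigr => j /andP[Aj ji].
have cij : c i - c j != 0.
  by rewrite subr_eq0; apply: contra_neq ji => /cI ->.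
have cji : c j - c i != 0 by rewrite -opprB oppr_eq0.
rewrite [\prod_(l | A l) _](bigD1 i) //= (bigD1 j) /=; last by rewrite Aj.
rewrite [\prod_(l | A l && (l != j)) _](bigD1 i) /=; last by rewrite Ai eq_sym.
set q := \prod_(l | [&& A l, _ & _]) _.
have -> : \prod_(l | A l && (l != i) && (l != j)) (t - c l) = q.
  by apply: eq_bigl => l; rewrite andbA.
have -> : \prod_(l | A l && (l != j) && (l != i)) (t - c l) = q.
  by apply: eq_bigl => l; rewrite andbA andbAC.
by field; rewrite cij cji.
Qed.

Section product_identities.
Variables (N : nat) (X : 'I_N.+1 -> R).
Hypothesis Xinj : injective X.

Let p1 a t := \prod_(l | l != a) (t - X l).
Let p2 a b t := \prod_(l | (l != a) && (l != b)) (t - X l).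

Let p2C a b t : p2 a b t = p2 b a t.
Proof. by apply: eq_bigl => l; rewrite andbC. Qed.

Let p1E a b t : b != a -> p1 a t = (t - X b) * p2 a b t.
Proof. by move=> ba; rewrite /p1 (bigD1 b). Qed.

Let XB a b : b != a -> X a - X b != 0.
Proof. by move=> ba; rewrite subr_eq0; apply: contra_neq ba => /Xinj. Qed.

(** In the summand of w_a the node X_a is missing, so the sum that [pair_sum_identity] can treat
    runs over j different from i and a. The drift of X_i differs from it by X_i^2 / (X_i - X_a) -
    X_i = X_i X_a / (X_i - X_a), and this is what the operator in w cancels. *)
Lemma node_second_derivative (theta : R) (s w : 'I_N.+1 -> R) (t : R) :
  X ord0 = 0 -> (forall a, a != ord0 -> s a = theta) ->
  2 * theta * \sum_(i | i != ord0) \sum_(j | (j != ord0) && (j != i))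
    X i ^+ 2 / (X i - X j) * - (\sum_(a | a != i) w a * p2 a i t)
  - \sum_a \sum_(b | b != a) - (X a * X b / (X a - X b) ^+ 2) *
     ((s a * w b - s b * w a) * (p1 a t - p1 b t))
  = - theta * \sum_a w a * \sum_(i | i != a) \sum_(j | (j != a) && (j != i))
     (t ^+ 2 * \prod_(l | [&& l != a, l != i & l != j]) (t - X l) - p1 a t).
Proof.
move=> X0 hs.
(* The drift of X_i with all nodes as poles, minus the contribution X_i of the node 0. Since
   [T ord0] is 0, sums over the nonzero nodes become sums over all nodes. *)
pose T i := \sum_(j | j != i) X i ^+ 2 / (X i - X j) - X i.
have -> : \sum_(i | i != ord0) \sum_(j | (j != ord0) && (j != i))
    X i ^+ 2 / (X i - X j) * - (\sum_(a | a != i) w a * p2 a i t) =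
  - \sum_a w a * \sum_(i | i != a) T i * p2 a i t.
  transitivity (\sum_i T i * - (\sum_(a | a != i) w a * p2 a i t)).
    have T0 : T ord0 = 0.
      by rewrite /T big1 ?X0 ?subrr // => j _; rewrite expr0n mul0r.
    rewrite [RHS](bigD1 ord0) //= T0 mul0r add0r; apply: eq_bigr => i i0.
    rewrite -mulr_suml; congr (_ * _).
    rewrite /T [in RHS](bigD1 ord0) /= 1?eq_sym // X0 subr0 expr2 mulfK.
      by rewrite addrC addrK; apply: eq_bigl => j; rewrite andbC.
    by rewrite -X0 (inj_eq Xinj).
  under eq_bigr => i _ do rewrite mulrN mulr_sumr.
  rewrite sumrN; congr (- _).
  rewrite (exchange_big_dep xpredT) //=; apply: eq_bigr => a _.
  rewrite mulr_sumr; apply: eq_big => [i|i _]; first by rewrite eq_sym.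
  by rewrite mulrCA.
have -> : \sum_a \sum_(b | b != a) - (X a * X b / (X a - X b) ^+ 2) *
     ((s a * w b - s b * w a) * (p1 a t - p1 b t)) =
   2 * theta * \sum_a \sum_(b | b != a) w a * (X a * X b / (X a - X b) * p2 a b t).
  have -> : 2 * theta * \sum_a \sum_(b | b != a)
      w a * (X a * X b / (X a - X b) * p2 a b t) =
    theta * (\sum_a \sum_(b | b != a) w a * (X a * X b / (X a - X b) * p2 a b t)
     + \sum_a \sum_(b | b != a) w b * (X b * X a / (X b - X a) * p2 b a t)).
    rewrite [X in _ + X](_ : _ = \sum_a \sum_(b | b != a)
      w a * (X a * X b / (X a - X b) * p2 a b t)); first by ring.
    by rewrite (@sum_neq_sym _ _ xpredT).
  rewrite -big_split mulr_sumr; apply: eq_bigr => a _.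
  rewrite -big_split mulr_sumr; apply: eq_bigr => b ba /=.
  have ab : a != b by rewrite eq_sym.
  rewrite (p1E t ba) (p1E t ab) (p2C b a).
  (* The parameter of the node 0 is arbitrary, but it only occurs with a factor X_a X_b that is
     0. *)
  have [->|a0] := eqVneq a ord0; first by rewrite X0 !(mul0r, mulr0, oppr0, addr0).
  have [->|b0] := eqVneq b ord0; first by rewrite X0 !(mul0r, mulr0, oppr0, addr0).
  by rewrite !hs //; field; rewrite !XB.
have -> : \sum_a w a * \sum_(i | i != a) T i * p2 a i t =
  \sum_a w a * \sum_(i | i != a) \sum_(j | (j != a) && (j != i))
     X i ^+ 2 / (X i - X j) * p2 a i t -
  \sum_a \sum_(b | b != a) w a * (X a * X b / (X a - X b) * p2 a b t).
  rewrite -sumrB; apply: eq_bigr => a _; rewrite -mulr_sumr -mulrBr -sumrB.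
  congr (_ * _); apply: eq_bigr => i ia; rewrite -mulr_suml -mulrBl.
  congr (_ * _); rewrite /T (bigD1 a) /=; last by rewrite eq_sym.
  have ai : a != i by rewrite eq_sym.
  rewrite (eq_bigl (fun j => (j != a) && (j != i))) => [|j]; last by rewrite andbC.
  by field; rewrite !XB.
rewrite [in RHS](eq_bigr (fun a => 2 * (w a * \sum_(i | i != a)
  \sum_(j | (j != a) && (j != i)) X i ^+ 2 / (X i - X j) * p2 a i t))) => [|a _].
  by rewrite -mulr_sumr; ring.
by rewrite mulrCA pair_sum_identity // => i j _ _ /Xinj.
Qed.

(** From (s - t) x^2 = t^2 (s - x) - s^2 (t - x) + (s - t) (t - x) (s - x): the factor s - t trades
    the square of a node for products in which one of the two factors at that node is restored. *)
Let square_split (t s u v : R) (x a b : R) :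
  u = (t - x) * a -> v = (s - x) * b ->
  (s - t) * (x ^+ 2 * (a * b)) = t ^+ 2 * a * v - s ^+ 2 * u * b + (s - t) * u * v.
Proof. by move=> -> ->; ring. Qed.

(** Both sides are quadratic forms in w. The coefficients of w_a^2 agree by [square_split]; those of
    w_a w_b agree up to a term antisymmetric in a and b, which cancels in the sum. *)
Lemma node_carre_du_champ (w : 'I_N.+1 -> R) (t s : R) :
  X ord0 = 0 ->
  (s - t) * (\sum_(i | i != ord0) X i ^+ 2 *
       ((\sum_(a | a != i) w a * p2 a i t) * (\sum_(a | a != i) w a * p2 a i s))
    - \sum_a \sum_(b | b != a) - (X a * X b / (X a - X b) ^+ 2) *
      (w a * w b * (p1 a t - p1 b t) * (p1 a s - p1 b s))) =
  t ^+ 2 * (\sum_a w a * \sum_(i | i != a) p2 a i t) * (\sum_a w a * p1 a s)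
  - s ^+ 2 * (\sum_a w a * p1 a t) * (\sum_a w a * \sum_(i | i != a) p2 a i s)
  + N%:R * (s - t) * (\sum_a w a * p1 a t) * (\sum_a w a * p1 a s).
Proof.
move=> X0.
have -> : \sum_(i | i != ord0) X i ^+ 2 *
   ((\sum_(a | a != i) w a * p2 a i t) * (\sum_(a | a != i) w a * p2 a i s)) =
  \sum_a \sum_b w a * w b *
    \sum_(i | (i != a) && (i != b)) X i ^+ 2 * (p2 a i t * p2 b i s).
  transitivity (\sum_i X i ^+ 2 *
   ((\sum_(a | a != i) w a * p2 a i t) * (\sum_(a | a != i) w a * p2 a i s))).
    by rewrite [RHS](bigD1 ord0) //= X0 expr0n mul0r add0r.
  under eq_bigr => i _ do rewrite mulr_suml mulr_sumr.
  rewrite (exchange_big_dep xpredT) //=; apply: eq_bigr => a _.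
  under eq_bigr => i _ do rewrite !mulr_sumr.
  rewrite (exchange_big_dep xpredT) //=; apply: eq_bigr => b _.
  rewrite mulr_sumr; apply: eq_big => [i|i _]; last by ring.
  by rewrite ![i == _]eq_sym.
have -> : \sum_a \sum_(b | b != a) - (X a * X b / (X a - X b) ^+ 2) *
      (w a * w b * (p1 a t - p1 b t) * (p1 a s - p1 b s)) =
   - \sum_a \sum_(b | b != a) w a * w b * (X a * X b * (p2 a b t * p2 a b s)).
  rewrite -sumrN; apply: eq_bigr => a _; rewrite -sumrN; apply: eq_bigr => b ba.
  have ab : a != b by rewrite eq_sym.
  rewrite (p1E t ba) (p1E t ab) (p1E s ba) (p1E s ab) !(p2C b a).
  by field; rewrite XB.
(* The contribution of the pair (a, b) to the right-hand side. *)
pose Z a b := w a * w b * (t ^+ 2 * (\sum_(i | i != a) p2 a i t) * p1 b s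
  - s ^+ 2 * p1 a t * (\sum_(i | i != b) p2 b i s)
  + N%:R * (s - t) * p1 a t * p1 b s).
transitivity (\sum_a \sum_b Z a b); last first.
  have distr k f g : k * (\sum_a f a) * (\sum_b g b) =
      \sum_(a < N.+1) \sum_(b < N.+1) k * f a * g b :> R.
    rewrite [k * _]mulr_sumr mulr_suml; apply: eq_bigr => a _.
    by rewrite mulr_sumr.
  rewrite !distr -sumrB -big_split; apply: eq_bigr => a _.
  by rewrite -sumrB -big_split; apply: eq_bigr => b _; rewrite /Z /=; ring.
have diag a : (s - t) * (\sum_(i | (i != a) && (i != a)) X i ^+ 2 * (p2 a i t * p2 a i s))
   * (w a * w a) = Z a a.
  rewrite /Z [RHS]mulrC [in LHS]mulrC [RHS]mulrC; congr (_ * _).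
  rewrite (eq_bigl (fun i => i != a)) => [|i]; last by rewrite andbb.
  rewrite mulr_sumr (eq_bigr (fun i => t ^+ 2 * p1 a s * p2 a i t
     - s ^+ 2 * p1 a t * p2 a i s + (s - t) * p1 a t * p1 a s)) => [|i ia].
    rewrite big_split sumrB /= -!mulr_sumr sumr_const cardC1 card_ord /=.
    by rewrite -[_ *+ N]mulr_natl; ring.
  by rewrite (square_split (p1E t ia) (p1E s ia)); ring.
have offdiag a b : b != a -> (s - t) * (w a * w b *
    \sum_(i | (i != a) && (i != b)) X i ^+ 2 * (p2 a i t * p2 b i s)
   + w a * w b * (X a * X b * (p2 a b t * p2 a b s))) =
   Z a b + w a * w b * (s * t) * (X a - X b) * (p2 a b t * p2 a b s).
  move=> ba; have ab : a != b by rewrite eq_sym.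
  rewrite -mulrDr mulrCA mulrDr mulr_sumr.
  rewrite (eq_bigr (fun i => t ^+ 2 * p1 b s * p2 a i t
     - s ^+ 2 * p1 a t * p2 b i s + (s - t) * p1 a t * p1 b s)) => [|i /andP[ia ib]]; last first.
    by rewrite (square_split (p1E t ia) (p1E s ib)); ring.
  rewrite big_split sumrB /= -!mulr_sumr sumr_const.
  have cab : #|(fun i : 'I_N.+1 => (i != a) && (i != b))|.+1 = N.
    transitivity #|predC1 a|; last by rewrite cardC1 card_ord.
    rewrite [RHS](cardD1 b) !inE ba; congr _.+1; apply: eq_card => i.
    by rewrite !inE unfold_in andbC.
  rewrite /Z (bigD1 b ba) /= (bigD1 a ab) /=.
  have -> : \sum_(i | (i != b) && (i != a)) p2 b i s =
      \sum_(i | (i != a) && (i != b)) p2 b i s.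
    by apply: eq_bigl => i; rewrite andbC.
  rewrite (p1E t ba) (p1E s ab) !(p2C b a) -[_ *+ #|_|]mulr_natl.
  have -> : (N%:R : R) = #|(fun i : 'I_N.+1 => (i != a) && (i != b))|%:R + 1.
    by rewrite -{1}cab -natr1.
  by ring.
rewrite opprK mulrDr !mulr_sumr -big_split /=.
transitivity (\sum_a (Z a a + \sum_(b | b != a)
   (Z a b + w a * w b * (s * t) * (X a - X b) * (p2 a b t * p2 a b s)))).
  apply: eq_bigr => a _; rewrite (bigD1 a) //= mulrDr -addrA; congr (_ + _).
    by rewrite -diag; ring.
  rewrite !mulr_sumr -big_split; apply: eq_bigr => b ba /=.
  by rewrite -offdiag //; ring.
transitivity (\sum_a \sum_b Z a b + \sum_a \sum_(b | b != a)
    w a * w b * (s * t) * (X a - X b) * (p2 a b t * p2 a b s)).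
  rewrite -big_split; apply: eq_bigr => a _.
  by rewrite [in RHS](bigD1 a) //= big_split addrA.
rewrite -[RHS]addr0; congr (_ + _).
(* The antisymmetric excess left by [offdiag]. *)
set u := \sum_i _; suff : u = - u by lra.
rewrite {1}/u (@sum_neq_sym _ _ xpredT) /= -sumrN; apply: eq_bigr => a _.
rewrite -sumrN; apply: eq_bigr => b ba; rewrite !(p2C b a).
by ring.
Qed.

End product_identities.
End rational_identities.

Lemma prod_sub_esym (C : comNzRingType) n (z : 'I_n -> C) (t : C) :
  \prod_j (t - z j) = \sum_(k < n.+1) (-1) ^+ k * t ^+ (n - k) *
    \sum_(h : {set 'I_n} | #|h| == k) \prod_(i in h) z i.
Proof.
under eq_bigr => j _ do rewrite addrC.
rewrite bigA_distr.
rewrite (partition_big (fun h : {set 'I_n} => inord #|h| : 'I_n.+1) xpredT) //=.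
apply: eq_bigr => k _; rewrite mulr_sumr.
have card_lt (h : {set 'I_n}) : (#|h| < n.+1)%N.
  by rewrite ltnS -[X in (_ <= X)%N]card_ord max_card.
apply: eq_big => [h|h /eqP hk]; first by rewrite -val_eqE /= inordK.
have {}hk : #|h| = k by rewrite -hk inordK.
rewrite (bigID (mem h)) /= -hk mulrAC; congr (_ * _).
  by rewrite -prodrN; apply: eq_bigr => i ->.
rewrite (eq_bigr (fun=> t)) => [|i /negbTE -> //].
rewrite prodr_const; congr (_ ^+ _).
have := cardC (mem h); rewrite card_ord => e.
by rewrite -[X in (X - _)%N]e addKn.
Qed.

Section real_parameters.
Variable R : realFieldType.

Lemma poly_nat_roots_eq0 (p : {poly R}) (c : R) :
  (forall n : nat, p.[c + n%:R] = 0) -> p = 0.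
Proof.
move=> p0; apply/eqP; apply: contraT => pn0.
have := @max_poly_roots _ p [seq c + i%:R | i <- iota 0 (size p)] pn0.
rewrite size_map size_iota ltnn; apply.
  by apply/allP => z /mapP[i _ ->]; apply/eqP.
by rewrite map_inj_uniq ?iota_uniq // => i j /addrI /eqP; rewrite eqr_nat => /eqP.
Qed.

(** One point is left out because the identity for the product of two generating polynomials, at t
    and u, is obtained by cancelling u - t. *)
Lemma horner_off_point_eq0 (p : {poly R}) (s : R) :
  (forall t, t != s -> p.[t] = 0) -> p = 0.
Proof.
move=> p0; apply: (@poly_nat_roots_eq0 _ (s + 1)) => n; apply: p0.
by rewrite gt_eqF // -addrA ltrDl ltr_wpDr.
Qed.

Lemma alternating_coefs_eq0 n (u : 'I_n.+1 -> R) (s : R) :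
  (forall t, t != s -> \sum_(k < n.+1) (-1) ^+ k * t ^+ (n - k) * u k = 0) ->
  forall k, u k = 0.
Proof.
move=> u0 k.
pose p := \sum_(k < n.+1) ((-1) ^+ k * u k) *: 'X^(n - k).
have /(congr1 (fun p : {poly R} => p`_(n - k))) : p = 0.
  apply: (@horner_off_point_eq0 _ s) => t ts; rewrite -[RHS](u0 _ ts) horner_sum.
  by apply: eq_bigr => j _; rewrite hornerZ hornerXn; ring.
rewrite coef0 coef_sum (bigD1 k) //= big1 => [|j jk].
  rewrite addr0 coefZ coefXn eqxx mulr1 => /eqP.
  by rewrite mulf_eq0 signr_eq0 => /eqP.
rewrite coefZ coefXn; case: eqP => [e|]; last by rewrite mulr0.
case/eqP: jk; apply/val_inj => /=.
by have := ltn_ord j; have := ltn_ord k; lia.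
Qed.

End real_parameters.

Lemma mnm_subxx n (m : multinom n) : mnm_sub m m = mnm0.
Proof. by apply/mnmP => i; rewrite mnmBE subnn mnm0E. Qed.

(** * The random polynomial with indeterminate nodes and weights *)

Section interpolation_polynomial.
Variables (R : realType) (N : nat).
Local Notation A := (mpoly N.+1 R).
Local Notation B := (mpoly N A).
Local Notation "''w_' a" := (mpolyX R (mnm1 a)) (at level 8, a at level 2, format "''w_' a").
Local Notation "''x_' i" := (mpolyX A (mnm1 i)) (at level 8, i at level 2, format "''x_' i").

Local Notation "c %:w" := (mpolyC N.+1 c) (at level 2, format "c %:w").

(** The summand of w_a contributes the monomial of [h] unless its missing factor belongs to [h]; the
    index [ord0] always contributes. *)
Definition weight_off (h : {set 'I_N}) : A :=
  \sum_(a | a \notin [set lift ord0 i | i in h]) 'w_a.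

(* [e_k] of the roots of the random polynomial: [(-1)^k] times its coefficient of
   degree [N - k], by [generic_random_polyE]. *)
Definition weighted_esym (k : nat) : B :=
  \sum_(h : {set 'I_N} | #|h| == k) mpolyC N (weight_off h) * \prod_(i in h) 'x_i.

(** Stated over any [nmodType] because the nodes are numbers in some places and indeterminates in
    others. *)
Definition extend0 (V : nmodType) (x : 'I_N -> V) (l : 'I_N.+1) : V :=
  if unlift ord0 l is Some i then x i else 0.

Lemma extend0_0 V x : @extend0 V x ord0 = 0.
Proof. by rewrite /extend0 unlift_none. Qed.

Lemma extend0_lift V x i : @extend0 V x (lift ord0 i) = x i.
Proof. by rewrite /extend0 liftK. Qed.

Definition generic_random_poly (t : R) : B :=
  \sum_a mpolyC N 'w_a *
    \prod_(l | l != a) (mpolyC N (mpolyC N.+1 t) - extend0 (fun i => 'x_i) l).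

(** The factor t of the node 0 takes the place of the removed factor, so that N factors remain for
    every a and [prod_sub_esym] applies uniformly. *)
Lemma prod_extend0 (C : comNzRingType) (z : 'I_N -> C) (t : C) (a : 'I_N.+1) :
  \prod_(l | l != a) (t - extend0 z l) =
  \prod_j (t - (if lift ord0 j == a then 0 else z j)).
Proof.
rewrite big_mkcond big_ord_recl /= extend0_0 subr0.
case: (unliftP ord0 a) => [i|] -> /=.
  rewrite [RHS](bigD1 i) //= eqxx subr0 (bigD1 i) //= eqxx /= mul1r.
  congr (_ * _); apply: eq_bigr => j ji; rewrite (inj_eq lift_inj) (negbTE ji).
  by rewrite extend0_lift.
by rewrite mul1r; apply: eq_bigr => j _; rewrite extend0_lift.
Qed.

Lemma generic_random_polyE t : generic_random_poly t =
  \sum_(k < N.+1) mpolyC N (mpolyC N.+1 ((-1) ^+ k * t ^+ (N - k))) * weighted_esym k.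
Proof.
rewrite /generic_random_poly.
under eq_bigr => a _ do rewrite prod_extend0 prod_sub_esym mulr_sumr.
rewrite exchange_big; apply: eq_bigr => k _ /=.
rewrite !rmorphM /= !rmorphXn /= !rmorphN1.
under eq_bigr => a _ do rewrite mulrCA.
rewrite -mulr_sumr; congr (_ * _).
under eq_bigr => a _ do rewrite mulr_sumr.
rewrite exchange_big; apply: eq_bigr => h hk /=.
rewrite raddf_sum mulr_suml [RHS]big_mkcond; apply: eq_bigr => a _ /=.
case: ifPn => [ah|/negPn /imsetP[i ih ai]]; last first.
  by rewrite (bigD1 i) //= ai eqxx mul0r mulr0.
congr (_ * _); apply: eq_bigr => i ih; case: eqP => // ia.
by case/negP: ah; rewrite -ia imset_f.
Qed.

Section at_point.
Variables (theta : R) (s : 'I_N.+1 -> R) (x : 'I_N -> R).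

Definition eval_x : B -> A := meval (fun i => mpolyC N.+1 (x i)).

Definition wderiv (a b : 'I_N.+1) (f : A) : A := mderiv a f - mderiv b f.

(* The generator of the diffusion of [w] along the edge [e_a - e_b] of the simplex, for
   which the Dirichlet distribution with parameters [s] is stationary. *)
Definition simplex_generator (a b : 'I_N.+1) (f : A) : A :=
  'w_a * 'w_b * wderiv a b (wderiv a b f) +
  ((s a)%:w * 'w_b - (s b)%:w * 'w_a) * wderiv a b f.

(** The coefficient for which [node_second_derivative] and [node_carre_du_champ] both hold; it is 0
    on the edges that contain the node 0. *)
Definition coupling (a b : 'I_N.+1) : R :=
  - (extend0 x a * extend0 x b / (extend0 x a - extend0 x b) ^+ 2).

Definition D2_x (F : B) : A :=
  \sum_i ((x i ^+ 2)%:w * eval_x (mderiv i (mderiv i F)) +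
   (2 * theta * \sum_(j | j != i) x i ^+ 2 / (x i - x j))%:w * eval_x (mderiv i F)).

Definition D2_w (f : A) : A :=
  \sum_(ab : 'I_N.+1 * 'I_N.+1 | ab.2 != ab.1)
    (coupling ab.1 ab.2)%:w * simplex_generator ab.1 ab.2 f.

Lemma wderivM a b f g : wderiv a b (f * g) = wderiv a b f * g + f * wderiv a b g.
Proof. by rewrite /wderiv !mderivM; ring. Qed.

Lemma wderivD a b f g : wderiv a b (f + g) = wderiv a b f + wderiv a b g.
Proof. by rewrite /wderiv !mderivD; ring. Qed.

Variable w : 'I_N.+1 -> R.

Definition eval_xw (F : B) : R := meval w (eval_x F).

Lemma eval_xD F G : eval_x (F + G) = eval_x F + eval_x G.
Proof. exact: mevalD. Qed.

Lemma eval_xM F G : eval_x (F * G) = eval_x F * eval_x G.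
Proof. exact: mevalM. Qed.

Lemma eval_xwD : {morph eval_xw : F G / F + G}.
Proof. by move=> F G; rewrite /eval_xw eval_xD mevalD. Qed.

Lemma eval_xwM : {morph eval_xw : F G / F * G}.
Proof. by move=> F G; rewrite /eval_xw eval_xM mevalM. Qed.

Lemma eval_xwN F : eval_xw (- F) = - eval_xw F.
Proof. by rewrite /eval_xw /eval_x !mevalN. Qed.

Lemma eval_xw_sum (I : Type) (r : seq I) (P : pred I) (F : I -> B) :
  eval_xw (\sum_(i <- r | P i) F i) = \sum_(i <- r | P i) eval_xw (F i).
Proof.
apply: (big_morph _ eval_xwD).
by rewrite /eval_xw /eval_x !meval0.
Qed.

Definition x_diffusion := diffusion eval_xw (@mderiv N A) (fun i => x i ^+ 2)
  (fun i => 2 * theta * \sum_(j | j != i) x i ^+ 2 / (x i - x j)).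

(** [diffusion] sums over a whole finite type, so the pairs with equal entries are kept with
    coefficient 0. *)
Definition simplex_coef (ab : 'I_N.+1 * 'I_N.+1) := if ab.2 != ab.1 then coupling ab.1 ab.2 else 0.

Definition w_diffusion := diffusion (meval w) (fun ab => wderiv ab.1 ab.2)
  (fun ab => simplex_coef ab * (w ab.1 * w ab.2))
  (fun ab => simplex_coef ab * (s ab.1 * w ab.2 - s ab.2 * w ab.1)).

Lemma meval_D2_x F : meval w (D2_x F) = x_diffusion F.
Proof.
rewrite raddf_sum; apply: eq_bigr => i _ /=.
by rewrite mevalD; congr (_ + _); rewrite mevalM mevalC.
Qed.

Lemma meval_D2_w f : meval w (D2_w f) = w_diffusion f.
Proof.
rewrite raddf_sum big_mkcond; apply: eq_bigr => ab _ /=; rewrite /simplex_coef.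
case: ifP => _; last by rewrite !mul0r addr0.
rewrite mevalM mevalC /simplex_generator mevalD !mevalM (mevalB w (_ * _)).
by rewrite !mevalM !mevalC !mevalXU -!mulrA -mulrDr.
Qed.

Local Notation T t := (mpolyC N (mpolyC N.+1 t)).
Local Notation XX := (extend0 (fun i => 'x_i)).
Local Notation X := (extend0 x).

Let mderiv1 i : mderiv i (1 : B) = 0.
Proof. by rewrite -mpolyC1 mderivC. Qed.

Let mderiv_node i t l : mderiv i (T t - XX l) = - (l == lift ord0 i)%:R.
Proof.
rewrite mderivB mderivC sub0r; congr (- _).
case: (unliftP ord0 l) => [j|] ->.
  rewrite extend0_lift mderivX mnm1E (inj_eq lift_inj).
  have [->|ji] := eqVneq j i; last by rewrite scale0r.
  by rewrite scale1r mnm_subxx mpolyX0.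
by rewrite extend0_0 linear0.
Qed.

Lemma mderiv_generic_random_poly i t : mderiv i (generic_random_poly t) =
  - \sum_(a | a != lift ord0 i) mpolyC N 'w_a *
     \prod_(l | (l != a) && (l != lift ord0 i)) (T t - XX l).
Proof.
rewrite raddf_sum -sumrN [RHS]big_mkcond; apply: eq_bigr => a _ /=.
rewrite mderiv_mulC (derivation_prod _ _ (mderiv1 i) (mderivM i)).
case: ifPn => [ai|/negPn /eqP ->].
  rewrite (bigD1 (lift ord0 i)) /=; last by rewrite eq_sym.
  rewrite mderiv_node eqxx mulN1r [X in _ + X]big1 ?addr0 ?mulrN // => l /andP[_ li].
  by rewrite mderiv_node (negbTE li) oppr0 mul0r.
rewrite big1 ?mulr0 // => l li.
by rewrite mderiv_node (negbTE li) oppr0 mul0r.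
Qed.

(** Each summand has degree at most one in every x_i, so the x-part of the operator acts on the
    generating polynomial through its drift alone. *)
Lemma mderiv2_generic_random_poly i t :
  mderiv i (mderiv i (generic_random_poly t)) = 0.
Proof.
rewrite mderiv_generic_random_poly mderivN (raddf_sum (mderiv i)) big1 ?oppr0 // => a ai /=.
rewrite mderiv_mulC (derivation_prod _ _ (mderiv1 i) (mderivM i)).
rewrite big1 ?mulr0 // => l /andP[_ li].
by rewrite mderiv_node (negbTE li) oppr0 mul0r.
Qed.

Let eval_node t l : eval_x (T t - XX l) = (t - X l)%:w.
Proof.
rewrite /eval_x mevalB mevalC mpolyCB; congr (_ - _).
case: (unliftP ord0 l) => [j|] ->; first by rewrite !extend0_lift mevalXU.
by rewrite !extend0_0 meval0 mpolyC0.
Qed.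

Let eval_nodes t (P : pred 'I_N.+1) :
  eval_x (\prod_(l | P l) (T t - XX l)) = (\prod_(l | P l) (t - X l))%:w.
Proof. by rewrite /eval_x !rmorph_prod; apply: eq_bigr => l _; exact: eval_node. Qed.

Lemma eval_x_generic_random_poly t : eval_x (generic_random_poly t) =
  \sum_a (\prod_(l | l != a) (t - X l))%:w * 'w_a.
Proof.
rewrite /eval_x raddf_sum; apply: eq_bigr => a _ /=.
by rewrite mevalM mevalC mulrC; congr (_ * _); exact: eval_nodes.
Qed.

Lemma eval_xw_generic_random_poly t : eval_xw (generic_random_poly t) =
  \sum_a w a * \prod_(l | l != a) (t - X l).
Proof.
rewrite /eval_xw eval_x_generic_random_poly raddf_sum.
by apply: eq_bigr => a _ /=; rewrite mevalM mevalC mevalXU mulrC.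
Qed.

Lemma eval_xw_mderiv i t : eval_xw (mderiv i (generic_random_poly t)) =
  - \sum_(a | a != lift ord0 i) w a *
     \prod_(l | (l != a) && (l != lift ord0 i)) (t - X l).
Proof.
rewrite mderiv_generic_random_poly eval_xwN eval_xw_sum; congr (- _).
apply: eq_bigr => a _; rewrite eval_xwM /eval_xw eval_nodes mevalC.
by rewrite {1}/eval_x mevalC mevalXU.
Qed.

Lemma wderiv_generic_random_poly a b t :
  wderiv a b (eval_x (generic_random_poly t)) =
  (\prod_(l | l != a) (t - X l) - \prod_(l | l != b) (t - X l))%:w.
Proof.
have dw c : mderiv c (eval_x (generic_random_poly t)) =
    (\prod_(l | l != c) (t - X l))%:w.
  rewrite eval_x_generic_random_poly (raddf_sum (mderiv c)) (bigD1 c) //=.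
  rewrite [X in _ + X]big1 => [|a' ac].
    rewrite addr0 mderiv_mulC mderivX mnm1E eqxx scale1r mnm_subxx mpolyX0.
    by rewrite mulr1.
  by rewrite mderiv_mulC mderivX mnm1E (negbTE ac) scale0r mulr0.
by rewrite /wderiv !dw mpolyCB.
Qed.

End at_point.
End interpolation_polynomial.

(** * The generating polynomial of the elementary symmetric polynomials under D_2^N *)

Section elementary_symmetric.
Variables (R : realType) (N : nat).
Local Notation B := (mpoly N R).

Definition elementary_poly (t : R) : B :=
  \prod_j (mpolyC N t - mpolyX R (mnm1 j)).

Lemma elementary_polyE t : elementary_poly t =
  \sum_(k < N.+1) mpolyC N ((-1) ^+ k * t ^+ (N - k)) * mesym N R k.
Proof.
rewrite /elementary_poly prod_sub_esym; apply: eq_bigr => k _.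
by rewrite rmorphM rmorphXn rmorphN1 rmorphXn.
Qed.

Variables (theta : R) (y : N.-tuple R).

Definition D2_diffusion := diffusion (meval (tnth y)) (@mderiv N R)
  (fun i => tnth y i ^+ 2)
  (fun i => 2 * theta * \sum_(j | j != i) tnth y i ^+ 2 / (tnth y i - tnth y j)).

Lemma D2E P : D2 theta P y = D2_diffusion P.
Proof.
rewrite /D2 /D2_diffusion /diffusion big_split; congr (_ + _) => /=.
by rewrite mulr_sumr; apply: eq_bigr => i _; rewrite -mulr_suml mulrA.
Qed.

Let mderiv1 i : mderiv i (1 : B) = 0.
Proof. by rewrite -mpolyC1 mderivC. Qed.

Let mderiv_node i t l : mderiv i (mpolyC N t - mpolyX R (mnm1 l)) = - (l == i)%:R.
Proof.
rewrite mderivB mderivC sub0r mderivX mnm1E; congr (- _).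
have [->|_] := eqVneq l i; last by rewrite scale0r.
by rewrite scale1r mnm_subxx mpolyX0.
Qed.

Lemma mderiv_elementary_poly i t : mderiv i (elementary_poly t) =
  - \prod_(l | l != i) (mpolyC N t - mpolyX R (mnm1 l)).
Proof.
rewrite (derivation_prod _ _ (mderiv1 i) (mderivM i)) (bigD1 i) //=.
rewrite mderiv_node eqxx mulN1r [X in _ + X]big1 ?addr0 // => l li.
by rewrite mderiv_node (negbTE li) oppr0 mul0r.
Qed.

Lemma mderiv2_elementary_poly i t : mderiv i (mderiv i (elementary_poly t)) = 0.
Proof.
rewrite mderiv_elementary_poly mderivN.
rewrite (derivation_prod _ _ (mderiv1 i) (mderivM i)) [X in - X]big1 ?oppr0 //.
by move=> l li; rewrite mderiv_node (negbTE li) oppr0 mul0r.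
Qed.

Let meval_nodes t (P : pred 'I_N) :
  meval (tnth y) (\prod_(l | P l) (mpolyC N t - mpolyX R (mnm1 l))) =
  \prod_(l | P l) (t - tnth y l).
Proof.
by rewrite rmorph_prod; apply: eq_bigr => l _; rewrite /= mevalB mevalC mevalXU.
Qed.

Lemma meval_elementary_poly t :
  meval (tnth y) (elementary_poly t) = \prod_j (t - tnth y j).
Proof. exact: meval_nodes. Qed.

Lemma meval_mderiv_elementary_poly i t :
  meval (tnth y) (mderiv i (elementary_poly t)) = - \prod_(l | l != i) (t - tnth y l).
Proof. by rewrite mderiv_elementary_poly mevalN meval_nodes. Qed.

Hypothesis yinj : injective (tnth y).

Lemma D2_elementary_poly t : D2_diffusion (elementary_poly t) =
  - theta * \sum_i \sum_(j | j != i)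
    (t ^+ 2 * \prod_(l | (l != i) && (l != j)) (t - tnth y l)
     - \prod_l (t - tnth y l)).
Proof.
have -> : - theta * \sum_i \sum_(j | j != i)
    (t ^+ 2 * \prod_(l | (l != i) && (l != j)) (t - tnth y l)
     - \prod_l (t - tnth y l)) =
   - theta * (2 * \sum_i \sum_(j | j != i)
     tnth y i ^+ 2 / (tnth y i - tnth y j) * \prod_(l | l != i) (t - tnth y l)).
  by rewrite (@pair_sum_identity _ _ xpredT) // => i j _ _ /yinj.
rewrite /D2_diffusion /diffusion [2 * \sum_i _]mulr_sumr [RHS]mulr_sumr; apply: eq_bigr => i _.
rewrite mderiv2_elementary_poly meval0 mulr0 add0r meval_mderiv_elementary_poly.
by rewrite -mulr_suml; ring.
Qed.

Lemma carre_du_champ_elementary_poly t u :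
  (u - t) * carre_du_champ (meval (tnth y)) (@mderiv N R)
    (fun i => tnth y i ^+ 2) (elementary_poly t) (elementary_poly u) =
  t ^+ 2 * (\sum_i \prod_(l | l != i) (t - tnth y l)) * (\prod_l (u - tnth y l))
  - u ^+ 2 * (\prod_l (t - tnth y l)) * (\sum_i \prod_(l | l != i) (u - tnth y l))
  + N%:R * (u - t) * (\prod_l (t - tnth y l)) * (\prod_l (u - tnth y l)).
Proof.
rewrite /carre_du_champ [LHS]mulr_sumr.
rewrite (eq_bigr (fun i =>
    t ^+ 2 * (\prod_l (u - tnth y l)) * (\prod_(l | l != i) (t - tnth y l))
  - u ^+ 2 * (\prod_l (t - tnth y l)) * (\prod_(l | l != i) (u - tnth y l))
  + (u - t) * (\prod_l (t - tnth y l)) * (\prod_l (u - tnth y l)))) => [|i _].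
  rewrite big_split sumrB /= -!mulr_sumr sumr_const card_ord -[_ *+ N]mulr_natl.
  by ring.
rewrite !meval_mderiv_elementary_poly mulrNN.
have split_node v : \prod_l (v - tnth y l) =
    (v - tnth y i) * \prod_(l | l != i) (v - tnth y l) by rewrite (bigD1 i).
by rewrite !split_node /=; ring.
Qed.

End elementary_symmetric.

(** * The intertwining on generating polynomials and on their products *)

Lemma big_lift0 (V : nmodType) N (P : pred 'I_N.+1) (F : 'I_N.+1 -> V) :
  \sum_(i | (i != ord0) && P i) F i =
  \sum_(i < N | P (lift ord0 i)) F (lift ord0 i).
Proof. by rewrite big_mkcond big_ord_recl /= add0r [RHS]big_mkcond. Qed.

Lemma deriv_prod_XsubC (R : comNzRingType) (I : finType) (A : pred I) (c : I -> R) :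
  (\prod_(i | A i) ('X - (c i)%:P))^`() =
  \sum_(i | A i) \prod_(j | A j && (j != i)) ('X - (c j)%:P).
Proof.
rewrite (derivation_prod _ _ (derivC 1) (@derivM R)); apply: eq_bigr => i _.
by rewrite derivXsubC mul1r.
Qed.

Section intertwining.
Variables (R : realType) (N : nat) (theta : R) (s : 'I_N.+1 -> R) (x : 'I_N -> R).
Variables (w : 'I_N.+1 -> R) (y : N.-tuple R).
Local Notation X := (extend0 x).
Hypothesis s_theta : forall a, a != ord0 -> s a = theta.
Hypothesis Xinj : injective X.
Hypothesis yinj : injective (tnth y).
Hypothesis roots_y : \sum_a w a *: \prod_(l | l != a) ('X - (X l)%:P) =
  \prod_l ('X - (tnth y l)%:P).

Let prodE (I : finType) (P : pred I) (c : I -> R) t :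
  (\prod_(l | P l) ('X - (c l)%:P)).[t] = \prod_(l | P l) (t - c l).
Proof. by rewrite horner_prod; apply: eq_bigr => l _; rewrite hornerXsubC. Qed.

Lemma roots_horner t :
  \prod_l (t - tnth y l) = \sum_a w a * \prod_(l | l != a) (t - X l).
Proof.
rewrite -prodE -roots_y horner_sum; apply: eq_bigr => a _.
by rewrite hornerZ prodE.
Qed.

(** Differentiating the polynomial identity [roots_y] turns symmetric sums over the unknown roots
    into sums over the nodes, linear in w; [roots2] differentiates twice. *)
Let roots1 t : \sum_i \prod_(l | l != i) (t - tnth y l) =
  \sum_a w a * \sum_(i | i != a) \prod_(l | (l != a) && (l != i)) (t - X l).
Proof.
transitivity (\prod_l ('X - (tnth y l)%:P))^`().[t].
  by rewrite deriv_prod_XsubC horner_sum; apply: eq_bigr => i _; rewrite prodE.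
rewrite -roots_y raddf_sum horner_sum.
apply: eq_bigr => a _; rewrite /= derivZ hornerZ deriv_prod_XsubC horner_sum.
by congr (_ * _); apply: eq_bigr => i _; rewrite prodE.
Qed.

Let roots2 t : \sum_i \sum_(j | j != i) \prod_(l | (l != i) && (l != j)) (t - tnth y l) =
  \sum_a w a * \sum_(i | i != a) \sum_(j | (j != a) && (j != i))
    \prod_(l | [&& l != a, l != i & l != j]) (t - X l).
Proof.
transitivity (\prod_l ('X - (tnth y l)%:P))^`()^`().[t].
  rewrite deriv_prod_XsubC raddf_sum horner_sum; apply: eq_bigr => i _ /=.
  rewrite deriv_prod_XsubC horner_sum.
  by apply: eq_bigr => j _; rewrite prodE.
rewrite -roots_y !raddf_sum horner_sum.
apply: eq_bigr => a _; rewrite /= !derivZ hornerZ deriv_prod_XsubC raddf_sum horner_sum.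
congr (_ * _); apply: eq_bigr => i _; rewrite /= deriv_prod_XsubC horner_sum.
apply: eq_bigr => j _; rewrite prodE; apply: eq_bigl => l.
by rewrite andbA.
Qed.

Definition xw_diffusion F := x_diffusion theta x w F - w_diffusion s x w (eval_x x F).

Lemma x_diffusion_generic t : x_diffusion theta x w (generic_random_poly N t) =
  2 * theta * \sum_(i | i != ord0) \sum_(j | (j != ord0) && (j != i))
    X i ^+ 2 / (X i - X j) *
      - (\sum_(a | a != i) w a * \prod_(l | (l != a) && (l != i)) (t - X l)).
Proof.
rewrite /x_diffusion /diffusion [in RHS](eq_bigl (fun i => (i != ord0) && true)); last first.
  by move=> i; rewrite andbT.
rewrite big_lift0 mulr_sumr; apply: eq_bigr => i _.
rewrite mderiv2_generic_random_poly {1}/eval_xw {1}/eval_x !meval0 mulr0 add0r.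
rewrite eval_xw_mderiv big_lift0 -mulr_suml mulrA; congr (_ * _ * _).
apply: eq_big => [j|j _]; first by rewrite (inj_eq lift_inj).
by rewrite !extend0_lift.
Qed.

Lemma w_diffusion_generic t :
  w_diffusion s x w (eval_x x (generic_random_poly N t)) =
  \sum_a \sum_(b | b != a) - (X a * X b / (X a - X b) ^+ 2) *
     ((s a * w b - s b * w a) *
      (\prod_(l | l != a) (t - X l) - \prod_(l | l != b) (t - X l))).
Proof.
rewrite /w_diffusion /diffusion.
rewrite [RHS](eq_bigr (fun a => \sum_b if b != a then - (X a * X b / (X a - X b) ^+ 2) *
     ((s a * w b - s b * w a) *
      (\prod_(l | l != a) (t - X l) - \prod_(l | l != b) (t - X l))) else 0)); last first.
  by move=> a _; rewrite [LHS]big_mkcond.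
rewrite pair_bigA; apply: eq_bigr => -[a b] _ /=.
rewrite wderiv_generic_random_poly /wderiv !mderivC subrr meval0 mulr0 add0r.
rewrite mevalC /simplex_coef /=; case: ifP => _; last by rewrite !mul0r.
by rewrite [RHS]mulrA.
Qed.

Lemma diffusion_elementary_poly t :
  xw_diffusion (generic_random_poly N t) = D2_diffusion theta y (elementary_poly N t).
Proof.
rewrite /xw_diffusion x_diffusion_generic w_diffusion_generic.
rewrite (node_second_derivative Xinj _ _ (extend0_0 _) s_theta) D2_elementary_poly //.
congr (_ * _).
have card_pairs (I : finType) (P : pred I) n (z : R) : #|P| = n.+1 ->
    \sum_(i | P i) \sum_(j | P j && (j != i)) z = (n.+1 * n)%:R * z.
  move=> Pn; rewrite (eq_bigr (fun=> n%:R * z)) => [|i Pi].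
    by rewrite sumr_const Pn natrM -mulrA [RHS]mulr_natl.
  rewrite sumr_const mulr_natl; congr (_ *+ _); apply/eq_add_S; rewrite -Pn.
  have iP : i \in P by exact: Pi.
  by rewrite [RHS](cardD1 i) iP; congr _.+1; apply: eq_card => j; rewrite !inE andbC.
(* Without the node a there remain N nodes, as many as there are roots, so both double sums contain
   the same number of ordered pairs; the case N = 0 is apart because that number is written as n.+1
   * n. *)
have eqN : exists k, forall z : R,
    \sum_(i < N) \sum_(j < N | j != i) z = k%:R * z /\
    forall a, \sum_(i < N.+1 | i != a) \sum_(j < N.+1 | (j != a) && (j != i)) z = k%:R * z.
  case: (N) => [|n].
    exists 0%N => z; rewrite big_ord0 mul0r; split=> // a.
    by rewrite big1 // => i; rewrite !ord1 eqxx.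
  exists (n.+1 * n)%N => z; split=> [|a].
    by apply: (@card_pairs _ xpredT); rewrite card_ord.
  by apply: card_pairs; rewrite cardC1 card_ord.
have [k ksum] := eqN.
transitivity (t ^+ 2 * (\sum_a w a * \sum_(i | i != a) \sum_(j | (j != a) && (j != i))
    \prod_(l | [&& l != a, l != i & l != j]) (t - X l)) -
   k%:R * \sum_a w a * \prod_(l | l != a) (t - X l)).
  rewrite [t ^+ 2 * _]mulr_sumr [k%:R * _]mulr_sumr -sumrB; apply: eq_bigr => a _.
  rewrite [t ^+ 2 * _]mulrCA [k%:R * _]mulrCA -mulrBr; congr (_ * _).
  rewrite -(proj2 (ksum _) a) mulr_sumr -sumrB; apply: eq_bigr => i _.
  by rewrite mulr_sumr -sumrB.
rewrite -roots_horner -roots2 -(proj1 (ksum _)) mulr_sumr -sumrB; apply: eq_bigr => i _.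
by rewrite mulr_sumr -sumrB.
Qed.

Lemma xw_diffusionD F G : xw_diffusion (F + G) = xw_diffusion F + xw_diffusion G.
Proof.
rewrite /xw_diffusion /x_diffusion /w_diffusion eval_xD.
rewrite (diffusionD _ _ (eval_xwD x w)); last by move=> i f g; exact: mderivD.
rewrite (diffusionD _ _ (mevalD w)); last by move=> ab f g; exact: wderivD.
have regroup (a b c d : R) : a + b - (c + d) = a - c + (b - d) by ring.
exact: regroup.
Qed.

Lemma xw_diffusionZ c F :
  xw_diffusion (mpolyC N (mpolyC N.+1 c) * F) = c * xw_diffusion F.
Proof.
rewrite /xw_diffusion /x_diffusion /w_diffusion eval_xM mulrBr.
rewrite (diffusion_scale _ _ (eval_xwM x w)).
- rewrite (diffusion_scale _ _ (mevalM w)).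
  + have ec : eval_x x (mpolyC N (mpolyC N.+1 c)) = mpolyC N.+1 c by exact: mevalC.
    by rewrite /eval_xw ec mevalC.
  + by move=> ab f g; exact: wderivM.
  + by move=> ab; rewrite /eval_x mevalC /wderiv !mderivC subrr.
- by move=> i f g; exact: mderivM.
- by move=> i; exact: mderivC.
Qed.

Lemma xw_diffusionM F G : xw_diffusion (F * G) =
  eval_xw x w F * xw_diffusion G + eval_xw x w G * xw_diffusion F +
  2 * (carre_du_champ (eval_xw x w) (@mderiv N _) (fun i => x i ^+ 2) F G -
       carre_du_champ (meval w) (fun ab => wderiv ab.1 ab.2)
         (fun ab => simplex_coef x ab * (w ab.1 * w ab.2)) (eval_x x F) (eval_x x G)).
Proof.
rewrite /xw_diffusion /x_diffusion /w_diffusion eval_xM.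
rewrite (diffusionM _ _ (eval_xwD x w) (eval_xwM x w)); last by exact: mderivM.
  rewrite (diffusionM _ _ (mevalD w) (mevalM w)).
  - have regroup (a b c d e f g h : R) : a * b + c * d + 2 * g -
        (a * e + c * f + 2 * h) = a * (b - e) + c * (d - f) + 2 * (g - h) by ring.
    exact: regroup.
  - by move=> ab f g; exact: wderivD.
  - by move=> ab f g; exact: wderivM.
by move=> i f g; exact: mderivD.
Qed.

Lemma carre_du_champ_generic t u :
  (u - t) * (carre_du_champ (eval_xw x w) (@mderiv N _) (fun i => x i ^+ 2)
      (generic_random_poly N t) (generic_random_poly N u) -
    carre_du_champ (meval w) (fun ab => wderiv ab.1 ab.2)
         (fun ab => simplex_coef x ab * (w ab.1 * w ab.2))
      (eval_x x (generic_random_poly N t)) (eval_x x (generic_random_poly N u))) =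
  (u - t) * carre_du_champ (meval (tnth y)) (@mderiv N R)
    (fun i => tnth y i ^+ 2) (elementary_poly N t) (elementary_poly N u).
Proof.
rewrite carre_du_champ_elementary_poly !roots_horner !roots1.
rewrite -(node_carre_du_champ Xinj _ _ _ (extend0_0 _)); congr (_ * (_ - _)).
  rewrite [RHS](eq_bigl (fun i => (i != ord0) && true)); last by move=> i; rewrite andbT.
  rewrite big_lift0; apply: eq_bigr => i _.
  rewrite extend0_lift -[in RHS](mulrNN (\sum_(a | _) _)).
  by congr (_ * (_ * _)); exact: eval_xw_mderiv.
rewrite [RHS](eq_bigr (fun a => \sum_b if b != a then - (X a * X b / (X a - X b) ^+ 2) *
     (w a * w b * (\prod_(l | l != a) (t - X l) - \prod_(l | l != b) (t - X l)) *
      (\prod_(l | l != a) (u - X l) - \prod_(l | l != b) (u - X l))) else 0)); last first.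
  by move=> a _; rewrite [LHS]big_mkcond.
rewrite pair_bigA; apply: eq_bigr => -[a b] _ /=.
have evw v : meval w (wderiv a b (eval_x x (generic_random_poly N v))) =
    \prod_(l | l != a) (v - X l) - \prod_(l | l != b) (v - X l).
  by rewrite wderiv_generic_random_poly mevalC.
transitivity (simplex_coef x (a, b) * (w a * w b) *
    ((\prod_(l | l != a) (t - X l) - \prod_(l | l != b) (t - X l)) *
     (\prod_(l | l != a) (u - X l) - \prod_(l | l != b) (u - X l)))).
  by congr (_ * (_ * _)); exact: evw.
rewrite /simplex_coef /=; case: ifP => _; last by rewrite !mul0r.
have regroup (c d e f g : R) : c * (d * e) * (f * g) = c * (d * e * f * g) by ring.
exact: regroup.
Qed.

Lemma diffusion_elementary_polyM t u : u != t ->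
  xw_diffusion (generic_random_poly N t * generic_random_poly N u) =
  D2_diffusion theta y (elementary_poly N t * elementary_poly N u).
Proof.
move=> ut; rewrite xw_diffusionM !diffusion_elementary_poly {3}/D2_diffusion.
rewrite (diffusionM _ _ (mevalD (tnth y)) (mevalM (tnth y))).
- rewrite !eval_xw_generic_random_poly -!roots_horner !meval_elementary_poly.
  congr (_ + 2 * _); apply: (@mulfI _ (u - t)); first by rewrite subr_eq0.
  exact: carre_du_champ_generic.
- by move=> i f g; exact: mderivD.
- by move=> i f g; exact: mderivM.
Qed.

End intertwining.

(** * From generating polynomials to all symmetric polynomials *)

Section symmetric_substitution.
Variables (R : realType) (N : nat).

(** For P = [subst_esym g] this is the polynomial F in x and w with F(x, w) = P(y), by [eval_subst].
    The shift of the index leaves out e_0 = 1. *)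
Definition subst_weighted_esym : mpoly N R -> mpoly N (mpoly N.+1 R) :=
  mmap (@mpolyC N _ \o @mpolyC N.+1 R) (fun k => weighted_esym R N k.+1).

Definition subst_esym : mpoly N R -> mpoly N R :=
  comp_mpoly [tuple mesym N R i.+1 | i < N].

Lemma subst_weighted_esymX k : subst_weighted_esym (mpolyX R (mnm1 k)) =
  weighted_esym R N k.+1.
Proof. by rewrite /subst_weighted_esym mmapX mmap1U. Qed.

Lemma subst_esymX k : subst_esym (mpolyX R (mnm1 k)) = mesym N R k.+1.
Proof. by rewrite /subst_esym comp_mpolyXU -tnth_nth tnth_mktuple. Qed.

Lemma subst_weighted_esymM : {morph subst_weighted_esym : f g / f * g}.
Proof. by move=> f g; exact: rmorphM. Qed.

Lemma subst_weighted_esymD : {morph subst_weighted_esym : f g / f + g}.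
Proof. by move=> f g; exact: mmapD. Qed.

Lemma subst_weighted_esymC c : subst_weighted_esym (mpolyC N c) = mpolyC N (mpolyC N.+1 c).
Proof. exact: mmapC. Qed.

Lemma subst_weighted_esymZ c f : subst_weighted_esym (c *: f) =
  mpolyC N (mpolyC N.+1 c) * subst_weighted_esym f.
Proof. by rewrite -mul_mpolyC subst_weighted_esymM subst_weighted_esymC. Qed.

Lemma subst_esymM : {morph subst_esym : f g / f * g}.
Proof. by move=> f g; exact: rmorphM. Qed.

Variables (theta : R) (s : 'I_N.+1 -> R) (x : 'I_N -> R).
Variables (w : 'I_N.+1 -> R) (y : N.-tuple R).
Local Notation X := (extend0 x).
Hypothesis s_theta : forall a, a != ord0 -> s a = theta.
Hypothesis Xinj : injective X.
Hypothesis yinj : injective (tnth y).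
Hypothesis roots_y : \sum_a w a *: \prod_(l | l != a) ('X - (X l)%:P) =
  \prod_l ('X - (tnth y l)%:P).

Local Notation delta F G := (xw_diffusion theta s x w F - D2_diffusion theta y G).

Let deltaD F F' G G' : delta (F + F') (G + G') = delta F G + delta F' G'.
Proof.
rewrite xw_diffusionD /D2_diffusion (diffusionD _ _ (mevalD (tnth y))); last first.
  by move=> i f g; exact: mderivD.
have regroup (a b c d : R) : a + b - (c + d) = a - c + (b - d) by ring.
exact: regroup.
Qed.

Let deltaZ c F G : delta (mpolyC N (mpolyC N.+1 c) * F) (mpolyC N c * G) = c * delta F G.
Proof.
rewrite xw_diffusionZ /D2_diffusion (diffusion_scale _ _ (mevalM (tnth y))).
- by rewrite [RHS]mulrBr; congr (_ - _ * _); exact: mevalC.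
- by move=> i f g; exact: mderivM.
- by move=> i; exact: mderivC.
Qed.

Let delta0 : delta 0 0 = 0.
Proof.
have := deltaD 0 0 0 0; rewrite !addr0 => e.
by apply: (addrI (delta 0 0)); rewrite -e addr0.
Qed.

Let delta_sum (I : Type) (r : seq I) (P : pred I) F G :
  delta (\sum_(i <- r | P i) F i) (\sum_(i <- r | P i) G i) =
  \sum_(i <- r | P i) delta (F i) (G i).
Proof.
elim: r => [|i r IH]; first by rewrite !big_nil; exact: delta0.
by rewrite !big_cons; case: (P i) => //; rewrite -IH; exact: deltaD.
Qed.

Let delta_comb (c : 'I_N.+1 -> R) F G :
  delta (\sum_k mpolyC N (mpolyC N.+1 (c k)) * F k) (\sum_k mpolyC N (c k) * G k) =
  \sum_k c k * delta (F k) (G k).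
Proof.
etransitivity; first exact: delta_sum.
by apply: eq_bigr => k _; exact: deltaZ.
Qed.

Lemma eval_weighted_esym (k : 'I_N.+1) :
  eval_xw x w (weighted_esym R N k) = meval (tnth y) (mesym N R k).
Proof.
apply/eqP; rewrite -subr_eq0; apply/eqP; move: k.
apply: (@alternating_coefs_eq0 _ _ _ 0) => t _.
transitivity (eval_xw x w (generic_random_poly N t) -
    meval (tnth y) (elementary_poly N t)); last first.
  rewrite eval_xw_generic_random_poly meval_elementary_poly (roots_horner roots_y).
  by rewrite subrr.
rewrite generic_random_polyE elementary_polyE eval_xw_sum
  (raddf_sum (meval (tnth y))) -sumrB.
apply: eq_bigr => k _; rewrite mulrBr; congr (_ - _) => /=; last first.
  by rewrite mevalM mevalC.
rewrite eval_xwM; congr (_ * _).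
by rewrite /eval_xw /eval_x !mevalC.
Qed.

Lemma diffusion_esym (k : 'I_N.+1) :
  delta (weighted_esym R N k) (mesym N R k) = 0.
Proof.
move: k; apply: (@alternating_coefs_eq0 _ _ _ 0) => t _.
transitivity (delta (generic_random_poly N t) (elementary_poly N t)); last first.
  by rewrite (diffusion_elementary_poly s_theta Xinj yinj roots_y) subrr.
rewrite generic_random_polyE elementary_polyE.
exact/esym/(delta_comb (fun k => (-1) ^+ k * t ^+ (N - k))
  (fun k => weighted_esym R N k) (fun k => mesym N R k)).
Qed.

Lemma diffusion_esymM (k l : 'I_N.+1) :
  delta (weighted_esym R N k * weighted_esym R N l) (mesym N R k * mesym N R l) = 0.
Proof.
have expand_generic v (F : mpoly N (mpoly N.+1 R)) : F * generic_random_poly N v =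
    \sum_(k < N.+1) mpolyC N (mpolyC N.+1 ((-1) ^+ k * v ^+ (N - k))) *
      (F * weighted_esym R N k).
  by rewrite generic_random_polyE mulr_sumr; apply: eq_bigr => i _; rewrite mulrCA.
have expand_elementary v (F : mpoly N R) : F * elementary_poly N v =
    \sum_(k < N.+1) mpolyC N ((-1) ^+ k * v ^+ (N - k)) * (F * mesym N R k).
  by rewrite elementary_polyE mulr_sumr; apply: eq_bigr => i _; rewrite mulrCA.
move: l; apply: (@alternating_coefs_eq0 _ _ _ 0) => u _.
move: k; apply: (@alternating_coefs_eq0 _ _ _ u) => t tu.
transitivity (delta (generic_random_poly N t * generic_random_poly N u)
   (elementary_poly N t * elementary_poly N u)); last first.
  rewrite (diffusion_elementary_polyM s_theta Xinj yinj roots_y) ?subrr //.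
  by rewrite eq_sym.
rewrite [generic_random_poly _ _ * _]mulrC [elementary_poly _ _ * _]mulrC.
rewrite (expand_generic t) (expand_elementary t).
apply: etrans (esym (delta_comb _ _ _)); apply: eq_bigr => k _; congr (_ * _).
rewrite [generic_random_poly _ _ * _]mulrC [elementary_poly _ _ * _]mulrC.
by rewrite (expand_generic u) (expand_elementary u); exact/esym/delta_comb.
Qed.

Lemma eval_subst f :
  eval_xw x w (subst_weighted_esym f) = meval (tnth y) (subst_esym f).
Proof.
rewrite (mpolyE f) /subst_weighted_esym /subst_esym.
rewrite (raddf_sum (mmap _ _)) (raddf_sum (comp_mpoly _)) eval_xw_sum.
rewrite (raddf_sum (meval _)); apply: eq_bigr => m _ /=.
rewrite mmapZ comp_mpolyZ mevalZ eval_xwM; congr (_ * _).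
  by rewrite /eval_xw /eval_x !mevalC.
rewrite mmapX comp_mpolyX /mmap1 rmorph_prod.
rewrite (big_morph _ (eval_xwM x w) (_ : _ 1 = 1)); last first.
  by rewrite /eval_xw /eval_x !meval1.
apply: eq_bigr => k _ /=; rewrite rmorphXn tnth_mktuple /=.
rewrite -(eval_weighted_esym (lift ord0 k)).
elim: (m k) => [|j IH]; first by rewrite !expr0 /eval_xw /eval_x !meval1.
by rewrite !exprS eval_xwM IH.
Qed.

Lemma diffusion_subst f :
  xw_diffusion theta s x w (subst_weighted_esym f) = D2 theta (subst_esym f) y.
Proof.
apply/eqP; rewrite D2E -subr_eq0; apply/eqP; move: f.
have phi_eq := eval_subst.
have delta_second_order : second_order (eval_xw x w \o subst_weighted_esym)
    (fun f => delta (subst_weighted_esym f) (subst_esym f)).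
  apply: second_orderB.
    apply: (second_order_comp subst_weighted_esymM); apply: second_orderB.
      apply: second_order_diffusion (eval_xwD x w) (eval_xwM x w) _ _.
        by move=> i f g; exact: mderivD.
      by move=> i f g; exact: mderivM.
    apply: (@second_order_comp _ _ _ (eval_x x) (meval w)); first exact: eval_xM.
    apply: second_order_diffusion (mevalD w) (mevalM w) _ _.
      by move=> i f g; exact: wderivD.
    by move=> i f g; exact: wderivM.
  (* The two operators can be subtracted because evaluating F at (x, w) and P at y is the same
     morphism on g. *)
  have -> : eval_xw x w \o subst_weighted_esym = meval (tnth y) \o subst_esym.
    exact/funext.
  apply: (second_order_comp subst_esymM).
  apply: second_order_diffusion (mevalD (tnth y)) (mevalM (tnth y)) _ _.
    by move=> i f g; exact: mderivD.
  by move=> i f g; exact: mderivM.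
apply: (@second_order_eq0 _ _ (eval_xw x w \o subst_weighted_esym)).
- exact: delta_second_order.
- move=> c f g; rewrite subst_weighted_esymD subst_weighted_esymZ.
  rewrite [subst_esym _](_ : _ = mpolyC N c * subst_esym f + subst_esym g).
    by apply: etrans (deltaD _ _ _ _) _; congr (_ + _); exact: deltaZ.
  by rewrite /subst_esym comp_mpolyD comp_mpolyZ mul_mpolyC.
(* At f = g = h = 1 the second order identity reads D 1 = 3 D 1 - 3 D 1. *)
- have := delta_second_order 1 1 1; rewrite !mulr1 /= => ->.
  have -> : eval_xw x w (subst_weighted_esym 1) = 1.
    by rewrite phi_eq /subst_esym comp_mpoly1 meval1.
  by rewrite !mul1r; ring.
- move=> i.
  rewrite subst_weighted_esymX subst_esymX; exact: (diffusion_esym (lift ord0 i)).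
- move=> i j; rewrite subst_weighted_esymM subst_esymM !subst_weighted_esymX !subst_esymX.
  exact: (diffusion_esymM (lift ord0 i) (lift ord0 j)).
Qed.

End symmetric_substitution.

(** * Dirichlet means of polynomials *)

Section dirichlet_mean.
Variables (R : realType) (N : nat) (s : 'I_N.+1 -> R).
Local Notation A := (mpoly N.+1 R).

Definition rising (a : R) (n : nat) : R := \prod_(j < n) (a + j%:R).

Lemma rising0 a : rising a 0 = 1.
Proof. by rewrite /rising big_ord0. Qed.

Lemma risingS a n : rising a n.+1 = rising a n * (a + n%:R).
Proof. by rewrite /rising big_ord_recr. Qed.

Definition dirichlet_moment (m : multinom N.+1) : R :=
  (\prod_i rising (s i) (m i)) / rising (\sum_i s i) (mdeg m).

Lemma dirichlet_moment0 : dirichlet_moment mnm0 = 1.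
Proof.
rewrite /dirichlet_moment mdeg0 rising0 divr1 big1 // => i _.
by rewrite mnm0E rising0.
Qed.

Lemma dirichlet_momentS a (m : multinom N.+1) : dirichlet_moment (mnm_add (mnm1 a) m) =
  dirichlet_moment m * ((s a + (m a)%:R) / (\sum_i s i + (mdeg m)%:R)).
Proof.
rewrite /dirichlet_moment mdegD mdeg1 add1n risingS invfM mulrACA; congr (_ * _).
rewrite (bigD1 a) //= [in RHS](bigD1 a) //= mnmDE mnm1E eqxx risingS mulrAC.
congr (_ * _ * _); apply: eq_bigr => i ia.
by rewrite mnmDE mnm1E eq_sym (negbTE ia).
Qed.

(* The expectation of [f] under the Dirichlet distribution, computed from the moments; see
   [integral_dirichlet_mean]. *)
Definition dirichlet_mean (f : A) : R :=
  \sum_(m <- msupp f) mcoeff m f * dirichlet_moment m.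

Lemma dirichlet_meanE (f : A) (r : seq (multinom N.+1)) :
  uniq r -> {subset msupp f <= r} ->
  dirichlet_mean f = \sum_(m <- r) mcoeff m f * dirichlet_moment m.
Proof.
move=> ur fr; rewrite [RHS](bigID (mem (msupp f))) /= [X in _ + X]big1 => [|m mf].
  rewrite addr0 -big_filter; apply/perm_big/uniq_perm; rewrite ?msupp_uniq ?filter_uniq //.
  by move=> m; rewrite mem_filter andb_idr //; exact: fr.
by rewrite (memN_msupp_eq0 mf) mul0r.
Qed.

Lemma dirichlet_mean_is_additive : additive dirichlet_mean.
Proof.
move=> f g; pose r := undup (msupp f ++ msupp g ++ msupp (f - g)).
have sr h : {subset msupp h <= msupp f ++ msupp g ++ msupp (f - g)} ->
    dirichlet_mean h = \sum_(m <- r) mcoeff m h * dirichlet_moment m.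
  move=> hr; apply: dirichlet_meanE; first exact: undup_uniq.
  by move=> m mh; rewrite mem_undup hr.
rewrite !sr; first (by rewrite -sumrB; apply: eq_bigr => m _; rewrite mcoeffB mulrBl).
- by move=> m; rewrite !mem_cat => ->; rewrite orbT.
- by move=> m; rewrite !mem_cat => ->.
- by move=> m; rewrite !mem_cat => ->; rewrite !orbT.
Qed.

HB.instance Definition _ :=
  GRing.isAdditive.Build A R dirichlet_mean dirichlet_mean_is_additive.

Lemma dirichlet_meanX m : dirichlet_mean (mpolyX R m) = dirichlet_moment m.
Proof. by rewrite /dirichlet_mean msuppX big_seq1 mcoeffX eqxx mul1r. Qed.

Lemma dirichlet_meanZ c f : dirichlet_mean (mpolyC N.+1 c * f) = c * dirichlet_mean f.
Proof.
rewrite mul_mpolyC; have [->|c0] := eqVneq c 0; first by rewrite scale0r mul0r raddf0.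
rewrite /dirichlet_mean (perm_big _ (msuppZ _ c0)) mulr_sumr.
by apply: eq_bigr => m _; rewrite mcoeffZ mulrA.
Qed.

(** Integration by parts along the edge e_a - e_b, done on moments: for f = w^m the mean is (s_a +
    m_a) E[w_b w^m] - (s_b + m_b) E[w_a w^m], and by [dirichlet_momentS] both terms are the same
    multiple of (s_a + m_a) (s_b + m_b). With [wderiv a b f] in place of [f] it says that
    [simplex_generator a b f] has mean 0. *)
Lemma dirichlet_mean_by_parts a b f :
  dirichlet_mean (mpolyX R (mnm1 a) * mpolyX R (mnm1 b) * wderiv a b f +
   (mpolyC N.+1 (s a) * mpolyX R (mnm1 b) - mpolyC N.+1 (s b) * mpolyX R (mnm1 a)) * f) = 0.
Proof.
set xa := mpolyX R (mnm1 a); set xb := mpolyX R (mnm1 b).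
rewrite {1 2}(mpolyE f).
elim: (msupp f) => [|m r IH].
  rewrite big_nil /wderiv (raddf0 (mderiv a)) (raddf0 (mderiv b)) subrr !mulr0 addr0.
  exact: raddf0.
rewrite big_cons; set c := mcoeff m f; set g := \sum_(i <- r) _ in IH *.
have -> : xa * xb * wderiv a b (c *: mpolyX R m + g) +
    (mpolyC N.+1 (s a) * xb - mpolyC N.+1 (s b) * xa) * (c *: mpolyX R m + g) =
  mpolyC N.+1 c * (xa * xb * wderiv a b (mpolyX R m) +
    (mpolyC N.+1 (s a) * xb - mpolyC N.+1 (s b) * xa) * mpolyX R m) +
  (xa * xb * wderiv a b g + (mpolyC N.+1 (s a) * xb - mpolyC N.+1 (s b) * xa) * g).
  by rewrite wderivD -mul_mpolyC /wderiv !mderiv_mulC; ring.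
rewrite raddfD /= IH addr0 dirichlet_meanZ.
have mderivX' k : mpolyX R (mnm1 k) * mderiv k (mpolyX R m) =
    mpolyC N.+1 (m k)%:R * mpolyX R m.
  rewrite mderivX -mul_mpolyC mulrCA -mpolyXD.
  have [->|mk] := eqVneq (m k) 0%N; first by rewrite mpolyC0 !mul0r.
  by rewrite addmC submK // lep1mP.
have -> : xa * xb * wderiv a b (mpolyX R m) +
    (mpolyC N.+1 (s a) * xb - mpolyC N.+1 (s b) * xa) * mpolyX R m =
  mpolyC N.+1 (s a + (m a)%:R) * mpolyX R (mnm_add (mnm1 b) m) -
  mpolyC N.+1 (s b + (m b)%:R) * mpolyX R (mnm_add (mnm1 a) m).
  rewrite !mpolyXD -/xa -/xb.
  transitivity (xb * (xa * mderiv a (mpolyX R m)) - xa * (xb * mderiv b (mpolyX R m)) +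
    (mpolyC N.+1 (s a) * xb - mpolyC N.+1 (s b) * xa) * mpolyX R m).
    by rewrite /wderiv; ring.
  by rewrite !mderivX' !mpolyCD; ring.
rewrite raddfB /= !dirichlet_meanZ !dirichlet_meanX !dirichlet_momentS.
by ring.
Qed.

Lemma dirichlet_mean_D2_w (x : 'I_N -> R) f : dirichlet_mean (D2_w s x f) = 0.
Proof.
rewrite /D2_w (raddf_sum dirichlet_mean) big1 // => -[a b] _ /=.
by rewrite dirichlet_meanZ /simplex_generator dirichlet_mean_by_parts mulr0.
Qed.

End dirichlet_mean.

Section average.
Variables (R : realType) (N : nat) (s : 'I_N.+1 -> R).

Definition average (F : mpoly N (mpoly N.+1 R)) : mpoly N R :=
  map_mpoly (dirichlet_mean s) F.

Lemma mcoeff_average m F : mcoeff m (average F) = dirichlet_mean s (mcoeff m F).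
Proof. by rewrite /average mcoeff_map_mpoly. Qed.

Lemma mderiv_average i F : mderiv i (average F) = average (mderiv i F).
Proof.
apply/mpolyP => m; rewrite mcoeff_average !mcoeff_deriv mcoeff_average.
by rewrite raddfMn.
Qed.

Lemma meval_average x F : meval x (average F) = dirichlet_mean s (eval_x x F).
Proof.
have -> : average F = \sum_(m <- msupp F)
    mpolyC N (dirichlet_mean s (mcoeff m F)) * mmap1 (fun i => mpolyX R (mnm1 i)) m by [].
have -> : eval_x x F =
    \sum_(m <- msupp F) mcoeff m F * mmap1 (fun i => mpolyC N.+1 (x i)) m by [].
rewrite (raddf_sum (meval x)) (raddf_sum (dirichlet_mean s)).
apply: eq_bigr => m _; rewrite /= /mmap1.
have -> : \prod_(i < N) mpolyC N.+1 (x i) ^+ m i = mpolyC N.+1 (\prod_(i < N) x i ^+ m i).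
  by rewrite rmorph_prod; apply: eq_bigr => i _; rewrite rmorphXn.
rewrite [in RHS]mulrC dirichlet_meanZ mevalM mevalC mulrC; congr (_ * _).
rewrite (rmorph_prod (meval x)); apply: eq_bigr => i _.
by rewrite rmorphXn /= mevalXU.
Qed.

Lemma D2_average theta (x : N.-tuple R) F :
  D2 theta (average F) x = dirichlet_mean s (D2_x theta (tnth x) F).
Proof.
have mean_term c H : dirichlet_mean s (mpolyC N.+1 c * eval_x (tnth x) H) =
    c * peval (average H) x.
  by rewrite dirichlet_meanZ -meval_average.
rewrite /D2 /D2_x (raddf_sum (dirichlet_mean s)) mulr_sumr -big_split.
apply: eq_bigr => i _; rewrite (raddfD (dirichlet_mean s)) /=.
congr (_ + _).
  by apply: etrans (esym (mean_term _ _)); rewrite -!mderiv_average.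
apply: etrans (esym (mean_term _ _)); rewrite -mderiv_average -mulr_suml.
exact: mulrA.
Qed.

End average.

(** * Interlacing *)

Section interlacing.
Variables (R : rcfType) (N : nat) (X w : 'I_N.+1 -> R).
Hypothesis X_mono : forall i j : 'I_N.+1, (i <= j)%N -> X i <= X j.
Hypothesis w_gt0 : forall a, 0 < w a.
Hypothesis sum_w : \sum_a w a = 1.

(** As numbers, [lift ord_max i] is i and [lift ord0 i] is i + 1, so [lo i] and [hi i] are the ends
    of the i-th interval between consecutive nodes. *)
Let lo (i : 'I_N) := X (lift ord_max i).
Let hi (i : 'I_N) := X (lift ord0 i).
Let gap : pred 'I_N := fun i => lo i < hi i.

Let le_lo_hi i : lo i <= hi i.
Proof. apply: X_mono; rewrite /= /bump [(N <= i)%N]leqNgt ltn_ord add0n.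
by rewrite add1n leqnSn. Qed.

Let gapN i : ~~ gap i -> lo i = hi i.
Proof. by rewrite /gap -leNgt => hl; apply/eqP; rewrite eq_le le_lo_hi. Qed.

Let le_hi_lo (i j : 'I_N) : (i < j)%N -> hi i <= lo j.
Proof.
by move=> ij; apply: X_mono; rewrite /= /bump [(N <= j)%N]leqNgt ltn_ord add0n add1n.
Qed.

(** Whichever node is removed, the i-th remaining one is an end of the i-th interval. *)
Let X_lift a i : X (lift a i) = if (i < a)%N then lo i else hi i.
Proof.
rewrite /lo /hi; case: ifP => ia; congr (X _); apply/val_inj; rewrite /= /bump.
  by rewrite leqNgt ia leqNgt ltn_ord.
by rewrite leqNgt ia.
Qed.

Let q' : {poly R} := \sum_a w a *: \prod_(i | gap i) ('X - (X (lift a i))%:P).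

(* Coincident nodes contribute a common factor to every summand. *)
Let factor_q : \sum_a w a *: \prod_(l | l != a) ('X - (X l)%:P) =
  \prod_(i | ~~ gap i) ('X - (lo i)%:P) * q'.
Proof.
rewrite mulr_sumr; apply: eq_bigr => a _; rewrite -scalerAr; congr (_ *: _).
transitivity (\prod_i ('X - (X (lift a i))%:P)).
  rewrite big_mkcond (bigD1_ord a) //= eqxx mul1r; apply: eq_bigr => i _.
  by rewrite eq_sym neq_lift.
rewrite (bigID gap) /= mulrC; congr (_ * _); apply: eq_bigr => i gi.
by rewrite X_lift gapN // if_same.
Qed.

(** [b j] records on which side of c the j-th gap lies. At c all summands of q' then have weakly the
    same sign and the one of [a0] has it strictly, so nothing cancels. *)
Let q'_sign (c : R) (b : pred 'I_N) (a0 : 'I_N.+1) :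
  (forall j, gap j -> if b j then hi j <= c else c <= lo j) ->
  (forall j, gap j -> if b j then X (lift a0 j) < c else c < X (lift a0 j)) ->
  0 < q'.[c] * \prod_(j | gap j) (if b j then 1 else -1).
Proof.
move=> hb ha0.
have -> : q'.[c] * \prod_(j | gap j) (if b j then 1 else -1) =
    \sum_a w a * \prod_(j | gap j) ((c - X (lift a j)) * (if b j then 1 else -1)).
  rewrite horner_sum mulr_suml; apply: eq_bigr => a _.
  rewrite hornerZ -mulrA horner_prod -big_split; congr (_ * _).
  by apply: eq_bigr => j _; rewrite hornerXsubC.
rewrite (bigD1 a0) //= ltr_pwDl //.
  rewrite mulr_gt0 // prodr_gt0 // => j gj; have := ha0 j gj.
  by case: (b j) => h; rewrite ?mulr1 ?mulrN1 ?oppr_gt0 ?subr_gt0 ?subr_lt0.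
rewrite sumr_ge0 // => a _; rewrite mulr_ge0 ?(ltW (w_gt0 a)) //.
rewrite prodr_ge0 // => j gj; have := hb j gj; rewrite X_lift.
have lh := le_lo_hi j.
by case: (b j) => h; rewrite ?mulr1 ?mulrN1 ?oppr_ge0 ?subr_ge0 ?subr_le0;
  case: ifP => _ //; [apply: le_trans h|apply: le_trans lh].
Qed.

Let le_lo (i j : 'I_N) : (i <= j)%N -> lo i <= lo j.
Proof.
rewrite leq_eqVlt => /predU1P[/val_inj -> //|/le_hi_lo]; exact: le_trans (le_lo_hi i).
Qed.

Let le_hi (i j : 'I_N) : (i <= j)%N -> hi i <= hi j.
Proof.
rewrite leq_eqVlt => /predU1P[/val_inj -> //|/le_hi_lo h]; exact: le_trans (le_lo_hi j).
Qed.

(** The sign patterns of q' at the two ends of a gap differ only at j = i, so q' changes sign across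
    it. A degenerate interval supplies its single point, which makes the choice total in i. *)
Let root_in_gap i : exists y, (lo i <= y <= hi i) /\ (gap i -> root q' y /\ lo i < y < hi i).
Proof.
have [gi|ngi] := boolP (gap i); last first.
  by exists (lo i); rewrite lexx le_lo_hi.
have q_lo : 0 < q'.[lo i] * \prod_(j | gap j) (if (j < i)%N then 1 else -1).
  apply: (@q'_sign _ _ (lift ord_max i)) => j gj.
    by case: ltnP => [/le_hi_lo|/le_lo].
  rewrite X_lift /= /bump [(N <= i)%N]leqNgt ltn_ord add0n.
  by case: ltnP => [/le_hi_lo|/le_lo]; [apply: lt_le_trans|move/le_lt_trans; apply].
have q_hi : 0 < q'.[hi i] * \prod_(j | gap j) (if (j <= i)%N then 1 else -1).
  apply: (@q'_sign _ _ (lift ord0 i)) => j gj.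
    by case: leqP => [/le_hi|/le_hi_lo].
  rewrite X_lift /= /bump add1n ltnS.
  by case: leqP => [/le_hi|/le_hi_lo]; [apply: lt_le_trans|move/le_lt_trans; apply].
move: q_lo q_hi; rewrite (bigD1 i gi) /= ltnn mulN1r.
rewrite [X in _ -> 0 < _ * X -> _](bigD1 i gi) /= leqnn mul1r.
rewrite [X in _ -> 0 < _ * X -> _](eq_bigr (fun j : 'I_N => if (j < i)%N then 1 else -1 : R))
    => [|j /andP[_ ji]]; last first.
  by rewrite leq_eqVlt; case: eqP => // /val_inj e; rewrite e eqxx in ji.
set p := \prod_(_ | _) _; rewrite mulrN oppr_gt0 => lo_lt hi_gt.
have [y hy ry] : exists2 y, lo i <= y <= hi i & root q' y.
  have [p_gt0|p_lt0|p0] := ltgtP 0 p; last by rewrite -p0 mulr0 ltxx in lo_lt.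
    apply: poly_ivt; first exact: le_lo_hi.
    by move: lo_lt hi_gt; rewrite pmulr_llt0 // pmulr_lgt0 // => /ltW -> /ltW ->.
  have [|y hy] := @poly_ivt _ (- q') (lo i) (hi i) (le_lo_hi i).
    move: lo_lt hi_gt; rewrite nmulr_llt0 // nmulr_lgt0 // !hornerN.
    by rewrite oppr_le0 oppr_ge0 => /ltW -> /ltW ->.
  by rewrite rootN; exists y.
have q_lo : q'.[lo i] != 0 by apply: contraTneq lo_lt => ->; rewrite mul0r ltxx.
have q_hi : q'.[hi i] != 0 by apply: contraTneq hi_gt => ->; rewrite mul0r ltxx.
exists y; split=> // _; split=> //.
have [/andP[l h] /eqP qy] := (hy, ry).
have yl : lo i != y by apply: contraNneq q_lo => ->; rewrite qy.
have yh : y != hi i by apply: contraNneq q_hi => <-; rewrite qy.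
by rewrite !lt_neqAle l h yl yh.
Qed.

(** The weights sum to 1, so q' is monic of degree the number of gaps; one root in each of these
    disjoint open gaps exhausts its roots. *)
Lemma interlacing_roots : exists y : 'I_N -> R,
  [/\ forall i, X (lift ord_max i) <= y i <= X (lift ord0 i),
      forall i, X (lift ord_max i) < X (lift ord0 i) ->
        X (lift ord_max i) < y i < X (lift ord0 i) &
      \sum_a w a *: \prod_(l | l != a) ('X - (X l)%:P) =
        \prod_i ('X - (y i)%:P)].
Proof.
have [y hy] := fin_all_exists root_in_gap.
have y_in i : lo i <= y i <= hi i by have [] := hy i.
have y_gap i : gap i -> root q' (y i) /\ lo i < y i < hi i by have [_] := hy i.
exists y; split=> // [i /y_gap[] //|].
rewrite factor_q [RHS](bigID (predC gap)) /=; congr (_ * _).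
  apply: eq_bigr => i gi; congr ('X - _%:P); apply/eqP; rewrite eq_le.
  by have := y_in i; rewrite -(gapN gi) andbC.
under [RHS]eq_bigl => i do rewrite negbK.
set n := size (enum gap).
have size_prod (a : 'I_N.+1) : size (\prod_(i | gap i) ('X - (X (lift a i))%:P)) = n.+1.
  by rewrite -big_enum size_prod_XsubC.
have monic_prod (a : 'I_N.+1) : \prod_(i | gap i) ('X - (X (lift a i))%:P) \is monic.
  by rewrite -big_enum monic_prod_XsubC.
have q'n : q'`_n = 1.
  rewrite coef_sum -[RHS]sum_w; apply: eq_bigr => a _; rewrite coefZ.
  by have /monicP := monic_prod a; rewrite /lead_coef size_prod /= => ->; rewrite mulr1.
have sz : size q' = n.+1.
  apply/eqP; rewrite eqn_leq; apply/andP; split.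
    apply: leq_trans (size_sum _ _ _) _; apply/bigmax_leqP => a _.
    by apply: leq_trans (size_scale_leq _ _) _; rewrite size_prod.
  by apply: contraT; rewrite -leqNgt => /leq_sizeP /(_ n (leqnn n))/eqP; rewrite q'n oner_eq0.
have lc : lead_coef q' = 1 by rewrite /lead_coef sz.
have y_lt (i j : 'I_N) : gap i -> gap j -> (i < j)%N -> y i < y j.
  move=> /y_gap[_ /andP[_ yi]] /y_gap[_ /andP[yj _]] ij.
  by apply: lt_trans yi (le_lt_trans (le_hi_lo ij) yj).
rewrite [LHS](@all_roots_prod_XsubC _ _ [seq y i | i <- enum gap]).
- by rewrite lc scale1r big_map big_enum.
- by rewrite size_map.
- by apply/allP => z /mapP[i]; rewrite mem_enum => /y_gap[ry _] ->.
- rewrite uniq_rootsE map_inj_in_uniq ?enum_uniq // => i j.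
  rewrite !mem_enum => gi gj e; case: (ltngtP i j) => [ij|ji|/val_inj //].
    by have := y_lt _ _ gi gj ij; rewrite e ltxx.
  by have := y_lt _ _ gj gi ji; rewrite e ltxx.
Qed.

End interlacing.

(** * Leading monomials *)

Section dominance.
Variable N : nat.
Implicit Types (m mu nu : multinom N) (I : {set 'I_N}).

Definition psum mu k := (\sum_(i < N | (i < k)%N) mu i)%N.

Definition initial k : {set 'I_N} := [set i : 'I_N | (i < k)%N].

Lemma psumE mu k : psum mu k = (\sum_(i in initial k) mu i)%N.
Proof. by apply: eq_bigl => i; rewrite inE. Qed.

Lemma card_initial k : #|initial k| = minn k N.
Proof.
rewrite cardE -(size_map val) -(size_iota 0 (minn k N)); apply/perm_size/uniq_perm.
- by rewrite map_inj_uniq ?enum_uniq //; exact: val_inj.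
- exact: iota_uniq.
move=> j; rewrite mem_iota leq0n add0n leq_min /=.
apply/mapP/andP => [[i]|[jk jN]].
  by rewrite mem_enum inE => ik ->; rewrite ik ltn_ord.
by exists (Ordinal jN); rewrite // mem_enum inE.
Qed.

Lemma psum_min mu k : psum mu (minn k N) = psum mu k.
Proof. by apply: eq_bigl => i; rewrite leq_min ltn_ord andbT. Qed.

Lemma psum_add mu nu k : psum (mnm_add mu nu) k = (psum mu k + psum nu k)%N.
Proof. by rewrite /psum -big_split; apply: eq_bigr => i _; rewrite mnmDE. Qed.

Lemma psumS mu (i : 'I_N) : psum mu i.+1 = (psum mu i + mu i)%N.
Proof.
rewrite /psum (bigD1 i) //= addnC; congr (_ + _)%N; apply: eq_bigl => j.
by rewrite ltnS ltn_neqAle andbC.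
Qed.

Lemma psum_inj mu nu : (forall k, psum mu k = psum nu k) -> mu = nu.
Proof.
move=> e; apply/mnmP => i; apply: (@addnI (psum mu i)).
by rewrite -psumS e psumS e.
Qed.

(** Dominance for an arbitrary exponent [m]: bounding all subset sums bounds the partial sums of its
    decreasing rearrangement, so the permutations of a monomial are covered without sorting. [mu] is
    meant to be decreasing. *)
Definition dominated mu m := (mdeg m == mdeg mu) &&
  [forall I : {set 'I_N}, (\sum_(i in I) m i <= psum mu #|I|)%N].

Lemma dominatedP mu m : reflect (mdeg m = mdeg mu /\
  forall I, (\sum_(i in I) m i <= psum mu #|I|)%N) (dominated mu m).
Proof.
apply: (iffP andP) => [[/eqP d /forallP h]|[/eqP d h]]; first by split.
by split=> //; apply/forallP.
Qed.

Lemma dominated_psum mu m k : dominated mu m -> (psum m k <= psum mu k)%N.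
Proof. by case/dominatedP => _ h; rewrite psumE -(psum_min mu) -card_initial. Qed.

Lemma dominated_trans mu nu m : dominated nu mu -> dominated mu m -> dominated nu m.
Proof.
move=> h /dominatedP[dm hm]; have /dominatedP[dmu _] := h.
apply/dominatedP; split; first by rewrite dm.
by move=> I; apply: leq_trans (hm I) (dominated_psum _ h).
Qed.

Lemma dominated0 : dominated mnm0 mnm0.
Proof. by apply/dominatedP; split=> // I; rewrite big1 // => i _; rewrite mnm0E. Qed.

Lemma dominatedD mu nu m m' :
  dominated mu m -> dominated nu m' -> dominated (mnm_add mu nu) (mnm_add m m').
Proof.
move=> /dominatedP[d h] /dominatedP[d' h']; apply/dominatedP; split.
  by rewrite !mdegD d d'.
move=> I; rewrite psum_add; under eq_bigr => i _ do rewrite mnmDE.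
by rewrite big_split leq_add.
Qed.

(** The partial sums of m and m' are bounded by those of mu and nu and have the same total, so each
    bound is attained. This makes leading coefficients multiplicative. *)
Lemma dominatedD_eq mu nu m m' : dominated mu m -> dominated nu m' ->
  mnm_add m m' = mnm_add mu nu -> m = mu /\ m' = nu.
Proof.
move=> h h' e.
suff em : m = mu by split=> //; apply: (@addmI _ mu); rewrite -{1}em.
apply: psum_inj => k; have := congr1 (psum^~ k) e; rewrite /= !psum_add.
by have := dominated_psum k h; have := dominated_psum k h'; lia.
Qed.

(** At the first index where the exponents differ, the partial sums force m to be the smaller
    one. *)
Lemma dominated_le mu m : dominated mu m -> (m <= mu)%O.
Proof.
move=> h; have /dominatedP[d _] := h.
have [->//|neq] := eqVneq m mu.
apply/ltW/(ltmcP d).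
have [i0 mi0] : exists i, m i != mu i.
  apply/existsP; apply: contraR neq => /existsPn eq_all.
  by apply/eqP/mnmP => i; exact/eqP/negPn/eq_all.
case: (@arg_minnP _ i0 (fun i => m i != mu i) val mi0) => i mi i_min.
have eq_lt (j : 'I_N) : (j < i)%N -> m j = mu j.
  by move=> ji; apply/eqP; apply: contraTT ji => /i_min; rewrite -leqNgt.
exists i; [exact: eq_lt|rewrite ltn_neqAle mi /=].
have := dominated_psum i.+1 h; rewrite !psumS.
by rewrite {1}/psum (eq_bigr _ eq_lt) leq_add2l.
Qed.

End dominance.

Section support.
Variables (N : nat) (dom : multinom N -> multinom N -> bool) (C : comNzRingType).
Hypothesis dom0 : dom (@mnm0 N) (@mnm0 N).
Hypothesis domD : forall mu nu m m',
  dom mu m -> dom nu m' -> dom (mnm_add mu nu) (mnm_add m m').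
Hypothesis domD_eq : forall mu nu m m', dom mu m -> dom nu m' ->
  mnm_add m m' = mnm_add mu nu -> m = mu /\ m' = nu.
Implicit Types (f g : mpoly N C) (m mu nu : multinom N).

(** [dom] is abstract because it will be both [dominated], which bounds the support of F, and
    [below], the total monomial order on which eigenvalues are compared. *)
Definition supported mu f := forall m, m \in msupp f -> dom mu m.

Lemma supportedP mu f :
  (forall m, ~~ dom mu m -> mcoeff m f = 0) <-> supported mu f.
Proof.
split=> h m; first by rewrite mcoeff_msupp; apply: contraNT => /h ->.
by move=> mN; apply: memN_msupp_eq0; apply: contra mN => /h.
Qed.

Lemma supportedM mu nu f g :
  supported mu f -> supported nu g -> supported (mnm_add mu nu) (f * g).
Proof.
move=> hf hg m /msuppM_le /allpairsP[[m1 m2] /= [/hf h1 /hg h2 ->]].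
exact: domD.
Qed.

Lemma mcoeffM_supported mu nu f g : supported mu f -> supported nu g ->
  mcoeff (mnm_add mu nu) (f * g) = mcoeff mu f * mcoeff nu g.
Proof.
move=> hf hg; rewrite mcoeffM.
have mu_lt : (mdeg mu < (mdeg (mnm_add mu nu)).+1)%N by rewrite mdegD ltnS leq_addr.
have nu_lt : (mdeg nu < (mdeg (mnm_add mu nu)).+1)%N by rewrite mdegD ltnS leq_addl.
rewrite (bigD1 (BMultinom mu_lt, BMultinom nu_lt)) //= big1 ?addr0 //.
move=> [m m'] /andP[/eqP e neq] /=.
have [|mf] := eqVneq (mcoeff m f) 0; first by move=> ->; rewrite mul0r.
have [|mg] := eqVneq (mcoeff m' g) 0; first by move=> ->; rewrite mulr0.
case/eqP: neq; rewrite -!mcoeff_msupp in mf mg.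
have [em em'] := domD_eq (hf _ mf) (hg _ mg) (esym e).
by congr (_, _); apply/val_inj.
Qed.

(** [c] may be 0: then [mu] only bounds the support. *)
Definition leading mu (c : C) f := supported mu f /\ mcoeff mu f = c.

Lemma leadingM mu nu c d f g :
  leading mu c f -> leading nu d g -> leading (mnm_add mu nu) (c * d) (f * g).
Proof.
by move=> [sf <-] [sg <-]; split; [exact: supportedM|exact: mcoeffM_supported].
Qed.

Lemma leading1 : leading mnm0 1 1.
Proof.
split=> [m|]; last by rewrite mcoeff1 eqxx.
by rewrite msupp1 inE => /eqP ->; exact: dom0.
Qed.

Lemma leadingX mu c f n : leading mu c f -> leading (mnm_muln mu n) (c ^+ n) (f ^+ n).
Proof.
move=> h; elim: n => [|n IH]; first exact: leading1.
by rewrite !exprS mulmS; exact: leadingM.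
Qed.

Lemma leading_prod (J : Type) (r : seq J) (lm : J -> multinom N) (c : J -> C)
    (F : J -> mpoly N C) :
  (forall j, leading (lm j) (c j) (F j)) ->
  leading (\big[@mnm_add N/@mnm0 N]_(j <- r) lm j) (\prod_(j <- r) c j) (\prod_(j <- r) F j).
Proof.
move=> h; elim: r => [|j r IH]; first by rewrite !big_nil; exact: leading1.
by rewrite !big_cons; exact: leadingM.
Qed.

End support.

Section leading_esym.
Variables (R : realType) (N : nat).
Local Notation A := (mpoly N.+1 R).
Local Notation one k := (@mesym1 N (initial N k)).

Let sum_mesym1 (h I : {set 'I_N}) : (\sum_(i in I) mesym1 h i = #|I :&: h|)%N.
Proof.
rewrite -sum1_card big_mkcond [RHS]big_mkcond; apply: eq_bigr => i _ /=.
by rewrite inE mnmE; do 2 case: (_ \in _).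
Qed.

Lemma dominated_mesym1 (h : {set 'I_N}) : dominated (one #|h|) (mesym1 h).
Proof.
have hN : (#|h| <= N)%N by rewrite -[X in (_ <= X)%N]card_ord max_card.
apply/dominatedP; split.
  by rewrite !mdeg_mesym1 card_initial; apply/esym/minn_idPl.
move=> I; rewrite psumE !sum_mesym1.
have -> : initial N #|I| :&: initial N #|h| = initial N (minn #|I| #|h|).
  by apply/setP => i; rewrite !inE leq_min.
rewrite card_initial !leq_min -andbA; apply/and3P; split.
- exact/subset_leq_card/subsetIl.
- exact/subset_leq_card/subsetIr.
- by apply: leq_trans hN; exact/subset_leq_card/subsetIr.
Qed.

Lemma weighted_esymE k : weighted_esym R N k =
  \sum_(h : {set 'I_N} | #|h| == k) mpolyC N (weight_off R h) * mpolyX A (mesym1 h).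
Proof.
apply: eq_bigr => h _; congr (_ * _); rewrite mpolyXE_id big_mkcond.
by apply: eq_bigr => i _; rewrite mnmE; case: (i \in h).
Qed.

Lemma leading_weighted_esym k : (k <= N)%N ->
  leading (@dominated N) (one k) (weight_off R (initial N k)) (weighted_esym R N k).
Proof.
move=> kN; split.
  apply/supportedP => m mN; rewrite weighted_esymE raddf_sum big1 // => h /eqP hk /=.
  rewrite mcoeffCM mcoeffX; case: eqP => [e|]; last by rewrite mulr0.
  by case/negP: mN; rewrite -e -hk dominated_mesym1.
have ck : #|initial N k| == k by rewrite card_initial (minn_idPl kN).
rewrite weighted_esymE raddf_sum (bigD1 (initial N k)) //= big1 => [|h /andP[_ hk]].
  by rewrite addr0 mcoeffCM mcoeffX eqxx mulr1.
rewrite mcoeffCM mcoeffX; case: eqP => [/inj_mesym1 e|]; last by rewrite mulr0.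
by rewrite e eqxx in hk.
Qed.

(** The partition with nu_k columns of height k + 1, that is, the leading exponent of the product of
    the e_(k+1)^(nu_k). *)
Definition conj_shape (nu : multinom N) : multinom N :=
  \big[@mnm_add N/@mnm0 N]_(k < N) mnm_muln (one k.+1) (nu k).

Definition weight_monomial (nu : multinom N) : A :=
  \prod_(k < N) weight_off R (initial N k.+1) ^+ nu k.

Lemma subst_weighted_esym_mpolyX nu : subst_weighted_esym (mpolyX R nu) =
  \prod_(k < N) weighted_esym R N k.+1 ^+ nu k.
Proof. by rewrite /subst_weighted_esym mmapX. Qed.

Lemma subst_weighted_esymE g : subst_weighted_esym g =
  \sum_(nu <- msupp g) mpolyC N (mpolyC N.+1 (mcoeff nu g)) *
    subst_weighted_esym (mpolyX R nu).
Proof.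
transitivity (\sum_(nu <- msupp g) mpolyC N (mpolyC N.+1 (mcoeff nu g)) *
  mmap1 (fun k : 'I_N => weighted_esym R N k.+1) nu); first by [].
by apply: eq_bigr => nu _; rewrite subst_weighted_esym_mpolyX.
Qed.

Lemma leading_monomial nu :
  leading (@dominated N) (conj_shape nu) (weight_monomial nu) (subst_weighted_esym (mpolyX R nu)).
Proof.
rewrite subst_weighted_esym_mpolyX /conj_shape /weight_monomial.
apply: (leading_prod (@dominated0 N) (@dominatedD N) (@dominatedD_eq N)) => k.
apply: (leadingX (@dominated0 N) (@dominatedD N) (@dominatedD_eq N)).
exact: leading_weighted_esym.
Qed.

Lemma conj_shapeE nu (i : 'I_N) : conj_shape nu i = (\sum_(k < N | i <= k) nu k)%N.
Proof.
rewrite /conj_shape mnm_sumE [RHS]big_mkcond; apply: eq_bigr => k _.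
by rewrite mulmnE mnmE inE ltnS; case: leqP => _; rewrite ?mul1n ?mul0n.
Qed.

Lemma conj_shape_inj : injective conj_shape.
Proof.
move=> nu nu' e; apply/mnmP => i.
have tail (n : multinom N) : (conj_shape n i = n i + \sum_(k < N | i < k) n k)%N.
  rewrite conj_shapeE (bigD1 i) //=; congr (_ + _)%N; apply: eq_bigl => k.
  by rewrite ltn_neqAle eq_sym andbC.
have tail_eq : (\sum_(k < N | i < k) nu k = \sum_(k < N | i < k) nu' k)%N.
  have [iN|Ni] := ltnP i.+1 N.
    by have := congr1 (fun m : multinom N => m (Ordinal iN)) e; rewrite /= !conj_shapeE.
  by rewrite !big_pred0 // => k; apply/negP => ik; have := ltn_ord k; lia.
have := congr1 (fun m : multinom N => m i) e.
by rewrite /= !tail tail_eq => /addIn.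
Qed.

(* For these weights the roots of the random polynomial are the [x_i] themselves. *)
Definition unit_weights (a : 'I_N.+1) : R := (a == ord0)%:R.

Lemma meval_unit_weight_off h : meval unit_weights (weight_off R h) = 1.
Proof.
rewrite (raddf_sum (meval _)) /= (bigD1 ord0) /=; last first.
  by apply/imsetP => -[i _ /eqP]; rewrite (negbTE (neq_lift _ _)).
rewrite mevalXU /unit_weights eqxx big1 ?addr0 // => a /andP[_ a0].
by rewrite mevalXU (negbTE a0).
Qed.

Lemma map_weighted_esym k :
  map_mpoly (meval unit_weights) (weighted_esym R N k) = mesym N R k.
Proof.
rewrite weighted_esymE (raddf_sum (map_mpoly _)) mesymE; apply: eq_bigr => h _ /=.
by rewrite rmorphM /= map_mpolyC map_mpolyX /= meval_unit_weight_off mpolyC1 mul1r.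
Qed.

(** Specialising w turns F into P, and every [weight_off] into 1. What is known about the
    coefficients of P thereby gives information on g, and from g on F. *)
Lemma map_subst_weighted_esym g :
  map_mpoly (meval unit_weights) (subst_weighted_esym g) = subst_esym g.
Proof.
rewrite subst_weighted_esymE (raddf_sum (map_mpoly _)).
transitivity (\sum_(nu <- msupp g) mpolyC N (mcoeff nu g) *
  mmap1 (tnth [tuple mesym N R i.+1 | i < N]) nu); last by [].
apply: eq_bigr => m _ /=.
rewrite rmorphM /= map_mpolyC /= mevalC; congr (_ * _).
rewrite subst_weighted_esym_mpolyX (rmorph_prod (map_mpoly _)) /mmap1.
by apply: eq_bigr => k _; rewrite rmorphXn /= map_weighted_esym tnth_mktuple.
Qed.

Variable g : mpoly N R.

Lemma mcoeff_subst_weighted_esym m : mcoeff m (subst_weighted_esym g) =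
  \sum_(nu <- msupp g) mpolyC N.+1 (mcoeff nu g) *
    mcoeff m (subst_weighted_esym (mpolyX R nu)).
Proof.
rewrite {1}subst_weighted_esymE (raddf_sum (mcoeff m)).
by apply: eq_bigr => nu _ /=; rewrite mcoeffCM.
Qed.

Lemma mcoeff_subst_esym m : mcoeff m (subst_esym g) =
  \sum_(nu <- msupp g) mcoeff nu g *
    meval unit_weights (mcoeff m (subst_weighted_esym (mpolyX R nu))).
Proof.
have <- := map_subst_weighted_esym g.
apply: etrans (mcoeff_map_mpoly _ _ _) _.
apply: etrans (congr1 (meval unit_weights) (mcoeff_subst_weighted_esym m)) _.
rewrite (raddf_sum (meval unit_weights)).
by apply: eq_bigr => nu _ /=; rewrite mevalM mevalC.
Qed.

Let height (m : multinom N) := (\sum_(k < N.+1) psum m k)%N.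

Let height_lt mu m : dominated mu m -> m != mu -> (height m < height mu)%N.
Proof.
move=> h; apply: contraNT; rewrite -leqNgt => le; apply/eqP/psum_inj => k.
have le_psum (i : 'I_N.+1) : true -> (psum m i <= psum mu i)%N.
  by move=> _; exact: dominated_psum.
have [_ e] := leqif_sum (fun i hi => leqif_eq (le_psum i hi)).
have : height m == height mu.
  by rewrite eqn_leq le andbT leq_sum // => i _; exact: dominated_psum.
rewrite e => /forall_inP /(_ (inord (minn k N))) /(_ isT).
by rewrite inordK ?ltnS ?geq_minr // !psum_min => /eqP.
Qed.

(** Distinct monomials of g have distinct leading exponents, so the highest ones cannot cancel. If
    [conj_shape n] were not dominated by [lam], its coefficient in P would be 0; the other monomials
    reaching it have shapes of larger [height], which are dominated by induction, and transitivity
    would apply. Hence that coefficient is the one of n in g, a contradiction. *)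
Lemma dominated_conj_shape lam nu : supported (@dominated N) lam (subst_esym g) ->
  nu \in msupp g -> dominated lam (conj_shape nu).
Proof.
move=> hP.
pose b := (\max_(n <- msupp g) height (conj_shape n))%N.
have height_b n : n \in msupp g -> (height (conj_shape n) <= b)%N.
  by move=> ng; apply: leq_bigmax_seq.
suff main c : forall n, n \in msupp g -> (b - height (conj_shape n) < c)%N ->
    dominated lam (conj_shape n).
  by move=> ng; exact: (main (b - height (conj_shape nu)).+1).
elim: c => // c IH n ng hc.
have [//|nd] := boolP (dominated lam (conj_shape n)).
suff : mcoeff n g == 0 by rewrite mcoeff_eq0 ng.
have := (supportedP _ lam _).2 hP _ nd; rewrite mcoeff_subst_esym.
rewrite (bigD1_seq n) ?msupp_uniq //= big_seq_cond big1 => [|n' /andP[n'g n'n]].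
  have [_ ->] := leading_monomial n.
  rewrite addr0 /weight_monomial (rmorph_prod (meval _)) big1 => [|k _].
    by rewrite mulr1 => ->.
  by rewrite rmorphXn /= meval_unit_weight_off expr1n.
have [sup _] := leading_monomial n'.
have [dn|/((supportedP _ _ _).2 sup) ->] := boolP (dominated (conj_shape n') (conj_shape n)).
  have lt : (height (conj_shape n) < height (conj_shape n'))%N.
    by apply: height_lt dn _; rewrite (inj_eq conj_shape_inj) eq_sym.
  case/negP: nd; apply: dominated_trans dn; apply: IH => //.
  by have := height_b _ n'g; lia.
by rewrite meval0 mulr0.
Qed.

Lemma supported_subst_weighted_esym lam : supported (@dominated N) lam (subst_esym g) ->
  supported (@dominated N) lam (subst_weighted_esym g).
Proof.
move=> hP; apply/supportedP => m mN; rewrite mcoeff_subst_weighted_esym big_seq big1 //.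
move=> nu nug; have [sup _] := leading_monomial nu.
rewrite ((supportedP _ _ _).2 sup) ?mulr0 //; apply: contra mN.
exact/dominated_trans/dominated_conj_shape.
Qed.

Lemma leading_coef_subst lam (c : R) : supported (@dominated N) lam (subst_esym g) ->
  mcoeff lam (subst_esym g) = c -> c != 0 ->
  exists2 nu, conj_shape nu = lam &
    mcoeff lam (subst_weighted_esym g) = mpolyC N.+1 c * weight_monomial nu.
Proof.
move=> hP Pc c0.
have only nu' nu : nu' \in msupp g -> conj_shape nu = lam -> nu' != nu ->
    mcoeff lam (subst_weighted_esym (mpolyX R nu')) = 0.
  move=> g' e neq; have [sup _] := leading_monomial nu'.
  apply: (supportedP _ _ _).2 sup _ _; apply: contra neq => dn.
  rewrite -(inj_eq conj_shape_inj) e.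
  have := dominated_conj_shape hP g' => /dominated_le le1.
  by rewrite eq_le le1 (dominated_le dn).
have [nu nug e] : exists2 nu, nu \in msupp g & conj_shape nu = lam.
  have [/hasP[nu nug /eqP e]|/hasPn none] := boolP (has (fun nu => conj_shape nu == lam) (msupp g)).
    by exists nu.
  case/eqP: c0; rewrite -Pc mcoeff_subst_esym big_seq big1 // => nu nug.
  have [sup _] := leading_monomial nu.
  rewrite ((supportedP _ _ _).2 sup) ?meval0 ?mulr0 //; apply: contra (none _ nug) => dn.
  have /dominated_le le1 := dominated_conj_shape hP nug.
  by rewrite eq_le le1 (dominated_le dn).
exists nu => //.
have gc : mcoeff nu g = c.
  rewrite -Pc mcoeff_subst_esym (bigD1_seq nu) ?msupp_uniq //=.
  rewrite big_seq_cond big1 => [|nu' /andP[g' neq]].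
    have [_] := leading_monomial nu; rewrite e => ->.
    rewrite addr0 /weight_monomial (rmorph_prod (meval _)) big1 ?mulr1 // => k _.
    by rewrite rmorphXn /= meval_unit_weight_off expr1n.
  by rewrite (only nu' nu) // meval0 mulr0.
rewrite mcoeff_subst_weighted_esym (bigD1_seq nu) ?msupp_uniq //=.
rewrite big_seq_cond big1 => [|nu' /andP[g' neq]].
  by have [_] := leading_monomial nu; rewrite e gc addr0 => ->.
by rewrite (only nu' nu) // mulr0.
Qed.

End leading_esym.

(** * The Dirichlet mean of the leading coefficient *)

Section mean_weight_monomial.
Variables (R : realType) (N : nat) (s : 'I_N.+1 -> R).
Hypothesis s_gt0 : forall a, 0 < s a.
Local Notation A := (mpoly N.+1 R).
Local Notation W k := (weight_off R (initial N k)).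

Definition tail k : {set 'I_N.+1} := ~: (lift ord0 @: initial N k).

Definition tail_sum k : R := \sum_(a in tail k) s a.

Lemma tail_sum_gt0 k : 0 < tail_sum k.
Proof.
have : ord0 \in tail k.
  by rewrite inE; apply/imsetP => -[i _ /eqP]; rewrite (negbTE (neq_lift _ _)).
move=> t0; rewrite /tail_sum (bigD1 ord0) //= ltr_pwDl // sumr_ge0 // => a _.
exact: ltW.
Qed.

Lemma tail0 : tail 0 = finset.setT.
Proof.
apply/setP => a; rewrite !inE; apply/imsetP => -[i].
by rewrite inE ltn0.
Qed.

Lemma tail_sum0 : tail_sum 0 = \sum_a s a.
Proof. by rewrite /tail_sum tail0; apply: eq_bigl => a; rewrite inE. Qed.

Lemma subset_tail k l : (k <= l)%N -> tail l \subset tail k.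
Proof.
move=> kl; rewrite finset.setCS; apply: imsetS; apply/fintype.subsetP => i; rewrite !inE => ik.
exact: leq_trans ik kl.
Qed.

Lemma rising_gt0 (c : R) n : 0 < c -> 0 < rising c n.
Proof. by move=> c0; apply: prodr_gt0 => j _; rewrite ltr_wpDr. Qed.

(* Homogeneous of degree [d] in the weights [w_0, w_(k+1), ..., w_N]. *)
Definition tail_homog k d (f : A) := forall m, m \in msupp f ->
  mdeg m = d /\ forall a, a \notin tail k -> m a = 0%N.

Lemma tail_homog1 k : tail_homog k 0 1.
Proof.
by move=> m; rewrite msupp1 inE => /eqP ->; rewrite mdeg0; split=> // a _; rewrite mnm0E.
Qed.

Lemma tail_homogM k d e f g :
  tail_homog k d f -> tail_homog k e g -> tail_homog k (d + e) (f * g).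
Proof.
move=> hf hg m /msuppM_le /allpairsP[[m1 m2] /= [/hf[d1 z1] /hg[d2 z2] ->]].
by split=> [|a ha]; rewrite ?mdegD ?d1 ?d2 // mnmDE z1 // z2.
Qed.

Lemma tail_homog_weight_off k l : (k <= l)%N -> tail_homog k 1 (W l).
Proof.
move=> kl m /msupp_sum_le /flatten_mapP[a]; rewrite mem_filter => /andP[al _].
rewrite msuppX inE => /eqP ->; split=> [|b hb]; first by rewrite mdeg1.
rewrite mnm1E; case: eqP => // e; case/negP: hb; rewrite -e.
by apply: (fintype.subsetP (subset_tail kl)); rewrite inE.
Qed.

Lemma tail_homogX k d n f : tail_homog k d f -> tail_homog k (n * d) (f ^+ n).
Proof.
move=> h; elim: n => [|n IH]; first exact: tail_homog1.
by rewrite exprS mulSn; exact: tail_homogM.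
Qed.

(** Summing (s_a + m_a) / (s_0 + ... + s_N + d) over the tail gives this factor, since all of the
    degree d of m lies in the tail. *)
Lemma mean_weight_offM k d f : tail_homog k d f ->
  dirichlet_mean s (W k * f) =
  (tail_sum k + d%:R) / (tail_sum 0 + d%:R) * dirichlet_mean s f.
Proof.
move=> hf.
have -> : W k * f = \sum_(m <- msupp f) \sum_(a in tail k)
    mpolyC N.+1 (mcoeff m f) * mpolyX R (mnm_add (mnm1 a) m).
  rewrite {1}(mpolyE f) mulr_sumr; apply: eq_bigr => m _.
  rewrite -mul_mpolyC mulrCA mulr_suml mulr_sumr; apply: eq_big => [a|a _].
    by rewrite inE.
  by rewrite mpolyXD.
rewrite (raddf_sum (dirichlet_mean s)) {2}/dirichlet_mean mulr_sumr.
rewrite big_seq [RHS]big_seq; apply: eq_bigr => m mf /=.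
have [dm zm] := hf m mf.
rewrite (raddf_sum (dirichlet_mean s)).
transitivity (\sum_(a in tail k) (s a + (m a)%:R) *
    (mcoeff m f * dirichlet_moment s m / (tail_sum 0 + d%:R))).
  apply: eq_bigr => a _ /=; rewrite dirichlet_meanZ dirichlet_meanX dirichlet_momentS dm.
  by rewrite -tail_sum0; ring.
rewrite -mulr_suml big_split /= -natr_sum.
have -> : (\sum_(a in tail k) m a = d)%N.
  rewrite -dm mdegE [RHS](bigID (mem (tail k))) /= [X in (_ + X)%N]big1 ?addn0 //.
by rewrite -/(tail_sum k); ring.
Qed.

Lemma mean_weight_offX k d n f : tail_homog k d f ->
  dirichlet_mean s (W k ^+ n * f) =
  rising (tail_sum k) (n + d) / rising (tail_sum k) d *
  (rising (tail_sum 0) d / rising (tail_sum 0) (n + d)) * dirichlet_mean s f.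
Proof.
move=> hf.
have r_neq0 l e : rising (tail_sum l) e != 0.
  by rewrite gt_eqF // rising_gt0 // tail_sum_gt0.
elim: n => [|n IH]; first by rewrite mul1r add0n !divff // !mul1r.
have h : tail_homog k (n + d) (W k ^+ n * f).
  rewrite -[X in (X + d)%N]muln1; apply: tail_homogM => //.
  exact/tail_homogX/tail_homog_weight_off.
rewrite exprS -mulrA (mean_weight_offM h) IH addSn !risingS natrD.
have t_neq0 l : tail_sum l + (n%:R + d%:R) != 0.
  by rewrite gt_eqF // ltr_pwDl ?tail_sum_gt0 // -natrD.
by field; rewrite !r_neq0 t_neq0.
Qed.

Variable nu : multinom N.

Let part k := (\sum_(i < N | k <= i) nu i)%N.

Let partS (i : 'I_N) : part i = (nu i + part i.+1)%N.
Proof.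
rewrite /part (bigD1 i) //=; congr (_ + _)%N; apply: eq_bigl => j.
by rewrite ltn_neqAle eq_sym andbC.
Qed.

Lemma mean_weight_monomial : dirichlet_mean s (weight_monomial R nu) =
  \prod_(i < N) (rising (tail_sum i.+1) (conj_shape nu i) / rising (tail_sum i) (conj_shape nu i)).
Proof.
have r_neq0 l e : rising (tail_sum l) e != 0.
  by rewrite gt_eqF // rising_gt0 // tail_sum_gt0.
pose Q k := \prod_(i < N | (k <= i)%N) W i.+1 ^+ nu i.
(* Downward induction on k, with n = N - k. The last factor is the part of the product that has not
   yet telescoped; it is 1 at k = 0. *)
suff main n : forall k, (k + n)%N = N -> tail_homog k (part k) (Q k) /\
    dirichlet_mean s (Q k) =
    \prod_(i < N | (k <= i)%N) (rising (tail_sum i.+1) (part i) / rising (tail_sum i) (part i)) *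
    (rising (tail_sum k) (part k) / rising (tail_sum 0) (part k)).
  have [_] := main N 0%N (add0n N); rewrite divff // mulr1 => e.
  by apply: etrans e _; apply: eq_bigr => i _; rewrite conj_shapeE.
elim: n => [|n IH] k kn.
  have noi (i : 'I_N) : (k <= i)%N = false.
    by apply/negbTE; rewrite -ltnNge -[k]addn0 kn.
  rewrite /Q /part !big_pred0 // !rising0 divr1 mulr1; split; first exact: tail_homog1.
  by rewrite -mpolyX0 dirichlet_meanX dirichlet_moment0.
have kN : (k < N)%N by rewrite -kn addnS ltnS leq_addr.
have [|homQ meanQ] := IH k.+1; first by rewrite addSnnS.
pose i := Ordinal kN.
have split_i (T : Type) (idx : T) (op : Monoid.com_law idx) (F : 'I_N -> T) :
    \big[op/idx]_(j < N | (k <= j)%N) F j =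
    op (F i) (\big[op/idx]_(j < N | (k < j)%N) F j).
  rewrite (bigD1 i) //=; congr (op _ _); apply: eq_bigl => j.
  by rewrite ltn_neqAle eq_sym andbC.
have Qk : Q k = W k.+1 ^+ nu i * Q k.+1 by rewrite /Q split_i.
have pk : part k = (nu i + part k.+1)%N by exact: (partS i).
split.
  rewrite Qk pk; apply: tail_homogM.
    by have := tail_homogX (n := nu i) (tail_homog_weight_off (leqnSn k)); rewrite muln1.
  move=> m /homQ[d z]; split=> // a ha; apply: z; apply: contra ha.
  exact/fintype.subsetP/subset_tail.
rewrite Qk (mean_weight_offX _ homQ) meanQ split_i /= -pk.
rewrite -[part (Ordinal kN)]/(part k).
have := (r_neq0 k (part k), r_neq0 k.+1 (part k.+1), r_neq0 0%N (part k), r_neq0 0%N (part k.+1)).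
by move=> [[[? ?] ?] ?]; field; apply/and4P.
Qed.

End mean_weight_monomial.

(** * Polynomials that vanish at all ascending points *)

Lemma digits_inj n (M : nat) (a b : 'I_n -> nat) :
  (forall i, a i < M)%N -> (forall i, b i < M)%N ->
  (\sum_(i < n) a i * M ^ i = \sum_(i < n) b i * M ^ i)%N -> a =1 b.
Proof.
elim: n a b => [|n IH] a b aM bM; first by move=> _ [].
have M0 : (0 < M)%N by apply: leq_ltn_trans (aM ord0).
have shift (c : 'I_n.+1 -> nat) : (\sum_(i < n.+1) c i * M ^ i =
    (\sum_(i < n) c (lift ord0 i) * M ^ i) * M + c ord0)%N.
  rewrite big_ord_recl expn0 muln1 addnC; congr (_ + _)%N.
  by rewrite big_distrl; apply: eq_bigr => i _; rewrite /= /bump expnS mulnAC mulnA.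
rewrite !shift => e.
have e0 : a ord0 = b ord0.
  by have := congr1 (modn^~ M) e; rewrite /= !modnMDl !modn_small.
move: e; rewrite e0 => /addIn/eqP; rewrite eqn_pmul2r // => /eqP /IH e i.
by case: (unliftP ord0 i) => [j|] ->; rewrite ?e0 // e.
Qed.

Section ascending_points.
Variables (R : realFieldType) (N : nat).

Definition ascending (x : 'I_N -> R) :=
  (forall i, 0 < x i) /\ (forall i j : 'I_N, (i < j)%N -> x i < x j).

(* Kronecker substitution: x_i = t ^ (M ^ i) separates the monomials of f. *)
Lemma meval_ascending_eq0 (f : mpoly N R) :
  (forall x, ascending x -> meval x f = 0) -> f = 0.
Proof.
(* Larger than every exponent in f, and at least 2 so that the powers M ^ i increase. *)
move=> f0; pose M := (mmeasure mdeg f).+2.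
pose code (m : multinom N) := (\sum_(i < N) m i * M ^ i)%N.
have mM m i : m \in msupp f -> (m i < M)%N.
  move=> mf; apply: leq_ltn_trans (ltn_trans (msize_mdeg_lt mf) (leqnSn _)).
  by rewrite mdegE (bigD1 i) //= leq_addr.
pose h : {poly R} := \sum_(m <- msupp f) mcoeff m f *: 'X^(code m).
have h0 : h = 0.
  apply: (@poly_nat_roots_eq0 _ _ 2) => n; set t := 2 + n%:R.
  have t1 : 1 < t by rewrite /t ltr_wpDr // ltr1n.
  rewrite -[RHS](f0 (fun i => t ^+ (M ^ i))); last first.
    split=> [i|i j ij]; first by rewrite exprn_gt0 // (lt_trans _ t1).
    by rewrite ltr_eXn2l // ltn_exp2l.
  rewrite mevalE horner_sum; apply: eq_bigr => m _.
  rewrite hornerZ hornerXn; congr (_ * _); rewrite expr_sum.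
  by apply: eq_bigr => i _; rewrite -exprM mulnC.
apply/mpolyP => m; rewrite mcoeff0.
have [mf|/memN_msupp_eq0 //] := boolP (m \in msupp f).
have /(congr1 (fun p : {poly R} => p`_(code m))) := h0.
rewrite coef0 coef_sum (bigD1_seq m) ?msupp_uniq //= big_seq_cond big1 => [|m' /andP[mf' ne]].
  by rewrite addr0 coefZ coefXn eqxx mulr1.
rewrite coefZ coefXn; case: eqP => [e|]; last by rewrite mulr0.
case/eqP: ne; apply/mnmP => i; apply/esym.
exact: (digits_inj (fun i => mM m i mf) (fun i => mM m' i mf') e).
Qed.

End ascending_points.

(** * Eigenvalues of [D_2^N] *)

Section eigenvalue.
Variables (R : realType) (N : nat) (theta : R).

(* The diagonal entry of [D_2^N] at the monomial [x^m], for the lexicographic order. *)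
Definition eigenvalue_of (m : multinom N) : R :=
  \sum_i ((m i)%:R ^+ 2 - (m i)%:R) +
  2 * theta * \sum_(i < N) \sum_(j < N | (i < j)%N) (m i)%:R.

Let sum_psum (m : multinom N) :
  \sum_(i < N) \sum_(j < N | (i < j)%N) (m i)%:R = \sum_(j < N) (psum m j)%:R :> R.
Proof.
rewrite (exchange_big_dep xpredT) //=; apply: eq_bigr => j _.
by rewrite /psum natr_sum.
Qed.

Let triangular m B : (m <= B)%N -> ((\sum_(v < B) (m - v)).*2 = m ^ 2 + m)%N.
Proof.
elim: m B => [|m IH] B; first by rewrite big1.
case: B => // B; rewrite ltnS => /IH e; rewrite big_ord_recl /= subn0 doubleD.
under eq_bigr => i _ do rewrite /= /bump add1n subSS.
by rewrite e; lia.
Qed.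

(** By [triangular], squares are sums of the truncated differences m_i - v over the levels v. At
    each level the total excess is compared by applying dominance to the set of indices with m_i >
    v. *)
Lemma sum_sqr_dominated (lam m : multinom N) : dominated lam m ->
  (\sum_(i < N) m i ^ 2 <= \sum_(i < N) lam i ^ 2)%N.
Proof.
move=> h; have /dominatedP[dm hI] := h; have d := dm; rewrite !mdegE in d.
pose B := mdeg lam.
have le_deg (n : multinom N) i : mdeg n = mdeg lam -> (n i <= B)%N.
  by move=> e; rewrite /B -e mdegE (bigD1 i) //= leq_addr.
have excess v : (\sum_(i < N) (m i - v) <= \sum_(i < N) (lam i - v))%N.
  pose I := [set i | (v < m i)%N].
  have -> : (\sum_(i < N) (m i - v) = \sum_(i in I) (m i - v))%N.
    rewrite [RHS]big_mkcond; apply: eq_bigr => i _; rewrite inE.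
    by case: ltnP => // le; apply/eqP; rewrite subn_eq0.
  rewrite -(leq_add2r (#|I| * v)).
  have -> : (\sum_(i in I) (m i - v) + #|I| * v = \sum_(i in I) m i)%N.
    rewrite -sum_nat_const -big_split; apply: eq_bigr => i; rewrite inE => vi.
    by rewrite /= subnK // ltnW.
  apply: leq_trans (hI I) _; rewrite psumE.
  have -> : (#|I| * v = \sum_(i in initial N #|I|) v)%N.
    rewrite sum_nat_const card_initial; congr (_ * _)%N; apply/esym/minn_idPl.
    by rewrite -[X in (_ <= X)%N]card_ord max_card.
  apply: (@leq_trans (\sum_(i in initial N #|I|) ((lam i - v) + v))%N).
    by apply: leq_sum => i _; rewrite addnC -leq_subLR.
  rewrite big_split leq_add2r [X in (X <= _)%N]big_mkcond leq_sum // => i _.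
  by case: ifP.
have squares (n : multinom N) : mdeg n = mdeg lam ->
    (\sum_(i < N) n i ^ 2 + \sum_(i < N) n i =
     (\sum_(v < B) \sum_(i < N) (n i - v)).*2)%N.
  move=> dn; rewrite exchange_big -muln2 big_distrl -big_split.
  by apply: eq_bigr => i _; rewrite /= muln2 triangular // le_deg.
rewrite -(leq_add2r (\sum_(i < N) m i)) {2}d !squares // leq_double.
exact: leq_sum.
Qed.

(** The strictness comes from the theta term, twice theta times the sum of all partial sums: each is
    bounded, so equal totals would make all of them equal. *)
Lemma eigenvalue_of_lt lam m : 0 < theta -> dominated lam m -> m != lam ->
  eigenvalue_of m < eigenvalue_of lam.
Proof.
move=> theta0 h ne; have /dominatedP[d _] := h.
rewrite /eigenvalue_of !sumrB !sum_psum; apply: ler_ltD.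
  rewrite -!natr_sum -!mdegE d lerD2r.
  under eq_bigr => i _ do rewrite -natrX.
  under [X in _ <= X]eq_bigr => i _ do rewrite -natrX.
  by rewrite -!natr_sum ler_nat sum_sqr_dominated.
rewrite ltr_pM2l ?mulr_gt0 // -!natr_sum ltr_nat ltn_neqAle.
rewrite leq_sum => [|i _]; last exact: dominated_psum.
rewrite andbT; apply: contra ne => /eqP e; apply/eqP/psum_inj => k.
rewrite -(psum_min m) -(psum_min lam).
have [kN|Nk] := ltnP k N; last first.
  have full (n : multinom N) : psum n N = mdeg n.
    by rewrite /psum mdegE; apply: eq_bigl => i; rewrite ltn_ord.
  by rewrite !full.
have [_ e'] := leqif_sum (fun (i : 'I_N) (_ : true) => leqif_eq (dominated_psum i h)).
move: e'; rewrite e eqxx => /esym/forall_inP /(_ (Ordinal kN) isT) /eqP.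
by [].
Qed.

End eigenvalue.

Section monomial_order.
Variables (N : nat).

Definition below (mu m : multinom N) : bool := (m <= mu)%O.

Lemma belowD mu nu m m' : below mu m -> below nu m' -> below (mnm_add mu nu) (mnm_add m m').
Proof. exact: lem_add. Qed.

Lemma belowD_eq mu nu m m' : below mu m -> below nu m' ->
  mnm_add m m' = mnm_add mu nu -> m = mu /\ m' = nu.
Proof.
rewrite /below => h h' e.
have em : m = mu.
  apply/eqP; rewrite eq_le h leNgt; apply/negP => lt.
  by have := ltmc_le_add lt h'; rewrite e ltxx.
by split=> //; apply: (@addmI _ mu); rewrite -{1}em.
Qed.

Lemma supported_below_mlead (C : comNzRingType) (f : mpoly N C) :
  supported below (mlead f) f.
Proof. by move=> m; exact: msupp_le_mlead. Qed.

Lemma leading_below_mlead (C : comNzRingType) (f : mpoly N C) mu c :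
  leading below mu c f -> c != 0 -> mlead f = mu.
Proof.
move=> [sup fc] c0.
have mu_f : mu \in msupp f by rewrite mcoeff_msupp fc.
apply/eqP; rewrite eq_le msupp_le_mlead // andbT; apply: sup.
by apply: mlead_supp; apply: contraNneq c0 => f0; rewrite -fc f0 mcoeff0.
Qed.

End monomial_order.

Section eigenvalue_uniqueness.
Variables (R : realType) (N : nat) (theta : R).
Local Notation "''x_' i" := (mpolyX R (mnm1 i)) (at level 8, i at level 2, format "''x_' i").
Local Notation leading := (leading (@below N)).
Let leadM mu nu (c d : R) f g :
  leading mu c f -> leading nu d g -> leading (mnm_add mu nu) (c * d) (f * g).
Proof. exact: (leadingM (@belowD N) (@belowD_eq N)). Qed.

(* Multiplying by the discriminant clears the poles [x_i - x_j] of [D_2^N], so that leading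
   monomials can be compared. *)
Definition discriminant : mpoly N R :=
  \prod_(p : 'I_N * 'I_N | p.1 != p.2) ('x_(p.1) - 'x_(p.2)).

Definition discriminant_off (i j : 'I_N) : mpoly N R :=
  \prod_(p : 'I_N * 'I_N | (p.1 != p.2) && (p != (i, j))) ('x_(p.1) - 'x_(p.2)).

Lemma discriminantE (i j : 'I_N) : i != j ->
  discriminant = ('x_i - 'x_j) * discriminant_off i j.
Proof. by move=> ij; rewrite /discriminant (bigD1 (i, j)). Qed.

Let leading_var i : leading (mnm1 i) 1 'x_i.
Proof.
split=> [m|]; last by rewrite mcoeffX eqxx.
by rewrite msuppX inE => /eqP ->; exact: lexx.
Qed.

Let var_lt (i j : 'I_N) : (i < j)%N -> (mnm1 j < mnm1 i :> multinom N)%O.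
Proof.
move=> ij; apply/ltmcP; first by rewrite !mdeg1.
exists i => [k ki|]; rewrite !mnm1E -!val_eqE /=.
  by rewrite !gtn_eqF // (ltn_trans ki).
by rewrite eqxx gtn_eqF.
Qed.

Let var_neq (i j : 'I_N) : i != j -> (mnm1 j != mnm1 i :> multinom N).
Proof. by move=> ij; rewrite eq_mnm1 eq_sym. Qed.

Let leading_diff (i j : 'I_N) : (i < j)%N -> leading (mnm1 i) 1 ('x_i - 'x_j).
Proof.
move=> ij; have lt := var_lt ij; split.
  apply/supportedP => m; rewrite /below -ltNge => mi; rewrite mcoeffB !mcoeffX.
  by rewrite !(@eq_sym _ _ m) (gt_eqF mi) (gt_eqF (lt_trans lt mi)) subrr.
by rewrite mcoeffB !mcoeffX eqxx (lt_eqF lt) subr0.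
Qed.

Lemma discriminant_neq0 : discriminant != 0.
Proof.
apply/prodf_neq0 => -[i j] /= ij; apply/eqP => /(congr1 (mcoeff (mnm1 i))).
rewrite mcoeffB !mcoeffX eqxx (negbTE (var_neq ij)) subr0 mcoeff0 => /eqP.
by rewrite oner_eq0.
Qed.

(** The polynomial is the discriminant times x_i / (x_i - x_j). For i < j the leading monomial of
    x_i - x_j is x_i and the quotient counts as 1; for i > j it is the larger x_j, and the bound is
    not attained. *)
Let leading_off (i j : 'I_N) : i != j -> leading (mlead discriminant)
  (if (i < j)%N then mleadc discriminant else 0) ('x_i * discriminant_off i j).
Proof.
move=> ij; set q := discriminant_off i j.
have lq : leading (mlead q) (mleadc q) q by split=> //; exact: supported_below_mlead.
have q0 : q != 0.
  by have := discriminant_neq0; rewrite (discriminantE ij) mulf_eq0 negb_or => /andP[].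
have c0 : mleadc q != 0 by rewrite mleadc_eq0.
case: (ltngtP i j) => [lt|gt|/val_inj e]; last by rewrite e eqxx in ij.
  have := leadM (leading_diff lt) lq; rewrite -discriminantE // mul1r => ld.
  have e := leading_below_mlead ld c0; have [_ ec] := ld.
  by rewrite e ec -[mcoeff _ q]mul1r; exact: leadM (leading_var i) lq.
have ld : leading (mnm_add (mnm1 j) (mlead q)) (- mleadc q) discriminant.
  have := leadM (leading_diff gt) lq; rewrite mul1r => -[sup co].
  have de : discriminant = - (('x_j - 'x_i) * q).
    by rewrite (discriminantE ij) -mulNr opprB.
  split; last by rewrite de mcoeffN co.
  by apply/supportedP => m /((supportedP _ _ _).2 sup) z; rewrite de mcoeffN z oppr0.
have nc0 : - mleadc q != 0 by rewrite oppr_eq0.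
have e := leading_below_mlead ld nc0.
have [sup co] := leadM (leading_var i) lq.
have lt : (mnm_add (mnm1 i) (mlead q) < mnm_add (mnm1 j) (mlead q))%O.
  by rewrite ltmc_add2l; exact: var_lt.
rewrite e; split=> [m /sup le|]; first exact: le_trans le (ltW lt).
apply: (supportedP _ _ _).2 sup _ _.
by rewrite /below -ltNge.
Qed.

(** Unlike [mderiv i], it is diagonal on monomials and so preserves supports. *)
Definition euler i (f : mpoly N R) := 'x_i * mderiv i f.

Lemma mcoeff_euler i f m : mcoeff m (euler i f) = (m i)%:R * mcoeff m f.
Proof.
rewrite /euler; have [mi|mi] := eqVneq (m i) 0%N.
  rewrite mi mul0r; apply: memN_msupp_eq0; apply/negP.
  move=> /msuppM_le /allpairsP[[m1 m2] /= []]; rewrite msuppX inE => /eqP -> _ e.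
  by have := congr1 (fun m : multinom N => m i) e; rewrite /= mi mnmDE mnm1E eqxx.
have e : mnm_add (mnm_sub m (mnm1 i)) (mnm1 i) = m by rewrite submK // lep1mP.
rewrite -[in LHS]e addmC mulrC mcoeffMX mcoeff_deriv e mnmBE mnm1E eqxx.
by rewrite subn1 prednK ?lt0n // mulr_natl.
Qed.

Lemma supported_euler i f mu : supported (@below N) mu f ->
  supported (@below N) mu (euler i f).
Proof.
move=> h m; rewrite mcoeff_msupp mcoeff_euler mulf_eq0 negb_or => /andP[_].
by rewrite -mcoeff_msupp => /h.
Qed.

Lemma euler2 i f : euler i (euler i f) - euler i f =
  'x_i ^+ 2 * mderiv i (mderiv i f).
Proof.
rewrite /euler mderivM mderivX mnm1E eqxx scale1r mnm_subxx mpolyX0.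
by ring.
Qed.

Lemma D2_eigenvalue_mlead (f : mpoly N R) (c : R) : f != 0 ->
  (forall x : N.-tuple R, ascending (tnth x) -> D2 theta f x = c * peval f x) ->
  c = eigenvalue_of theta (mlead f).
Proof.
move=> f0 hf.
(* The discriminant times D_2 f - c f, written as a polynomial. *)
pose Z := discriminant * \sum_i (euler i (euler i f) - euler i f) +
  mpolyC N (2 * theta) * (\sum_i \sum_(j | j != i) 'x_i * discriminant_off i j * euler i f)
  - mpolyC N c * (discriminant * f).
have Z0 : Z = 0.
  apply: meval_ascending_eq0 => x' ax'; pose x := [tuple x' i | i < N].
  have xE : tnth x =1 x' by move=> i; rewrite tnth_mktuple.
  have ax : ascending (tnth x).
    by split=> [i|i j ij]; rewrite !xE; [exact: ax'.1|exact: ax'.2].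
  rewrite -(meval_eq _ xE).
  have inj : injective (tnth x).
    move=> i j e; case: (ltngtP i j) => [ij|ji|/val_inj //].
      by have := ax.2 _ _ ij; rewrite e ltxx.
    by have := ax.2 _ _ ji; rewrite e ltxx.
  set v := meval (tnth x) discriminant.
  have off (i j : 'I_N) : i != j -> meval (tnth x) (discriminant_off i j) =
      v / (tnth x i - tnth x j).
    move=> ij; rewrite /v (discriminantE ij) mevalM mevalB !mevalXU mulrAC divff ?mul1r //.
    by rewrite subr_eq0 (inj_eq inj).
  have Z_eval : meval (tnth x) Z = v * (D2 theta f x - c * peval f x).
    rewrite /Z mevalB mevalD !mevalM !mevalC -/v mulrBr; congr (_ - _); last first.
      by rewrite /peval; ring.
    rewrite /D2 mulrDr; congr (_ + _).
      congr (_ * _); rewrite (raddf_sum (meval _)); apply: eq_bigr => i _ /=.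
      by rewrite euler2 mevalM rmorphXn /= mevalXU.
    rewrite mulrCA; congr (_ * _); rewrite mulr_sumr (raddf_sum (meval _)).
    apply: eq_bigr => i _ /=; rewrite mulr_sumr (raddf_sum (meval _)).
    apply: eq_bigr => j ji /=; rewrite /euler !mevalM !mevalXU off 1?eq_sym //.
    by rewrite /peval; ring.
  by rewrite Z_eval (hf x ax) subrr mulr0.
have sup_f : supported (@below N) (mlead f) f by exact: supported_below_mlead.
have leading_euler i : leading (mlead f) ((mlead f i)%:R * mleadc f) (euler i f).
  by split; [exact: supported_euler|rewrite mcoeff_euler].
have ld : leading (mlead discriminant) (mleadc discriminant) discriminant.
  by split=> //; exact: supported_below_mlead.
have := congr1 (mcoeff (mnm_add (mlead discriminant) (mlead f))) Z0.
rewrite /Z mcoeff0 mcoeffB mcoeffD !mcoeffCM.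
have [_ ->] := leadM ld (conj sup_f (erefl (mleadc f))).
have -> : mcoeff (mnm_add (mlead discriminant) (mlead f))
    (discriminant * \sum_i (euler i (euler i f) - euler i f)) =
  mleadc discriminant * \sum_i ((mlead f i)%:R ^+ 2 - (mlead f i)%:R) * mleadc f.
  rewrite mulr_sumr (raddf_sum (mcoeff _)) mulr_sumr; apply: eq_bigr => i _ /=.
  have le : leading (mlead f) (((mlead f i)%:R ^+ 2 - (mlead f i)%:R) * mleadc f)
      (euler i (euler i f) - euler i f).
    split; last by rewrite mcoeffB !mcoeff_euler; ring.
    apply/supportedP => m mN; rewrite mcoeffB !mcoeff_euler.
    by rewrite ((supportedP _ _ _).2 sup_f m mN) !mulr0 subr0.
  by have [_ ->] := leadM ld le.
have -> : mcoeff (mnm_add (mlead discriminant) (mlead f))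
    (\sum_i \sum_(j | j != i) 'x_i * discriminant_off i j * euler i f) =
  mleadc discriminant * ((\sum_(i < N) \sum_(j < N | (i < j)%N) (mlead f i)%:R) * mleadc f).
  rewrite mulr_suml mulr_sumr (raddf_sum (mcoeff _)); apply: eq_bigr => i _ /=.
  rewrite mulr_suml mulr_sumr (raddf_sum (mcoeff _)) /=.
  rewrite [RHS](eq_bigl (fun j : 'I_N => (j != i) && (i < j)%N)) => [|j]; last first.
    by rewrite andb_idl // => ij; rewrite -val_eqE /= gtn_eqF.
  rewrite big_mkcondr; apply: eq_bigr => j ji.
  have [_ ->] := leadM (leading_off (etrans (f_equal negb (eq_sym i j)) ji)) (leading_euler i).
  by case: ifP => _ //; rewrite mul0r.
rewrite -mulr_suml => e.
have vf : mleadc discriminant * mleadc f != 0.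
  by rewrite mulf_neq0 // mleadc_eq0 // discriminant_neq0.
apply: (mulIf vf); apply/eqP; rewrite -subr_eq0 -oppr_eq0 -[X in _ == X]e; apply/eqP.
by rewrite /eigenvalue_of; ring.
Qed.

End eigenvalue_uniqueness.

(** * Partitions and the leading monomial of a Jack polynomial *)

Section partitions.

(** Exchange argument: when the maximum x of s is not in t, the head of t is traded for x, which is
    at least as large. *)
Lemma sumn_sub_take (s t r : seq nat) : sorted geq s -> perm_eq (t ++ r) s ->
  (sumn t <= sumn (take (size t) s))%N.
Proof.
elim: s t r => [|x s IH] t r.
  by move=> _ /perm_nilP; case: t.
move=> sx; have {}IH := IH _ _ (path_sorted sx).
have [xt|xt] := boolP (x \in t) => p.
  have /perm_sumn -> := perm_to_rem xt.
  have := IH (rem x t) r; rewrite size_rem // => /(_ _)/= h.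
  have [t0|tS] := posnP (size t); first by move: xt; rewrite (size0nil t0).
  rewrite -[size t]prednK //= leq_add2l h //.
  rewrite -(perm_cons x); apply: perm_trans p; rewrite perm_sym.
  by rewrite -cat_cons perm_cat2r perm_to_rem.
case: t xt p => [|y t] // xt p; rewrite /=.
have xr : x \in r.
  have := perm_mem p x; rewrite mem_head mem_cat (negbTE xt) /= => ->.
  by [].
have yx : (y <= x)%N.
  have : y \in x :: s by rewrite -(perm_mem p) mem_head.
  rewrite inE => /predU1P[-> //|ys].
  have geq_trans : transitive geq by move=> a b c h1 h2; exact: leq_trans h2 h1.
  exact: (allP (order_path_min geq_trans sx)).
apply: leq_add => //; apply: (IH t (y :: rem x r)).
rewrite -(perm_cons x); apply: perm_trans p; apply/permP => a.
have /permP /(_ a) := perm_to_rem xr.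
by rewrite /= !count_cat /= => ->; lia.
Qed.

Let geq_trans : transitive geq.
Proof. by move=> a b c h1 h2; exact: leq_trans h2 h1. Qed.

Let geq_anti : antisymmetric geq.
Proof. by move=> a b; rewrite andbC => /anti_leq. Qed.

Variable N : nat.

Definition padded (mu : seq nat) : seq nat := cat mu (nseq (N - size mu) 0%N).

Definition part_multinom (mu : seq nat) : multinom N := Multinom [tuple nth 0%N mu i | i < N].

Lemma sorted_padded mu : is_partition mu -> sorted geq (padded mu).
Proof.
case/andP => smu _; rewrite sorted_pairwise // pairwise_cat -sorted_pairwise // smu /=.
apply/andP; split.
  by apply/allrelP => a b _ /nseqP[-> _].
by elim: (N - size mu)%N => //= n ->; rewrite andbT; apply/allP => b /nseqP[->].
Qed.

Lemma sumn_take_padded mu k : sumn (take k (padded mu)) = sumn (take k mu).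
Proof.
rewrite /padded take_cat; case: ltnP => // h; rewrite sumn_cat (take_oversize h).
suff -> : sumn (take (k - size mu) (nseq (N - size mu) 0%N)) = 0%N by rewrite addn0.
by elim: (N - size mu)%N (k - size mu)%N => [|n IH] [|j] //=; rewrite IH.
Qed.

Lemma padded_inj mu la : is_partition mu -> is_partition la ->
  perm_eq (padded mu) (padded la) -> mu = la.
Proof.
move=> hmu hla /(sorted_eq geq_trans geq_anti (sorted_padded hmu) (sorted_padded hla)) e.
have pos s : is_partition s -> [seq i <- padded s | (0 < i)%N] = s.
  case/andP => _ s0; rewrite filter_cat filter_nseq /= cats0; apply/all_filterP/allP => i si.
  by rewrite lt0n; apply: contraNneq s0 => <-.
by rewrite -(pos mu) // e pos.
Qed.

Lemma mdeg_val (m : multinom N) : mdeg m = sumn (multinom_val m).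
Proof. by rewrite /mdeg sumnE. Qed.

Lemma sum_nth_sumn (s : seq nat) k :
  (\sum_(i < size s | (i < k)%N) nth 0 s i = sumn (take k s))%N.
Proof.
elim: s k => [|x s IH] k; first by rewrite big_ord0.
case: k => [|k]; first by rewrite big_pred0.
by rewrite /= -IH big_mkcond big_ord_recl /= [in RHS]big_mkcond.
Qed.

Lemma psum_part_multinom (la : seq nat) k : (size la <= N)%N ->
  psum (part_multinom la) k = sumn (take k la).
Proof.
move=> laN; have sN : size (padded la) = N by rewrite size_cat size_nseq subnKC.
rewrite -sumn_take_padded -sum_nth_sumn sN.
apply: eq_bigr => i _; rewrite mnmE /padded nth_cat nth_nseq.
by case: ltnP => // h; rewrite nth_default // if_same.
Qed.

Lemma dominated_rearrangement mu la m : is_partition mu -> (size la <= N)%N ->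
  sumn mu = sumn la -> (forall k, sumn (take k mu) <= sumn (take k la))%N ->
  perm_eq (multinom_val m) (padded mu) -> dominated (part_multinom la) m.
Proof.
move=> hmu laN e le p.
have full (n : multinom N) : psum n N = mdeg n.
  by rewrite /psum mdegE; apply: eq_bigl => i; rewrite ltn_ord.
apply/dominatedP; split.
  rewrite mdeg_val (perm_sumn p) -full psum_part_multinom // take_oversize // -e.
  by rewrite /padded sumn_cat sumn_nseq mul0n addn0.
move=> I; rewrite psum_part_multinom //; apply: leq_trans (le _).
rewrite -sumn_take_padded.
have -> : (\sum_(i in I) m i = sumn [seq m i | i <- enum I])%N.
  by rewrite sumnE big_map big_enum.
rewrite cardE -(size_map m); apply: (@sumn_sub_take _ _ [seq m i | i <- enum (~: I)%SET]).
  exact: sorted_padded.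
apply: perm_trans p.
have -> : tval (multinom_val m) = [seq m i | i <- enum 'I_N].
  apply: (@eq_from_nth _ 0%N) => [|i]; rewrite (size_tuple (multinom_val m)).
    by rewrite size_map size_enum_ord.
  move=> iN; by rewrite (nth_map (Ordinal iN)) ?size_enum_ord // (mnm_nth 0%N) nth_enum_ord.
rewrite -map_cat; apply/perm_map/uniq_perm.
- rewrite cat_uniq !enum_uniq /= andbT; apply/hasPn => i.
  by rewrite !mem_enum finset.in_setC.
- exact: enum_uniq.
- by move=> i; rewrite mem_cat !mem_enum finset.in_setC orbN.
Qed.

Section jack_support.
Variables (R : realType) (la : seq nat).
Hypothesis la_part : is_partition la.
Hypothesis la_size : (size la <= N)%N.

Lemma mcoeff_monomial_sym (mu : seq nat) m : mcoeff m (monomial_sym N mu : mpoly N R) =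
  ((mdeg m < (sumn mu).+1)%N && perm_eq (multinom_val m) (padded mu))%:R.
Proof.
rewrite /monomial_sym (raddf_sum (mcoeff m)).
have [mlt|mge] := boolP (mdeg m < (sumn mu).+1)%N; last first.
  rewrite big1 // => m' _ /=; rewrite mcoeffX; case: eqP => // e.
  by rewrite -e bmdeg in mge.
have [p|np] := boolP (perm_eq (multinom_val m) (padded mu)).
  rewrite (bigD1 (BMultinom mlt)) //= big1 => [|m' /andP[_ ne]].
    by rewrite addr0 mcoeffX eqxx.
  rewrite mcoeffX; case: eqP => // e; case/eqP: ne.
  exact/val_inj.
rewrite big1 // => m' pm'; rewrite /= mcoeffX; case: eqP => // e.
by rewrite -e [padded mu]/padded pm' in np.
Qed.

Lemma jack_leading theta (P : mpoly N R) : is_jack theta la P ->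
  leading (@dominated N) (part_multinom la) 1 P.
Proof.
move=> [_ [mus [u [hmus ->]] _]].
have part_la : multinom_val (part_multinom la) = padded la :> seq nat.
  apply: (@eq_from_nth _ 0%N) => [|i]; rewrite (size_tuple (multinom_val _)).
    by rewrite size_cat size_nseq subnKC.
  move=> iN.
  rewrite -(mnm_nth 0%N (part_multinom la) (Ordinal iN)) mnmE nth_cat nth_nseq /=.
  by case: ltnP => // h; rewrite nth_default // if_same.
have sup mu : is_partition mu -> sumn mu = sumn la ->
    (forall k, sumn (take k mu) <= sumn (take k la))%N ->
    forall m, ~~ dominated (part_multinom la) m -> mcoeff m (monomial_sym N mu : mpoly N R) = 0.
  move=> hmu e le m nd; rewrite mcoeff_monomial_sym.
  case: (boolP (perm_eq _ _)) => [p|]; last by rewrite andbF.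
  by case/negP: nd; exact: (dominated_rearrangement hmu).
split.
  apply/supportedP => m nd; rewrite mcoeffD sup // add0r (raddf_sum (mcoeff m)).
  rewrite big_seq big1 // => mu /hmus[hmu [_ e le]] /=.
  by rewrite mcoeffZ sup // mulr0.
rewrite mcoeffD mcoeff_monomial_sym part_la perm_refl andbT.
have -> : (mdeg (part_multinom la) < (sumn la).+1)%N.
  by rewrite mdeg_val part_la ltnS /padded sumn_cat sumn_nseq mul0n addn0.
rewrite (raddf_sum (mcoeff _)) big_seq big1 ?addr0 // => mu /hmus[hmu [ne _ _]] /=.
rewrite mcoeffZ mcoeff_monomial_sym part_la.
case: (boolP (perm_eq _ _)) => [p|]; last by rewrite andbF mulr0.
by case: ne; apply/esym/padded_inj.
Qed.

End jack_support.
End partitions.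

(** * The average of a Jack polynomial *)

Section average_of_jack.
Variables (R : realType) (N : nat) (theta alpha : R).
Hypothesis theta_gt0 : 0 < theta.
Hypothesis alpha_gt : -1 < alpha.
Local Notation s := (@Lambda_weights R theta alpha N).

Lemma Lambda_weights_gt0 a : 0 < s a.
Proof.
rewrite /Lambda_weights; case: ifP => // _.
by rewrite mulr_gt0 // -ltrBlDr sub0r.
Qed.

Lemma tail_sum_Lambda_weights k : (k <= N)%N ->
  tail_sum s k = (N%:R + alpha + 1 - k%:R) * theta.
Proof.
move=> kN; rewrite /tail_sum (bigD1 ord0) /=; last first.
  by rewrite inE; apply/imsetP => -[i _ /eqP]; rewrite (negbTE (neq_lift _ _)).
rewrite {1}/Lambda_weights eqxx (eq_bigr (fun=> theta)) => [|a /andP[_ a0]]; last first.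
  by rewrite /Lambda_weights (negbTE a0).
rewrite sumr_const -[theta *+ _]mulr_natl.
have -> : #|[pred a | (a \in tail N k) && (a != ord0)]| = (N - k)%N.
  have := cardsC (lift ord0 @: initial N k); rewrite -/(tail N k).
  rewrite card_imset; last exact: lift_inj.
  rewrite card_initial (minn_idPl kN) card_ord (cardD1 ord0 (tail N k)).
  have -> : ord0 \in tail N k.
    by rewrite inE; apply/imsetP => -[i _ /eqP]; rewrite (negbTE (neq_lift _ _)).
  have -> : #|[predD1 tail N k & ord0]| = #|[pred a | (a \in tail N k) && (a != ord0)]|.
    by apply: eq_card => a; rewrite !inE andbC.
  by lia.
by rewrite natrB //; ring.
Qed.

(** A polynomial that vanishes on the simplex may be nonzero, for instance a multiple of w_0 + ... +
    w_N - 1, so this is not formal; [dirichlet_mean_simplex] proves it from the integral form of the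
    moments. *)
Hypothesis mean_simplex : forall f : mpoly N.+1 R,
  (forall w, (forall a, 0 < w a) -> \sum_a w a = 1 -> meval w f = 0) ->
  dirichlet_mean s f = 0.

Lemma D2_average_eigen (g : mpoly N R) (c : R) (x : N.-tuple R) :
  (forall y : N.-tuple R, injective (tnth y) ->
     D2 theta (subst_esym g) y = c * peval (subst_esym g) y) ->
  ascending (tnth x) ->
  D2 theta (average s (subst_weighted_esym g)) x =
  c * peval (average s (subst_weighted_esym g)) x.
Proof.
move=> hg [x0 x_lt]; set F := subst_weighted_esym g.
have X_lt (i j : 'I_N.+1) : (i < j)%N -> extend0 (tnth x) i < extend0 (tnth x) j.
  case: (unliftP ord0 i) => [i'|] ->; case: (unliftP ord0 j) => [j'|] -> //.
  - by rewrite !extend0_lift /= /bump !add1n ltnS => /x_lt.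
  - by rewrite extend0_0 extend0_lift.
have Xinj : injective (extend0 (tnth x)).
  move=> i j e; case: (ltngtP i j) => [/X_lt|/X_lt|/val_inj //]; by rewrite e ltxx.
rewrite D2_average /peval (meval_average s (tnth x) F).
apply/eqP; rewrite -subr_eq0; apply/eqP.
(* The operator in w can be inserted because its mean is 0; the polynomial under the mean then
   vanishes at each point of the simplex. *)
transitivity (dirichlet_mean s (D2_x theta (tnth x) F - D2_w s (tnth x) (eval_x (tnth x) F)
   - mpolyC N.+1 c * eval_x (tnth x) F)).
  rewrite 2!(raddfB (dirichlet_mean s)) /= dirichlet_mean_D2_w subr0.
  by rewrite dirichlet_meanZ.
apply: mean_simplex => w w_gt0 w1.
have Xle (i j : 'I_N.+1) : (i <= j)%N -> extend0 (tnth x) i <= extend0 (tnth x) j.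
  by rewrite leq_eqVlt => /predU1P[/val_inj -> //|/X_lt/ltW].
have [y [_ y_lt roots_y]] := interlacing_roots Xle w_gt0 w1.
pose yt := [tuple y i | i < N].
have ytE i : tnth yt i = y i by rewrite tnth_mktuple.
(* Ascending nodes leave no degenerate gap, so the roots are distinct and the eigenvalue equation of
   P may be used at y. *)
have yt_inj : injective (tnth yt).
  have y_mono (i j : 'I_N) : (i < j)%N -> y i < y j.
    move=> ij.
    have /andP[_ h1] :
        extend0 (tnth x) (lift ord_max i) < y i < extend0 (tnth x) (lift ord0 i).
      by apply: y_lt; apply: X_lt; rewrite /= /bump [(N <= i)%N]leqNgt ltn_ord.
    have /andP[h2 _] :
        extend0 (tnth x) (lift ord_max j) < y j < extend0 (tnth x) (lift ord0 j).
      by apply: y_lt; apply: X_lt; rewrite /= /bump [(N <= j)%N]leqNgt ltn_ord.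
    apply: lt_trans h1 (le_lt_trans _ h2); apply: Xle.
    by rewrite /= /bump [(N <= j)%N]leqNgt ltn_ord add0n add1n.
  move=> i j; rewrite !ytE => e.
  case: (ltngtP i j) => [/y_mono|/y_mono|/val_inj //]; by rewrite e ltxx.
have roots_yt : \sum_a w a *: \prod_(l | l != a) ('X - (extend0 (tnth x) l)%:P) =
    \prod_l ('X - (tnth yt l)%:P).
  by rewrite roots_y; apply: eq_bigr => i _; rewrite ytE.
have s_theta a : a != ord0 -> s a = theta by rewrite /Lambda_weights => /negbTE ->.
have key := diffusion_subst s_theta Xinj yt_inj roots_yt g.
rewrite 2!mevalB mevalM mevalC meval_D2_x meval_D2_w.
have evF : meval w (eval_x (tnth x) F) = peval (subst_esym g) yt.
  exact: (eval_subst roots_yt).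
by rewrite evF -(hg yt yt_inj) -key subrr.
Qed.

Lemma average_jack (la : seq nat) (P g : mpoly N R) : is_partition la ->
  (size la <= N)%N -> is_jack theta la P -> subst_esym g = P ->
  average s (subst_weighted_esym g) =
  mpolyC N (\prod_(i < N) (rising (tail_sum s i.+1) (nth 0%N la i) /
                          rising (tail_sum s i) (nth 0%N la i))) * P.
Proof.
move=> hla hN hP gP; set F := subst_weighted_esym g; set c := \prod_i _.
set G := average s F; set lam := part_multinom N la.
have [supP Plam] := jack_leading hla hN hP.
have [_ _ eigP] := hP.
have P0 : P != 0.
  by apply: contraTneq isT => P0; move: Plam; rewrite P0 mcoeff0 => /esym/eqP; rewrite oner_eq0.
have asc_inj (x : N.-tuple R) : ascending (tnth x) -> injective (tnth x).
  move=> [_ lt] i j e; case: (ltngtP i j) => [/lt|/lt|/val_inj //]; by rewrite e ltxx.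
have mleadP : mlead P = lam.
  apply: (leading_below_mlead (c := 1)) (oner_neq0 _); split=> // m /supP.
  exact: dominated_le.
have supF : supported (@dominated N) lam F.
  by apply: supported_subst_weighted_esym; rewrite gP.
have [nu nu_lam Flam] : exists2 nu, conj_shape nu = lam &
    mcoeff lam F = mpolyC N.+1 1 * weight_monomial R nu.
  by apply: leading_coef_subst; rewrite ?gP ?oner_neq0.
have Glam : mcoeff lam G = c.
  rewrite mcoeff_average Flam dirichlet_meanZ mul1r.
  rewrite (mean_weight_monomial Lambda_weights_gt0) nu_lam.
  by apply: eq_bigr => i _; rewrite mnmE.
apply/eqP; rewrite -subr_eq0; apply/negPn/negP => f0.
set f := G - mpolyC N c * P in f0.
have flam : mcoeff lam f = 0 by rewrite mcoeffB mcoeffCM Glam Plam mulr1 subrr.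
have supf : supported (@dominated N) lam f.
  apply/supportedP => m nd; rewrite mcoeffB mcoeffCM mcoeff_average.
  rewrite ((supportedP _ _ _).2 supF _ nd) ((supportedP _ _ _).2 supP _ nd).
  by rewrite raddf0 mulr0 subrr.
set E := D2_eigenvalue N theta la in eigP.
(* If f were nonzero, P and f would share the eigenvalue E, while the leading exponent of f is
   dominated by [lam] and different from it. *)
have EP : E = eigenvalue_of theta lam.
  rewrite -mleadP; apply: (D2_eigenvalue_mlead P0) => x /asc_inj; exact: eigP.
have Ef : E = eigenvalue_of theta (mlead f).
  apply: (D2_eigenvalue_mlead f0) => x ax.
  have D2f : D2 theta f x = D2 theta G x - c * D2 theta P x.
    have -> : f = G + mpolyC N (- c) * P by rewrite /f mpolyCN mulNr.
    rewrite !D2E /D2_diffusion (diffusionD _ _ (mevalD (tnth x))); last first.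
      by move=> i p q; exact: mderivD.
    rewrite (diffusion_scale _ _ (mevalM (tnth x))).
    - by rewrite mevalC mulNr.
    - by move=> i p q; exact: mderivM.
    - by move=> i; exact: mderivC.
  rewrite D2f (D2_average_eigen (c := E)) //; last by rewrite gP.
  rewrite (eigP _ (asc_inj _ ax)) /peval mevalB mevalM mevalC.
  by rewrite -/F -/G; ring.
have lead_f : dominated lam (mlead f) by apply: supf; exact: mlead_supp.
have lead_neq : mlead f != lam.
  by apply: contraTneq (mlead_supp f0) => ->; rewrite mcoeff_msupp flam eqxx.
have := eigenvalue_of_lt theta_gt0 lead_f lead_neq.
by rewrite -EP -Ef ltxx.
Qed.

End average_of_jack.

Local Open Scope classical_set_scope.

(** * The Gamma function and the Dirichlet integral *)

Section image_measure.
Variables (d d' : measure_display) (T : measurableType d) (T' : measurableType d').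
Variables (R : realType) (m : {measure set T -> \bar R}) (f : T -> T').

Definition image_measure (mf : measurable_fun setT f) : {measure set T' -> \bar R}.
Proof. by refine (pushforward m f). Defined.

Lemma ge0_integral_image_measure (mf : measurable_fun setT f) (g : T' -> \bar R) :
  measurable_fun setT g -> (forall y, 0 <= g y)%E ->
  (\int[image_measure mf]_y g y = \int[m]_x g (f x))%E.
Proof. by move=> mg g0; rewrite ge0_integral_pushforward. Qed.

End image_measure.

Section affine_change_of_variable.
Variable R : realType.
Local Notation mu := (@lebesgue_measure R).

Definition affine (k c x : measurableTypeR R) : measurableTypeR R := k * x + c.

Lemma measurable_affine k c : measurable_fun setT (affine k c).
Proof. by apply: measurable_funD => //; exact: measurable_funM. Qed.

Lemma lebesgue_measure_affine (k c : R) (k0 : 0 < k) (A : set R) :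
  measurable A -> mu A = (k%:E * mu (affine k c @^-1` A))%E.
Proof.
move=> mA.
apply: (@lebesgue_measure_unique R (mscale (NngNum (ltW k0))
  (image_measure mu (measurable_affine k c)))) => // _ [[a b]] _ <-.
rewrite /= /mscale.
rewrite (_ : image_measure _ _ _ = mu `](a - c) / k, (b - c) / k]); last first.
  congr mu; apply/seteqP; split => x; rewrite /affine /= !in_itv /= => /andP[h1 h2].
    by rewrite ltr_pdivrMr // ler_pdivlMr // mulrC ltrBlDr lerBrDr h1.
  by move: h1 h2; rewrite ltr_pdivrMr // ler_pdivlMr // mulrC ltrBlDr lerBrDr => -> ->.
rewrite !lebesgue_measure_itv /= !lte_fin ltr_pM2r ?invr_gt0 // ltrD2r.
case: ifP => _; last by rewrite mule0.
rewrite -!EFinB -EFinM; congr EFin.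
by rewrite -mulrBl mulrCA mulfV ?gt_eqF // mulr1; ring.
Qed.

Lemma ge0_integral_affine (f : R -> \bar R) (k c : R) : 0 < k ->
  measurable_fun setT f -> (forall x, 0 <= f x)%E ->
  (\int[mu]_x f x = k%:E * \int[mu]_x f (k * x + c)%R)%E.
Proof.
move=> k0 mf f0.
rewrite (@eq_measure_integral _ _ _ _
    (mscale (NngNum (ltW k0)) (image_measure mu (measurable_affine k c)))); last first.
  by move=> A mA _; exact: lebesgue_measure_affine.
rewrite ge0_integral_mscale //; congr (_ * _)%E.
exact: ge0_integral_image_measure.
Qed.

End affine_change_of_variable.

Section power_kernel.
Variable R : realType.
Local Notation mu := (@lebesgue_measure R).

Lemma cvg_invn_at_right : (n.+2%:R^-1 : R) @[n --> \oo] --> (0 : R)^'+.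
Proof.
move=> P [e /= e0 eP]; change (\forall n \near \oo, P (n.+2%:R^-1)); near=> n.
have n0 : (0 < n.+2%:R^-1 :> R)%R by rewrite invr_gt0.
apply: eP => //; rewrite /ball /= sub0r normrN gtr0_norm ?invr_gt0 //.
apply: le_lt_trans (_ : n.+1%:R^-1 < e).
  by rewrite lef_pV2 ?posrE // ler_nat.
by near: n; exact: (near_infty_natSinv_lt (PosNum e0)).
Unshelve. all: by end_near. Qed.

Lemma integral_powR_itv (a e : R) : 0 < a -> 0 < e < 1 ->
  (\int[mu]_(x in `[e, 1%R]) (x `^ (a - 1))%:E = (a^-1 - a^-1 * e `^ a)%:E)%E.
Proof.
move=> a0 /andP[e0 e1].
have pos : forall x : R, x \in `[e, 1%R]%R -> x \in `]0%R, +oo[%R.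
  by move=> x; rewrite !in_itv /= andbT => /andP[ex _]; exact: lt_le_trans ex.
have cont (b x : R) : x \in `]0%R, +oo[%R -> {for x, continuous (fun y : R => y `^ b)}.
  by move=> x0; apply/differentiable_continuous/derivable1_diffP; exact: derivable_powR.
rewrite (@continuous_FTC2 _ _ (fun x => a^-1 * x `^ a)) //.
- by rewrite powR1 mulr1 -EFinB.
- apply: continuous_in_subspaceT => x; rewrite inE => /pos; exact: cont.
- split.
  + move=> x /subset_itv_oo_cc /pos x0; apply: derivableM => //; exact: derivable_powR.
  + apply: cvg_at_right_filter; apply: cvgMr; apply: cont; apply: pos.
    by rewrite in_itv /= lexx ltW.
  + apply: cvg_at_left_filter; apply: cvgMr; apply: cont; apply: pos.
    by rewrite in_itv /= lexx ltW.
- move=> x /subset_itv_oo_cc /pos x0.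
  rewrite derive1Ml; last exact: derivable_powR.
  by rewrite powR_derive1 // mulrA mulVf ?mul1r // gt_eqF.
Qed.

Lemma integral_powR01 (a : R) : 0 < a ->
  (\int[mu]_(x in `]0%R, 1%R]) (x `^ (a - 1))%:E = (a^-1)%:E)%E.
Proof.
(* The integrand may be unbounded at 0. Starting at n + 2 keeps the left end strictly below 1. *)
move=> a0; pose F n : set R := `[(n.+2%:R)^-1, 1%R].
have le1 n : (n.+2%:R^-1 < 1 :> R)%R by rewrite invf_lt1 // ltr1n.
have inv0 n : (0 < n.+2%:R^-1 :> R)%R by rewrite invr_gt0.
have FE : \bigcup_n F n = `]0%R, 1%R].
  apply/seteqP; split => x /=.
    by case=> n _ /=; rewrite !in_itv /= => /andP[h x1]; rewrite (lt_le_trans (inv0 n) h).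
  rewrite in_itv /= => /andP[x0 x1].
  have hn := archimedean.Num.Theory.truncnS_gt x^-1.
  exists (archimedean.Num.truncn x^-1) => //; rewrite /F /= in_itv /= x1 andbT.
  rewrite invf_ple ?posrE //; apply: le_trans (ltW hn) _.
  by rewrite ler_nat.
have Fcvg : (\int[mu]_(x in F n) (x `^ (a - 1))%:E)%E @[n --> \oo] -->
   (\int[mu]_(x in \bigcup_n F n) (x `^ (a - 1))%:E)%E.
  apply: ge0_nondecreasing_set_cvg_integral.
  - apply/nondecreasing_seqP => n; apply/subsetPset => x; rewrite /F /=.
    rewrite !in_itv /= => /andP[h x1]; rewrite x1 andbT; apply: le_trans h.
    by rewrite lef_pV2 ?posrE // ler_nat.
  - by move=> n; exact: measurable_itv.
  - move=> n; apply: measurable_funTS; apply/measurable_EFinP; exact: measurable_powR.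
  - by move=> n x _; rewrite lee_fin powR_ge0.
rewrite -FE; apply: cvg_unique Fcvg _ => //.
apply: (@cvg_trans _ ((a^-1 - a^-1 * (n.+2%:R^-1) `^ a)%:E @[n --> \oo])).
  apply: near_eq_cvg; apply: nearW => n.
  by rewrite integral_powR_itv // inv0 le1.
apply: cvg_EFin; first exact: nearW.
rewrite -[X in _ --> X]subr0 -[X in _ --> _ - X](mulr0 a^-1).
apply: cvgB; first exact: cvg_cst.
apply: cvgMr.
exact: (cvg_comp _ _ cvg_invn_at_right (powR_cvg0 a0)).
Qed.

End power_kernel.

Section gamma_function.
Variable R : realType.
Local Notation mu := (@lebesgue_measure R).
Implicit Types a b u T : R.

(* Densities of the Gamma distributions without normalisation and without the exponential
   factor, extended by [0] to the whole line so that they can be convolved. *)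
Definition power_kernel a u : R := if 0 < u then u `^ (a - 1) else 0.

Lemma power_kernel_ge0 a u : 0 <= power_kernel a u.
Proof. by rewrite /power_kernel; case: ifP => // _; exact: powR_ge0. Qed.

Lemma measurable_power_kernel a :
  measurable_fun [set: measurableTypeR R] (power_kernel a : measurableTypeR R -> measurableTypeR R).
Proof.
apply: measurable_fun_ifT; last exact: measurable_cst.
  by apply: measurable_fun_ltr; [exact: measurable_cst|exact: measurable_id].
exact: (@measurable_powR R).
Qed.

Lemma power_kernelZ a T u : 0 < T ->
  power_kernel a (T * u) = T `^ (a - 1) * power_kernel a u.
Proof.
move=> T0; rewrite /power_kernel pmulr_rgt0 //; case: ifP => [u0|]; last by rewrite mulr0.
by rewrite powRM // ltW.
Qed.

Definition gamma_kernel a u : R := power_kernel a u * expR (- u).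

Lemma gamma_kernel_ge0 a u : 0 <= gamma_kernel a u.
Proof. by rewrite mulr_ge0 ?power_kernel_ge0 ?expR_ge0. Qed.

Lemma measurable_gamma_kernel a :
  measurable_fun [set: measurableTypeR R] (gamma_kernel a : measurableTypeR R -> measurableTypeR R).
Proof.
apply: measurable_funM; first exact: measurable_power_kernel.
by apply: (measurableT_comp (@measurable_expR R)); exact: oppr_measurable.
Qed.

Definition gamma_integral a : \bar R := (\int[mu]_u (gamma_kernel a u)%:E)%E.

Lemma beta_kernel_ge0 a b T u : (0 <= (power_kernel a u * power_kernel b (T - u))%:E)%E.
Proof. by rewrite lee_fin mulr_ge0 ?power_kernel_ge0. Qed.

Lemma measurable_beta_kernel a b T : measurable_fun [set: measurableTypeR R]
  (fun u : measurableTypeR R => (power_kernel a u * power_kernel b (T - u))%:E).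
Proof.
apply/measurable_EFinP; apply: measurable_funM; first exact: measurable_power_kernel.
apply: (measurableT_comp (@measurable_power_kernel b)).
exact: measurable_funB.
Qed.

Definition beta_conv a b T : \bar R :=
  (\int[mu]_u (power_kernel a u * power_kernel b (T - u))%:E)%E.

Lemma beta_conv_ge0 a b T : (0 <= beta_conv a b T)%E.
Proof. by apply: integral_ge0 => u _; rewrite lee_fin mulr_ge0 ?power_kernel_ge0. Qed.

(** Homogeneity under the substitution of T u for u; for T at most 0 the two kernels have disjoint
    supports. *)
Lemma beta_convE a b T :
  beta_conv a b T = ((power_kernel (a + b) T)%:E * beta_conv a b 1)%E.
Proof.
rewrite {1}/power_kernel; case: ltP => [T0|T0]; last first.
  rewrite mul0e; apply: integral0_eq => u _; congr EFin.
  rewrite /power_kernel; case: ltP => u0; last by rewrite mul0r.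
  by rewrite ltNge subr_le0 (le_trans T0 (ltW u0)) mulr0.
have T1 := powR_ge0 T (a + b - 1).
rewrite /beta_conv.
rewrite (@ge0_integral_affine _ _ T 0 T0 (measurable_beta_kernel a b T) (beta_kernel_ge0 a b T)).
rewrite -(ge0_integralZl_EFin mu measurableT (fun u _ => beta_kernel_ge0 a b 1 u)
  (measurable_beta_kernel a b 1) T1).
rewrite -(ge0_integralZl_EFin mu measurableT _ _ (ltW T0)); last 2 first.
- by move=> u _; exact: beta_kernel_ge0.
- apply: (measurableT_comp (measurable_beta_kernel a b T)); exact: measurable_affine.
apply: eq_integral => u _; rewrite -!EFinM; congr EFin.
rewrite addr0 (_ : T - T * u = T * (1 - u)); last by ring.
rewrite !power_kernelZ //.
have -> : T `^ (a + b - 1) = T * T `^ (a - 1) * T `^ (b - 1).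
  rewrite -[X in _ = X * _ * _](powRr1 (ltW T0)) -!powRD ?(gt_eqF T0) ?implybT //.
  by congr powR; ring.
ring.
Qed.

Lemma gamma_integral_ge0 a : (0 <= gamma_integral a)%E.
Proof. by apply: integral_ge0 => u _; rewrite lee_fin gamma_kernel_ge0. Qed.

(** The product is the total mass of the convolution of the two kernels, whose exponentials combine
    to exp(-t). It is an identity of extended reals, by Tonelli, since the finiteness of
    [gamma_integral] is derived from it through [gamma_integralS]. *)
Lemma gamma_integralM a b :
  (gamma_integral a * gamma_integral b = beta_conv a b 1 * gamma_integral (a + b))%E.
Proof.
pose F (p : measurableTypeR R * measurableTypeR R) :=
  (gamma_kernel a p.1 * gamma_kernel b (p.2 - p.1))%:E.
have mE c : measurable_fun [set: measurableTypeR R]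
    (fun u : measurableTypeR R => (gamma_kernel c u)%:E).
  by apply/measurable_EFinP; exact: measurable_gamma_kernel.
have E0 c u : (0 <= (gamma_kernel c u)%:E)%E by rewrite lee_fin gamma_kernel_ge0.
have mF : measurable_fun setT F.
  apply/measurable_EFinP; apply: measurable_funM.
    exact: (measurableT_comp (@measurable_gamma_kernel a)).
  apply: (measurableT_comp (@measurable_gamma_kernel b)).
  exact: measurable_funB.
have F0 p : (0 <= F p)%E by rewrite lee_fin mulr_ge0 ?gamma_kernel_ge0.
transitivity (\int[mu]_u \int[mu]_t F (u, t))%E.
  rewrite [X in (X * _)%E]/gamma_integral.
  rewrite -(ge0_integralZr mu measurableT (mE a) (fun u _ => E0 a u) (gamma_integral_ge0 b)).
  apply: eq_integral => u _.
  rewrite /gamma_integral (ge0_integral_affine (-u) ltr01 (mE b) (E0 b)) mul1e.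
  rewrite -(ge0_integralZl_EFin mu measurableT _ _ (gamma_kernel_ge0 a u)); last 2 first.
  - by move=> t _; exact: E0.
  - by apply: (measurableT_comp (mE b)); exact: measurable_affine.
  by apply: eq_integral => t _; rewrite /F /= -EFinM mul1r.
rewrite fubini_tonelli //.
rewrite [X in (_ * X)%E]/gamma_integral.
rewrite -(ge0_integralZl mu measurableT (mE _) (fun u _ => E0 _ u) (beta_conv_ge0 _ _ _)).
apply: eq_integral => t _.
transitivity ((expR (- t))%:E * beta_conv a b t)%E; last first.
  by rewrite beta_convE muleA -EFinM muleC [expR _ * _]mulrC.
rewrite -(ge0_integralZl_EFin mu measurableT (fun u _ => beta_kernel_ge0 a b t u)
  (measurable_beta_kernel a b t) (expR_ge0 _)).
apply: eq_integral => u _; rewrite /F /= -EFinM; congr EFin.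
rewrite /gamma_kernel (_ : - t = - u + - (t - u)); last by ring.
by rewrite expRD; ring.
Qed.

Lemma gamma_integralE a :
  gamma_integral a = (\int[mu]_(t in `]0%R, +oo[) (t `^ (a - 1) * expR (- t))%:E)%E.
Proof.
rewrite [RHS]integral_mkcond; apply: eq_integral => u _.
rewrite patchE mem_setE in_itv /= andbT /gamma_kernel /power_kernel.
by case: ifP; rewrite ?mul0r.
Qed.

Lemma gamma_integral1 : gamma_integral 1 = 1%E.
Proof.
rewrite -(integral_exponential_pdf (ltr01 : (0 < 1 :> R))) gamma_integralE.
rewrite integral_itv_obnd_cbnd; last first.
  apply: measurable_funTS; apply/measurable_EFinP.
  apply: measurable_funM; first exact: (@measurable_powR R).
  by apply: (measurableT_comp (@measurable_expR R)); exact: oppr_measurable.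
rewrite integral_mkcond; apply: eq_integral => u _.
rewrite /exponential_pdf /patch; case: ifP => // _.
by rewrite subrr powRr0 !mul1r mulN1r.
Qed.

Lemma beta_conv1 a : 0 < a -> beta_conv a 1 1 = (a^-1)%:E.
Proof.
move=> a0; rewrite -(integral_powR01 a0) -integral_itv_bndo_bndc; last first.
  by apply: measurable_funTS; apply/measurable_EFinP; exact: (@measurable_powR R).
rewrite [RHS]integral_mkcond; apply: eq_integral => u _.
rewrite patchE mem_setE in_itv /= /power_kernel subr_gt0 subrr powRr0.
by case: (0 < u); case: (u < 1); rewrite /= ?mulr1 ?mulr0 ?mul0r.
Qed.

Lemma gamma_integralS a : 0 < a -> (gamma_integral (a + 1) = a%:E * gamma_integral a)%E.
Proof.
move=> a0; have := gamma_integralM a 1; rewrite gamma_integral1 mule1 => ->.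
by rewrite beta_conv1 // muleA -EFinM mulfV ?gt_eqF // mul1e.
Qed.

(** On the interval from 0 to 1 the exponential is at least exp(-1), and [beta_conv a 1 1] is the
    integral of u^(a - 1) there. *)
Lemma gamma_integral_gt0 a : 0 < a -> (0 < gamma_integral a)%E.
Proof.
move=> a0.
have : (0 < (expR (-1))%:E * beta_conv a 1 1)%E.
  by rewrite beta_conv1 // -EFinM lte_fin mulr_gt0 ?expR_gt0 ?invr_gt0.
move/lt_le_trans; apply.
rewrite -(ge0_integralZl_EFin mu measurableT (fun u _ => beta_kernel_ge0 a 1 1 u)
  (measurable_beta_kernel a 1 1) (expR_ge0 _)).
apply: ge0_le_integral => //.
- by move=> u _; rewrite -EFinM lee_fin !mulr_ge0 ?expR_ge0 ?power_kernel_ge0.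
- by apply: emeasurable_funM => //; exact: measurable_beta_kernel.
- by apply/measurable_EFinP; exact: measurable_gamma_kernel.
move=> u _; rewrite -EFinM lee_fin /gamma_kernel mulrC -mulrA.
rewrite ler_wpM2l ?power_kernel_ge0 // {1}/power_kernel subr_gt0 subrr powRr0.
by case: ifP => [u1|_]; rewrite ?mul0r ?expR_ge0 // mul1r ler_expR lerN2 ltW.
Qed.

Lemma gamma_integral_natS n : (gamma_integral n.+1%:R < +oo)%E.
Proof.
elim: n => [|n IH]; first by rewrite gamma_integral1 ltry.
by rewrite -natr1 gamma_integralS // lte_mul_pinfty // ?lee_fin.
Qed.

(** Passing to a + 1 removes the singularity at 0; then u^a is at most 1 + u^(n + 1) for an integer
    n + 1 > a, and integer arguments are known. *)
Lemma gamma_integral_lty a : 0 < a -> (gamma_integral a < +oo)%E.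
Proof.
move=> a0.
suff : (gamma_integral (a + 1) < +oo)%E.
  rewrite gamma_integralS // => h; rewrite ltNge leye_eq; apply/eqP => e.
  by move: h; rewrite e gt0_muley ?lte_fin // ltxx.
pose n := archimedean.Num.truncn a.
have an : a < n.+1%:R by exact: archimedean.Num.Theory.truncnS_gt.
apply: (@le_lt_trans _ _ (gamma_integral 1 + gamma_integral n.+2%:R)%E); last first.
  by rewrite lte_add_pinfty //; [rewrite gamma_integral1 ltry | exact: gamma_integral_natS].
have mE c : measurable_fun [set: measurableTypeR R]
    (fun u : measurableTypeR R => (gamma_kernel c u)%:E).
  by apply/measurable_EFinP; exact: measurable_gamma_kernel.
have E0 c u : (0 <= (gamma_kernel c u)%:E)%E by rewrite lee_fin gamma_kernel_ge0.
rewrite -(ge0_integralD mu measurableT (fun u _ => E0 _ u) (mE _) (fun u _ => E0 _ u) (mE _)).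
apply: ge0_le_integral => //; first by apply: emeasurable_funD; exact: mE.
move=> u _; rewrite -EFinD lee_fin /gamma_kernel -mulrDl ler_wpM2r ?expR_ge0 //.
rewrite /power_kernel; case: ifP => [u0|]; last by rewrite addr0.
rewrite addrK subrr powRr0 -addn1 natrD addrK.
have [u1|/ltW u1] := leP 1 u.
  by rewrite (le_trans (ler_powR u1 (ltW an))) // lerDr.
apply: (@le_trans _ _ 1); last by rewrite lerDl powR_ge0.
by rewrite -(powRr0 u) ger_powR ?u0 // ltW.
Qed.

Lemma GammaE a : Gamma a = fine (gamma_integral a).
Proof. by rewrite gamma_integralE. Qed.

Lemma EFin_Gamma a : 0 < a -> (Gamma a)%:E = gamma_integral a.
Proof.
move=> a0; rewrite GammaE fineK // ge0_fin_numE ?gamma_integral_lty //.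
exact: gamma_integral_ge0.
Qed.

Lemma Gamma_gt0 a : 0 < a -> 0 < Gamma a.
Proof. by move=> a0; rewrite -lte_fin EFin_Gamma // gamma_integral_gt0. Qed.

Lemma GammaS a : 0 < a -> Gamma (a + 1) = a * Gamma a.
Proof.
move=> a0; apply: EFin_inj; rewrite EFinM !EFin_Gamma ?addr_gt0 //.
exact: gamma_integralS.
Qed.

Lemma beta_conv_Gamma a b T : 0 < a -> 0 < b ->
  beta_conv a b T = (power_kernel (a + b) T * (Gamma a * Gamma b / Gamma (a + b)))%:E.
Proof.
move=> a0 b0; have ab0 := addr_gt0 a0 b0; rewrite beta_convE EFinM; congr (_ * _)%E.
have G0 := Gamma_gt0 ab0.
rewrite 2!EFinM !EFin_Gamma // gamma_integralM -EFin_Gamma // -muleA -EFinM.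
by rewrite divff ?mule1 // gt_eqF.
Qed.

End gamma_function.

Section simplex_integral.
Variable R : realType.
Local Notation mu := (@lebesgue_measure R).

Lemma ge0_integral_lebesgue_tupleS n (f : n.+1.-tuple R -> \bar R) :
  measurable_fun setT f -> (forall v, (0 <= f v)%E) ->
  (\int[lebesgue_tuple R n.+1]_v f v =
   \int[mu]_t \int[lebesgue_tuple R n]_v f [tuple of t :: v])%E.
Proof.
move=> mf f0.
transitivity (\int[image_measure (mu \x lebesgue_tuple R n)%E (@measurable_cons_pair R n)]_v f v)%E.
  by apply: eq_measure_integral.
rewrite ge0_integral_image_measure //.
rewrite fubini_tonelli1 //.
by apply: measurableT_comp => //; exact: measurable_cons_pair.
Qed.

(** The size T is a parameter for the sake of the induction: fixing the first coordinate t leaves a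
    simplex of size T - t, and integrating over t is then a [beta_conv]. *)
Definition simplex_kernel n (s : 'I_n -> R) b T (v : n.-tuple R) : R :=
  power_kernel b (T - \sum_(i < n) tnth v i) * \prod_(i < n) power_kernel (s i) (tnth v i).

Lemma simplex_kernel_ge0 n (s : 'I_n -> R) b T v : 0 <= simplex_kernel s b T v.
Proof. by rewrite mulr_ge0 ?prodr_ge0 // => *; rewrite power_kernel_ge0. Qed.

Lemma measurable_simplex_kernel n (s : 'I_n -> R) b T :
  measurable_fun setT (simplex_kernel s b T).
Proof.
apply: measurable_funM.
  apply: (measurableT_comp (@measurable_power_kernel R b)).
  apply: measurable_funB; first exact: measurable_cst.
  by apply: measurable_sum => i; exact: measurable_tnth.
apply: measurable_prod => i _.
by apply: (measurableT_comp (@measurable_power_kernel R (s i))); exact: measurable_tnth.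
Qed.

Lemma simplex_integral n (s : 'I_n -> R) b T : 0 < b -> (forall i, 0 < s i) ->
  (\int[lebesgue_tuple R n]_v (simplex_kernel s b T v)%:E)%E =
  (power_kernel (b + \sum_(i < n) s i) T *
   (Gamma b * \prod_(i < n) Gamma (s i) / Gamma (b + \sum_(i < n) s i)))%:E.
Proof.
elim: n s T => [|n IH] s T b0 s0.
  rewrite integral_dirac //=; last first.
    by apply/measurable_EFinP; exact: measurable_simplex_kernel.
  rewrite diracT mul1e /simplex_kernel !big_ord0 subr0 addr0 !mulr1 divff ?mulr1 //.
  by rewrite gt_eqF // Gamma_gt0.
rewrite ge0_integral_lebesgue_tupleS; last 2 first.
- by apply/measurable_EFinP; exact: measurable_simplex_kernel.
- by move=> v; rewrite lee_fin simplex_kernel_ge0.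
pose s' i := s (lift ord0 i).
pose B := b + \sum_(i < n) s' i.
have B0 : 0 < B by rewrite ltr_pwDl // sumr_ge0 // => i _; exact/ltW/s0.
pose C := Gamma b * \prod_(i < n) Gamma (s' i) / Gamma B.
transitivity (C%:E * beta_conv (s ord0) B T)%E.
  have C0 : 0 <= C.
    have G c (c0 : 0 < c) := ltW (Gamma_gt0 c0).
    apply: divr_ge0; last exact: G.
    by apply: mulr_ge0; [exact: G | apply: prodr_ge0 => i _; exact/G/s0].
  rewrite -(ge0_integralZl_EFin mu measurableT
    (fun u _ => beta_kernel_ge0 (s ord0) B T u) (measurable_beta_kernel _ _ _) C0).
  apply: eq_integral => t _.
  transitivity ((power_kernel (s ord0) t)%:E *
      \int[lebesgue_tuple R n]_v (simplex_kernel s' b (T - t) v)%:E)%E.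
    rewrite -(ge0_integralZl_EFin _ measurableT _ _ (power_kernel_ge0 _ _)).
    - apply: eq_integral => v _; rewrite -EFinM; congr EFin.
      rewrite /simplex_kernel !big_ord_recl tnth0 opprD addrA mulrCA.
      by congr (_ * (power_kernel b (_ - _) * _)); apply: eq_bigr => i _; rewrite tnthS.
    - by move=> v _; rewrite lee_fin simplex_kernel_ge0.
    - by apply/measurable_EFinP; exact: measurable_simplex_kernel.
  rewrite IH //; last by move=> i; exact: s0.
  rewrite -!EFinM; congr EFin.
  by rewrite -/B -/C; ring.
rewrite beta_conv_Gamma // -EFinM; congr EFin.
rewrite !big_ord_recl -/s' (_ : b + (s ord0 + _) = s ord0 + B); last by rewrite /B addrCA.
rewrite /C mulrCA; congr (_ * _).
have /gt_eqF/negbT G0 := Gamma_gt0 B0.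
rewrite [LHS]mulrA; congr (_ / _).
by rewrite [X in _ * X = _]mulrC [LHS]mulrA divfK // -mulrA [_ * Gamma (s ord0)]mulrC.
Qed.

End simplex_integral.

Section dirichlet_moments.
Variables (R : realType) (N : nat) (s : 'I_N.+1 -> R).
Hypothesis s_gt0 : forall i, 0 < s i.
Local Notation lebesgue := (lebesgue_tuple R N).

Lemma Gamma_rising (a : R) n : 0 < a -> Gamma (a + n%:R) = rising a n * Gamma a.
Proof.
move=> a0; elim: n => [|n IH]; first by rewrite addr0 rising0 mul1r.
rewrite -natr1 addrA GammaS; last by rewrite ltr_wpDr.
by rewrite IH risingS mulrA [X in X * Gamma a]mulrC.
Qed.

Lemma barycentric0 (v : N.-tuple R) : tnth (barycentric v) ord0 = 1 - \sum_(i < N) tnth v i.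
Proof. exact: tnth0. Qed.

Lemma barycentricS (v : N.-tuple R) i : tnth (barycentric v) (lift ord0 i) = tnth v i.
Proof. exact: tnthS. Qed.

Lemma sum_barycentric (v : N.-tuple R) : \sum_(i < N.+1) tnth (barycentric v) i = 1.
Proof.
by rewrite big_ord_recl (eq_bigr _ (fun i _ => barycentricS v i)) barycentric0 subrK.
Qed.

Lemma open_simplex_barycentric (v : N.-tuple R) :
  open_simplex (barycentric v) <-> forall i, 0 < tnth (barycentric v) i.
Proof. by split=> [[]|h] //; split=> //; exact: sum_barycentric. Qed.

(** The Dirichlet density extended by 0 off the simplex, so that all integrals run over the whole
    space. *)
Definition dirichlet_weight (v : N.-tuple R) : R :=
  Gamma (\sum_i s i) / \prod_i Gamma (s i) *
  \prod_i power_kernel (s i) (tnth (barycentric v) i).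

Lemma sum_parameters_gt0 : 0 < \sum_i s i.
Proof. by rewrite big_ord_recl ltr_pwDl // sumr_ge0 // => i _; exact/ltW/s_gt0. Qed.

Lemma prod_Gamma_gt0 : 0 < \prod_i Gamma (s i).
Proof. by apply: prodr_gt0 => i _; exact/Gamma_gt0/s_gt0. Qed.

Lemma dirichlet_weight_ge0 v : 0 <= dirichlet_weight v.
Proof.
rewrite mulr_ge0 ?divr_ge0 ?(ltW prod_Gamma_gt0) ?(ltW (Gamma_gt0 sum_parameters_gt0)) //.
by apply: prodr_ge0 => i _; exact: power_kernel_ge0.
Qed.

Lemma dirichlet_weight_out v : ~ open_simplex (barycentric v) -> dirichlet_weight v = 0.
Proof.
move=> nv; have [i hi] : exists i, ~~ (0 < tnth (barycentric v) i).
  apply/existsP; rewrite -negb_forall; apply/forallP => h.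
  by apply: nv; apply/open_simplex_barycentric.
by rewrite /dirichlet_weight [X in _ * X](bigD1 i) //= {1}/power_kernel (negbTE hi) mul0r mulr0.
Qed.

Lemma dirichlet_weight_in v : open_simplex (barycentric v) ->
  dirichlet_weight v = dirichlet_density s (barycentric v).
Proof.
case=> v0 _; rewrite /dirichlet_weight /dirichlet_density; congr (_ * _).
by apply: eq_bigr => i _; rewrite /power_kernel v0.
Qed.

Lemma prod_power_kernel_barycentric (a : 'I_N.+1 -> R) v :
  \prod_i power_kernel (a i) (tnth (barycentric v) i) =
  simplex_kernel (a \o lift ord0) (a ord0) 1 v.
Proof.
rewrite big_ord_recl barycentric0 /simplex_kernel; congr (_ * _).
by apply: eq_bigr => i _; rewrite barycentricS.
Qed.

Lemma measurable_dirichlet_weight : measurable_fun setT dirichlet_weight.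
Proof.
apply: measurable_funM; first exact: measurable_cst.
under eq_fun do rewrite prod_power_kernel_barycentric.
exact: measurable_simplex_kernel.
Qed.

Lemma integral_prod_power_kernel (a : 'I_N.+1 -> R) : (forall i, 0 < a i) ->
  (\int[lebesgue]_v (\prod_i power_kernel (a i) (tnth (barycentric v) i))%:E)%E =
  (\prod_i Gamma (a i) / Gamma (\sum_i a i))%:E.
Proof.
move=> a0; under eq_integral do rewrite prod_power_kernel_barycentric.
rewrite simplex_integral //; last by move=> i; exact: a0.
by rewrite [in RHS]big_ord_recl [in RHS]big_ord_recl /power_kernel ltr01 powR1 mul1r.
Qed.

Lemma monomial_weight (m : multinom N.+1) v :
  meval (tnth (barycentric v)) (mpolyX R m) * dirichlet_weight v =
  Gamma (\sum_i s i) / \prod_i Gamma (s i) *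
  \prod_i power_kernel (s i + (m i)%:R) (tnth (barycentric v) i).
Proof.
rewrite mevalX mulrCA -big_split; congr (_ * _); apply: eq_bigr => i _ /=.
rewrite /power_kernel; case: ifP => [v0|]; last by rewrite mulr0.
rewrite -powR_mulrn ?ltW // -powRD ?(gt_eqF v0) ?implybT //.
by congr powR; ring.
Qed.

Lemma integral_monomial (m : multinom N.+1) :
  (\int[lebesgue]_v
     (meval (tnth (barycentric v)) (mpolyX R m) * dirichlet_weight v)%:E)%E =
  (dirichlet_moment s m)%:E.
Proof.
under eq_integral do rewrite monomial_weight EFinM.
have sm i : 0 < s i + (m i)%:R by rewrite ltr_wpDr.
rewrite ge0_integralZl_EFin //; first last.
- by rewrite divr_ge0 ?(ltW prod_Gamma_gt0) ?(ltW (Gamma_gt0 sum_parameters_gt0)).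
- apply/measurable_EFinP; under eq_fun do rewrite prod_power_kernel_barycentric.
  exact: measurable_simplex_kernel.
- by move=> v _; rewrite lee_fin prodr_ge0 // => i _; exact: power_kernel_ge0.
rewrite integral_prod_power_kernel // -EFinM; congr EFin.
have -> : \sum_i (s i + (m i)%:R) = \sum_i s i + (mdeg m)%:R.
  by rewrite big_split /= -natr_sum -mdegE.
have -> : \prod_i Gamma (s i + (m i)%:R) = \prod_i rising (s i) (m i) * \prod_i Gamma (s i).
  by rewrite -big_split; apply: eq_bigr => i _; exact: Gamma_rising.
rewrite Gamma_rising ?sum_parameters_gt0 // /dirichlet_moment.
have S0 : Gamma (\sum_i s i) != 0 by rewrite gt_eqF // Gamma_gt0 // sum_parameters_gt0.
have P0 := lt0r_neq0 prod_Gamma_gt0.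
have r0 := lt0r_neq0 (rising_gt0 (mdeg m) sum_parameters_gt0).
have cancel (g p x y : R) : g != 0 -> p != 0 -> y != 0 -> g / p * (x * p / (y * g)) = x / y.
  by move=> *; field; apply/and3P; split.
exact: cancel.
Qed.

Lemma integrable_monomial (m : multinom N.+1) :
  lebesgue.-integrable setT (fun v =>
     (meval (tnth (barycentric v)) (mpolyX R m) * dirichlet_weight v)%:E).
Proof.
have ge0 v : (0 <= (meval (tnth (barycentric v)) (mpolyX R m) * dirichlet_weight v)%:E)%E.
  rewrite lee_fin monomial_weight mulr_ge0 ?divr_ge0 ?(ltW prod_Gamma_gt0)
    ?(ltW (Gamma_gt0 sum_parameters_gt0)) //.
  by apply: prodr_ge0 => i _; exact: power_kernel_ge0.
apply/integrableP; split.
  apply/measurable_EFinP; under eq_fun do rewrite monomial_weight prod_power_kernel_barycentric.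
  by apply: measurable_funM; [exact: measurable_cst | exact: measurable_simplex_kernel].
under eq_integral do rewrite gee0_abs //.
by rewrite integral_monomial ltry.
Qed.

Lemma integral_dirichlet_mean (f : mpoly N.+1 R) :
  (\int[lebesgue]_v (meval (tnth (barycentric v)) f * dirichlet_weight v)%:E)%E =
  (dirichlet_mean s f)%:E.
Proof.
transitivity (\int[lebesgue]_v \sum_(m <- msupp f) ((mcoeff m f)%:E *
    (meval (tnth (barycentric v)) (mpolyX R m) * dirichlet_weight v)%:E))%E.
  apply: eq_integral => v _; rewrite mevalE mulr_suml -sumEFin; apply: eq_bigr => m _.
  by rewrite mevalX -EFinM -[in LHS]mulrA.
rewrite integral_sum //; last by move=> m; apply: integrableZl => //; exact: integrable_monomial.
rewrite /dirichlet_mean -sumEFin; apply: eq_bigr => m _.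
rewrite integralZl //; last exact: integrable_monomial.
by rewrite integral_monomial.
Qed.

Lemma dirichlet_mean_simplex (f : mpoly N.+1 R) :
  (forall w, (forall a, 0 < w a) -> \sum_a w a = 1 -> meval w f = 0) ->
  dirichlet_mean s f = 0.
Proof.
move=> f0; apply: EFin_inj; rewrite -integral_dirichlet_mean.
apply: integral0_eq => v _; congr EFin.
have [[v0 v1]|nv] := pselect (open_simplex (barycentric v)).
  by rewrite f0 ?mul0r.
by rewrite dirichlet_weight_out ?mulr0.
Qed.

End dirichlet_moments.

(** * The kernel as an image measure *)

Section density_measure.
Variables (d : measure_display) (T : measurableType d) (R : realType).
Variables (mu : {measure set T -> \bar R}) (dens : T -> R).
Hypothesis mdens : measurable_fun setT dens.
Hypothesis dens_ge0 : forall x, 0 <= dens x.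
Local Open Scope ereal_scope.

Definition density (A : set T) : \bar R := \int[mu]_(x in A) (dens x)%:E.

Let density0 : density set0 = 0.
Proof. exact: integral_set0. Qed.

Let density_ge0 A : 0 <= density A.
Proof. by apply: integral_ge0 => x _; rewrite lee_fin. Qed.

Let density_sigma_additive : semi_sigma_additive density.
Proof.
move=> F mF tF mUF; rewrite /density ge0_integral_bigcup //; last 2 first.
- by apply/measurable_EFinP; exact: measurable_funTS.
- by move=> x _; rewrite lee_fin.
by apply: is_cvg_ereal_nneg_natsum => n _; exact: density_ge0.
Qed.

HB.instance Definition _ := measure_function.isMeasure.Build _ _ _ density
  density0 density_ge0 density_sigma_additive.

Definition density_measure : {measure set T -> \bar R} := density.

Import HBNNSimple.

Lemma ge0_integral_density_measure (f : T -> \bar R) :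
  measurable_fun setT f -> (forall x, 0 <= f x) ->
  \int[density_measure]_x f x = \int[mu]_x (f x * (dens x)%:E).
Proof.
move=> mf f0; pose f_ := nnsfun_approx measurableT mf.
have md : measurable_fun setT (EFin \o dens) by exact/measurable_EFinP.
transitivity (limn (fun n => \int[density_measure]_x (f_ n x)%:E)).
  rewrite -monotone_convergence //.
  - apply: eq_integral => y _; apply/esym/cvg_lim => //.
    by apply: cvg_nnsfun_approx => *.
  - by move=> n; exact/measurable_EFinP/measurable_funP.
  - by move=> n y _; rewrite lee_fin.
  - by move=> y _ m n mn; rewrite lee_fin; exact/lefP/nd_nnsfun_approx.
transitivity (limn (fun n => \int[mu]_x ((f_ n x)%:E * (dens x)%:E))); last first.
  rewrite -monotone_convergence //.
  - apply: eq_integral => y _; apply/cvg_lim => //.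
    apply: cvgeZr => //; by apply: cvg_nnsfun_approx => *.
  - by move=> n; apply: emeasurable_funM => //; exact/measurable_EFinP/measurable_funP.
  - by move=> n y _; rewrite -EFinM lee_fin mulr_ge0.
  - move=> y _ m n mn; rewrite -!EFinM lee_fin ler_wpM2r //.
    exact/lefP/nd_nnsfun_approx.
congr (limn _); apply/funext => n.
transitivity (\sum_(k \in range (f_ n))
    \int[mu]_x (k%:E * ((\1_(f_ n @^-1` [set k]) x)%:E * (dens x)%:E))).
  rewrite integralT_nnsfun sintegralE; apply: eq_fsbigr => r /[!inE] -[y _ <-].
  rewrite ge0_integralZl_EFin //.
  - congr (_ * _); rewrite /density_measure /= /density integral_mkcond.
    apply: eq_integral => x _; rewrite patchE indicE; case: ifP => _.
      by rewrite mul1e.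
    by rewrite mul0e.
  - by move=> x _; rewrite -EFinM lee_fin mulr_ge0.
  - by apply: emeasurable_funM => //; exact/measurable_EFinP.
rewrite -ge0_integral_fsum //.
- apply: eq_integral => x _; rewrite [in RHS]fimfunE -fsumEFin //.
  rewrite ge0_mule_fsuml; last by move=> r; rewrite EFinM nnfun_muleindic_ge0.
  by apply: eq_fsbigr => r _; rewrite EFinM muleA.
- move=> r; apply: emeasurable_funM => //.
  by apply: emeasurable_funM => //; exact/measurable_EFinP.
- by move=> r x _; rewrite muleA mule_ge0 ?nnfun_muleindic_ge0 ?lee_fin.
Qed.

Lemma integral_density_measure (f : T -> \bar R) : measurable_fun setT f ->
  \int[density_measure]_x f x = \int[mu]_x (f x * (dens x)%:E).
Proof.
move=> mf; rewrite integralE [RHS]integralE.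
rewrite (ge0_integral_density_measure (measurable_funepos mf)) //.
rewrite (ge0_integral_density_measure (measurable_funeneg mf)) //.
congr (_ - _); apply: eq_integral => x _.
  by rewrite !funeposE maxe_pMl ?lee_fin // mul0e.
by rewrite !funenegE maxe_pMl ?lee_fin // mul0e mulNe.
Qed.

End density_measure.

Lemma integral_image_measure d d' (T : measurableType d) (T' : measurableType d')
    (R : realType) (m : {measure set T -> \bar R}) (f : T -> T')
    (mf : measurable_fun setT f) (g : T' -> \bar R) :
  measurable_fun setT g ->
  (\int[image_measure m mf]_y g y = \int[m]_x g (f x))%E.
Proof.
move=> mg; rewrite integralE [RHS]integralE.
congr (_ - _)%E.
- rewrite (ge0_integral_image_measure m mf (measurable_funepos mg) (fun x => funepos_ge0 g x)).
  by apply: eq_integral => x _; rewrite !funeposE.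
- rewrite (ge0_integral_image_measure m mf (measurable_funeneg mg) (fun x => funeneg_ge0 g x)).
  by apply: eq_integral => x _; rewrite !funenegE.
Qed.

Section ordered_roots.
Variables (R : realType) (N : nat).

Lemma ordered_rootsE (y : N.-tuple R) (p : {poly R}) :
  sorted <=%R y -> p = \prod_(a <- y) ('X - a%:P) -> ordered_roots N p = y.
Proof.
move=> sy py; apply: xget_unique; first by split.
move=> z [sz pz]; apply: val_inj => /=; apply: (sorted_eq le_trans le_anti) => //.
by apply: prod_XsubC_eq; rewrite -pz.
Qed.

Variables (x : N.-tuple R).
Hypothesis x_chamber : weyl_chamber x.
Let X := extend0 (tnth x).

Lemma extend0_mono (i j : 'I_N.+1) : (i <= j)%N -> X i <= X j.
Proof.
case: x_chamber => x0 xm; rewrite /X.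
case: (unliftP ord0 i) => [i'|] ->; case: (unliftP ord0 j) => [j'|] ->;
  rewrite ?extend0_0 ?extend0_lift //.
by rewrite /= /bump !add1n ltnS; exact: xm.
Qed.

Lemma random_polyE (w : N.+1.-tuple R) :
  random_poly x w = \sum_a tnth w a *: \prod_(l | l != a) ('X - (X l)%:P).
Proof.
apply: eq_bigr => a _; congr (_ *: _); apply: eq_bigr => l _; congr ('X - _%:P).
by case: (unliftP ord0 l) => [l'|] ->; rewrite /X ?extend0_0 ?extend0_lift ?tnthS ?tnth0.
Qed.

Lemma ordered_roots_interlacing (w : N.+1.-tuple R) : open_simplex w ->
  let y := ordered_roots N (random_poly x w) in
  [/\ random_poly x w = \prod_l ('X - (tnth y l)%:P),
      forall i, X (lift ord_max i) <= tnth y i <= X (lift ord0 i) &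
      forall i, X (lift ord_max i) < X (lift ord0 i) ->
        X (lift ord_max i) < tnth y i < X (lift ord0 i)].
Proof.
case=> w0 w1; have [y [y1 y2 y3]] := interlacing_roots extend0_mono w0 w1.
have yE : ordered_roots N (random_poly x w) = [tuple y i | i < N].
  apply: ordered_rootsE; last first.
    rewrite random_polyE y3 big_tuple; apply: eq_bigr => l _.
    by rewrite tnth_mktuple.
  apply/(sortedP 0) => i; rewrite size_tuple => iN.
  have := y1 (Ordinal (ltnW iN)); have := y1 (Ordinal iN).
  rewrite -[y (Ordinal iN)](tnth_mktuple y) -[y (Ordinal (ltnW iN))](tnth_mktuple y).
  rewrite !(tnth_nth 0) /= => /andP[h1 _] /andP[_ h2].
  apply: le_trans (le_trans h2 _) h1; apply: extend0_mono.
  by rewrite /= /bump leq0n [(N <= _)%N]leqNgt iN.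
split=> [|i|i]; rewrite yE ?tnth_mktuple ?random_polyE ?y3 //.
- by apply: eq_bigr => l _; rewrite tnth_mktuple.
- exact: y2.
Qed.

Lemma ordered_roots_weyl_chamber (w : N.+1.-tuple R) : open_simplex w ->
  weyl_chamber (ordered_roots N (random_poly x w)).
Proof.
move=> /ordered_roots_interlacing[_ h _]; split=> [i|i j].
  have /andP[h1 _] := h i; apply: le_trans h1.
  by rewrite -(extend0_0 (tnth x)); exact: extend0_mono.
rewrite leq_eqVlt => /orP[/eqP/val_inj -> //|ij].
have /andP[_ h1] := h i; have /andP[h2 _] := h j.
apply: le_trans (le_trans h1 _) h2; apply: extend0_mono.
by rewrite /= /bump leq0n [(N <= j)%N]leqNgt ltn_ord.
Qed.

Definition sign_around (k l : 'I_N) : R := if (l < k)%N then 1 else -1.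

(** For c inside the k-th gap, interlacing fixes the sign of c - y_l for every l other than k,
    namely [sign_around k l]; the sign of the polynomial at c therefore decides that of c - y_k. *)
Lemma ordered_roots_ge (w : N.+1.-tuple R) (k : 'I_N) c : open_simplex w ->
  X (lift ord_max k) < c < X (lift ord0 k) ->
  (c <= tnth (ordered_roots N (random_poly x w)) k) =
  ((\prod_(l | l != k) sign_around k l) * (random_poly x w).[c] <= 0).
Proof.
move=> /ordered_roots_interlacing; set y := ordered_roots _ _.
case=> -> h _ /andP[c1 c2]; rewrite horner_prod [X in _ * X <= _](bigD1 k) //= mulrCA -big_split /=.
rewrite hornerXsubC pmulr_lle0 ?subr_le0 //; apply: prodr_gt0 => l lk.
rewrite hornerXsubC /sign_around; case: ltnP => kl.
  rewrite mul1r subr_gt0; have /andP[_ h1] := h l.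
  apply: le_lt_trans (le_trans h1 _) c1; apply: extend0_mono.
  by rewrite /= /bump leq0n [(N <= k)%N]leqNgt ltn_ord.
rewrite mulN1r opprB subr_gt0; have /andP[h1 _] := h l.
apply: lt_le_trans c2 (le_trans _ h1); apply: extend0_mono.
by rewrite /= /bump leq0n [(N <= l)%N]leqNgt ltn_ord add1n ltn_neqAle eq_sym lk.
Qed.

End ordered_roots.

Section random_roots.
Variables (R : realType) (N : nat).
Implicit Type v : N.-tuple R.

Lemma measurable_barycentric i : measurable_fun setT (fun v => tnth (barycentric v) i).
Proof.
case: (unliftP ord0 i) => [j|] ->.
  by under eq_fun do rewrite barycentricS; exact: measurable_tnth.
under eq_fun do rewrite barycentric0.
apply: measurable_funB; first exact: measurable_cst.
by apply: measurable_sum => j; exact: measurable_tnth.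
Qed.

Definition simplex : set (N.-tuple R) := [set v | open_simplex (barycentric v)].

Lemma measurable_simplex : measurable simplex.
Proof.
rewrite (_ : simplex = \bigcap_(i in [set: 'I_N.+1])
    ((fun v => tnth (barycentric v) i) @^-1` `]0%R, +oo[)).
  apply: fin_bigcap_measurable => // i _; rewrite -[X in measurable X]setTI.
  by apply: measurable_barycentric => //; exact: measurable_itv.
apply/seteqP; split => v.
  by move/open_simplex_barycentric => h i _; rewrite /= in_itv /= andbT.
move=> h; apply/open_simplex_barycentric => i.
by have := h i I; rewrite /= in_itv /= andbT.
Qed.

Variables (x : N.-tuple R).
Hypothesis x_chamber : weyl_chamber x.

Lemma measurable_random_poly c :
  measurable_fun setT (fun v => (random_poly x (barycentric v)).[c]).
Proof.
under eq_fun do rewrite horner_sum; apply: measurable_sum => i.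
under eq_fun do rewrite hornerZ; apply: measurable_funM; last exact: measurable_cst.
exact: measurable_barycentric.
Qed.

Lemma measurable_ordered_roots k :
  measurable_fun simplex (fun v => tnth (ordered_roots N (random_poly x (barycentric v))) k).
Proof.
have mS := measurable_simplex.
apply: (measurability (@RGenCInfty.G R)) => [|/= _ [_] [c] -> <-].
  exact: RGenCInfty.measurableE.
set X := extend0 (tnth x); set B := (X in measurable X).
have BE v : B v <-> simplex v /\ c <= tnth (ordered_roots N (random_poly x (barycentric v))) k.
  split=> -[Sv]; first by rewrite /= in_itv /= andbT.
  by move=> cy; split; rewrite //= in_itv /= andbT.
(* Unless c lies strictly inside the k-th gap, interlacing alone decides the event: it is the whole
   simplex for c to the left and empty for c to the right. A degenerate gap always falls under these
   two cases. *)
have [cX|Xc] := leP c (X (lift ord_max k)).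
  rewrite (_ : B = simplex) //; apply/seteqP; split => v; first by case/BE.
  move=> Sv; apply/BE; split => //.
  have [_ /(_ k)/andP[h _] _] := ordered_roots_interlacing x_chamber Sv.
  exact: le_trans h.
have [Xc'|cX'] := leP (X (lift ord0 k)) c.
  rewrite (_ : B = set0) //; apply/seteqP; split => v // /BE[Sv cy].
  have [_ /(_ k)/andP[h1 h2] /(_ k) h3] := ordered_roots_interlacing x_chamber Sv.
  have [XX|XX] := ltP (X (lift ord_max k)) (X (lift ord0 k)).
    have /andP[_ h4] := h3 XX.
    by have := lt_le_trans h4 (le_trans Xc' cy); rewrite ltxx.
  by have := lt_le_trans (le_lt_trans (le_trans h2 XX) Xc) cy; rewrite ltxx.
pose f v := (\prod_(l | l != k) sign_around R k l) * (random_poly x (barycentric v)).[c].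
rewrite (_ : B = simplex `&` (f @^-1` `]-oo, 0%R])).
  apply: measurableI => //; rewrite -[X in measurable X]setTI.
  have mf : measurable_fun setT f.
    by apply: measurable_funM; [exact: measurable_cst | exact: measurable_random_poly].
  by apply: mf => //; exact: measurable_itv.
apply/seteqP; split => v.
  move/BE => [Sv cy]; split => //; rewrite /= in_itv /=.
  by rewrite /f -(ordered_roots_ge x_chamber) // Xc cX'.
move=> [Sv]; rewrite /= in_itv /= => fv; apply/BE; split => //.
by rewrite (ordered_roots_ge x_chamber) // Xc cX'.
Qed.

(* The value off the simplex, a null set for the Dirichlet measure, is chosen in the Weyl
   chamber. *)
Definition random_roots v : N.-tuple R :=
  if `[< simplex v >] then ordered_roots N (random_poly x (barycentric v))
  else [tuple of nseq N 0].

Lemma measurable_random_roots : measurable_fun setT random_roots.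
Proof.
apply/measurable_fun_tnthP => k.
pose f v := tnth (ordered_roots N (random_poly x (barycentric v))) k.
rewrite (_ : _ \o _ = f \_ simplex).
  apply/(measurable_restrictT f measurable_simplex); exact: measurable_ordered_roots.
apply/funext => v; rewrite /= /random_roots /patch -[v \in simplex]/(`[< simplex v >]).
by case: ifP => // _; rewrite tnth_nseq.
Qed.

Lemma random_roots_weyl_chamber v : weyl_chamber (random_roots v).
Proof.
rewrite /random_roots; case: ifPn => [/asboolP/ordered_roots_weyl_chamber|_]; first exact.
by split=> *; rewrite !tnth_nseq.
Qed.

End random_roots.

Section kernel_action.
Variables (R : realType) (N : nat).

Lemma measurable_meval (P : mpoly N R) :
  measurable_fun setT (fun y : N.-tuple R => meval (tnth y) P).
Proof.
under eq_fun do rewrite mevalE; apply: measurable_sum => m.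
apply: measurable_funM; first exact: measurable_cst.
apply: measurable_prod => i _; apply: measurable_funX; exact: measurable_tnth.
Qed.

Lemma measurable_weyl_chamber : measurable (@weyl_chamber R N).
Proof.
have meas (f : N.-tuple R -> R) : measurable_fun setT f -> measurable [set y | 0 <= f y].
  move=> mf; rewrite (_ : [set _ | _] = setT `&` f @^-1` `[0%R, +oo[).
    by apply: mf => //; exact: measurable_itv.
  by rewrite setTI; apply/seteqP; split => y; rewrite /= in_itv /= andbT.
rewrite (_ : @weyl_chamber R N =
  (\bigcap_(i in [set: 'I_N]) [set y : N.-tuple R | 0 <= tnth y i]) `&`
  (\bigcap_(i in [set: 'I_N]) \bigcap_(j in [set j : 'I_N | (i <= j)%N])
     [set y : N.-tuple R | 0 <= tnth y j - tnth y i])).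
  apply: measurableI; apply: fin_bigcap_measurable => // i _.
    by apply: (meas (fun y => tnth y i)); exact: measurable_tnth.
  apply: fin_bigcap_measurable => // j _.
  apply: (meas (fun y => tnth y j - tnth y i)).
  by apply: measurable_funB; exact: measurable_tnth.
apply/seteqP; split => y.
  by case=> y0 ym; split => i _ //= j ij; rewrite /= subr_ge0; exact: ym.
by case=> y0 ym; split => [i|i j ij]; [exact: y0 | rewrite -subr_ge0; exact: ym].
Qed.

Variables (theta alpha : R) (x : N.-tuple R).
Hypotheses (theta_gt0 : 0 < theta) (alpha_gt : -1 < alpha) (x_chamber : weyl_chamber x).
Let s := @Lambda_weights R theta alpha N.
Let s_gt0 : forall a, 0 < s a := Lambda_weights_gt0 theta_gt0 alpha_gt.
Let dirichlet_measure :=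
  density_measure (lebesgue_tuple R N) (measurable_dirichlet_weight s) (dirichlet_weight_ge0 s_gt0).

(** The two root maps differ only off the simplex, where the density is 0. *)
Lemma LambdaE : Lambda theta alpha x =
  image_measure dirichlet_measure (measurable_random_roots x_chamber).
Proof.
apply/funext => A; rewrite /Lambda /pushforward /dirichlet /=.
rewrite /image_measure /dirichlet_measure /density_measure /= /pushforward /density.
rewrite [LHS]integral_mkcond [RHS]integral_mkcond; apply: eq_integral => v _.
rewrite !patchE; have [Sv|nSv] := pselect (simplex v); last first.
  rewrite memNset; last by case.
  by rewrite dirichlet_weight_out //; case: ifP.
rewrite dirichlet_weight_in //.
have RE : random_roots x v = ordered_roots N (random_poly x (barycentric v)).
  by rewrite /random_roots asboolT.
have [Av|nAv] := pselect (A (random_roots x v)).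
  by rewrite !mem_set //; split => //=; rewrite -RE.
by rewrite !memNset // => -[_ /=]; rewrite -RE.
Qed.

Lemma kernel_action_Lambda (P g : mpoly N R) : subst_esym g = P ->
  kernel_action (@Lambda R theta alpha N) (peval P) x =
  (meval (tnth x) (average s (subst_weighted_esym g)))%:E.
Proof.
move=> gP; have mP : measurable_fun setT (fun y : N.-tuple R => (meval (tnth y) P)%:E).
  by apply/measurable_EFinP; exact: measurable_meval.
rewrite /kernel_action LambdaE integral_mkcond integral_image_measure; last first.
  apply/(measurable_restrictT _ measurable_weyl_chamber); exact: measurable_funTS.
transitivity (\int[dirichlet_measure]_v (meval (tnth (random_roots x v)) P)%:E)%E.
  apply: eq_integral => v _; rewrite patchE mem_set //.
  exact: random_roots_weyl_chamber.
rewrite integral_density_measure; last first.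
  by apply: (measurableT_comp mP); exact: measurable_random_roots.
rewrite meval_average -integral_dirichlet_mean //.
apply: eq_integral => v _; rewrite -EFinM; congr EFin.
have [Sv|nSv] := pselect (simplex v); last by rewrite dirichlet_weight_out // !mulr0.
congr (_ * _); rewrite /random_roots asboolT // -gP.
have [yE _ _] := ordered_roots_interlacing x_chamber Sv.
rewrite -(@eval_subst R N (tnth x) (tnth (barycentric v))) //.
by rewrite -random_polyE.
Qed.

Lemma jack_coefE la : jack_coef N la theta alpha =
  \prod_(i < N) (rising (tail_sum s i.+1) (nth 0%N la i) / rising (tail_sum s i) (nth 0%N la i)).
Proof.
have poch (a : R) n : 0 < a -> pochhammer a n%:R = rising a n.
  by move=> a0; rewrite /pochhammer Gamma_rising // mulfK // gt_eqF // Gamma_gt0.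
rewrite /jack_coef big_add1 /= big_mkord; apply: eq_bigr => i _.
rewrite !tail_sum_Lambda_weights ?ltn_ord // ?(ltnW (ltn_ord i)) //.
have iN : 0 <= N%:R - i.+1%:R :> R by rewrite subr_ge0 ler_nat.
have a0 : 0 < alpha + 1 by rewrite -ltrBlDr sub0r.
have i1 : i.+1%:R = i%:R + 1 :> R by rewrite -natr1.
rewrite !poch.
- congr (rising (_ * _) _ / rising (_ * _) _); last by rewrite i1; ring.
- apply: mulr_gt0 => //; rewrite (_ : _ - _ = N%:R - i.+1%:R + (alpha + 1) + 1); last by ring.
  by rewrite addr_gt0 // ltr_wpDl.
- apply: mulr_gt0 => //; rewrite (_ : _ - _ = N%:R - i.+1%:R + (alpha + 1)); last by ring.
  by rewrite ltr_wpDl.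
Qed.

End kernel_action.

Theorem theorem1p10 (R : realType) (theta alpha : R) (N : nat)
    (htheta : 0 < theta) (halpha : -1 < alpha)
    (la : seq nat) (hla : is_partition la) (hlen : (size la <= N)%N)
    (P : mpoly.mpoly N R) (hP : is_jack theta la P)
    (x : N.-tuple R) (hx : weyl_chamber x) :
  kernel_action (@Lambda R theta alpha N) (peval P) x =
  (jack_coef N la theta alpha * peval P x)%:E.
Proof.
have [Psym _ _] := hP; have [g [gP _]] := sym_fundamental Psym.
rewrite (kernel_action_Lambda htheta halpha hx gP) jack_coefE //.
have s_gt0 := Lambda_weights_gt0 (N := N) htheta halpha.
(* This is an identity of polynomials, so it can be evaluated at points of the chamber with
   coinciding or zero coordinates. *)
rewrite (average_jack htheta halpha (dirichlet_mean_simplex s_gt0) hla hlen hP gP).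
by rewrite mevalM mevalC.
Qed.
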